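(* Let $\lambda=(\lambda_1,\lambda_2,0)$ with integers $\lambda_1>\lambda_2>0$, and enumerate the basis vectors $v_0,v_1,\dots$ of $V^R_\mu(\lambda)$ on $\mathcal{O}(U_q(3))$ as $v_i=\xi_{O_2^i(\mathbf T_0)}$ (see context). Suppose these basis vectors are of type (a), and that $$v_i=(k^* )^{d_1}(-qh^* )^{d_2}a^{c_1}b^{c_2}c^{c_3}D_q^{d_1+d_2},\qquad v_{i+k}=(k^* )^{d_1+k}(-qh^* )^{d_2-k}a^{c_1}b^{c_2-k}c^{c_3+k}D_q^{d_1+d_2}$$ with $0\le k\le\min(d_2,c_2)$. (The exponent and index $k$ is an integer; the base $k$ is a generator.) Then $$\langle v_{i},v_{i+k}\rangle_L=\mathbf h(v_i^*v_{i+k})=q^{2d_1d_2+4d_1+4d_2+2c_1c_2+2c_1c_3+2c_2c_3+4c_1+4c_2+4c_3+k(d_2+c_2-k)}\,\frac{(1-q^2)^2(1-q^4)(q^2;q^2)_{d_2}(q^2;q^2)_{c_2}}{(q^2;q^2)_{d_1+d_2+1}(q^2;q^2)_{c_1+c_2+c_3+1}}$$ $$\times\sum_{j=0}^{c_3}\frac{(-1)^{j}q^{j^2-j}\binom{d_1}{j}_{q^{2}}\binom{c_3}{j}_{q^2}(q^2;q^2)_{j}}{(q^{2d_1+2d_2+2c_1+2c_3-2j+4};q^2)_{c_2+1}}\sum_{p=0}^{c_2-k}q^{(2d_1+2d_2+2c_3-2j+2)p}(q^2;q^2)_{c_1+p}(q^2;q^2)_{d_1+c_2+c_3-j-p}\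binom{c_2-k}{p}_{q^2}.$$
   Context: Let $q$ be real, $q\notin\{0,1,-1\}$. $\mathcal{O}(Mat_q(3))$ is the unital associative $\mathbb{C}$-algebra generated by $x_{i,j}$, $1\le i,j\le 3$, with relations, for $i<l$ and $j<k$: $x_{i,j}x_{l,j}=q\,x_{l,j}x_{i,j}$, $x_{i,j}x_{i,k}=q\,x_{i,k}x_{i,j}$, $x_{i,k}x_{l,j}=x_{l,j}x_{i,k}$, $x_{i,j}x_{l,k}=x_{l,k}x_{i,j}+(q-q^{-1})x_{i,k}x_{l,j}$, with algebra homomorphisms $\Delta(x_{i,j})=\sum_{p}x_{i,p}\otimes x_{p,j}$, $\varepsilon(x_{i,j})=\delta_{i,j}$. For $I=\{i_1<\dots<i_r\}$, $J=\{j_1<\dots<j_r\}$ put $\xi^I_J=\sum_{\tau\in\mathfrak S_r}(-q)^{\ell(\tau)}x_{i_1,j_{\tau(1)}}\cdots x_{i_r,j_{\tau(r)}}$ ($\ell$ = number of inversions); $D_q=\xi^{\{1,2,3\}}_{\{1,2,3\}}$ is central. Adjoin a central inverse $\mathrm{det}_q^{-1}$ of $D_q$ with $\Delta(\mathrm{det}_q^{-1})=\mathrm{det}_q^{-1}\otimes\mathrm{det}_q^{-1}$ to obtain the Hopf algebra $\mathcal{O}(GL_q(3))$. $\mathcal{O}(U_q(3))$ is this algebra with the conjugate-linear anti-multiplicative involution $x_{i,j}^*=(-q)^{j-i}\xi_{\hat j}^{\hat i}\,\mathrm{det}_q^{-1}$, $D_q^*=\mathrm{det}_q^{-1}$, where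 $\hat p=\{1,2,3\}\setminus\{p\}$. The Haar state $\mathbf h$ is the unique linear functional with $\mathbf h(1)=1$ and $(\mathrm{id}\otimes \mathbf h)\Delta(x)=\mathbf h(x)1=(\mathbf h\otimes\mathrm{id})\Delta(x)$ for all $x$; $\langle\varphi,\psi\rangle_L=\mathbf h(\varphi^*\psi)$. Generators are renamed $\begin{bmatrix} x_{1,1} & x_{1,2} & x_{1,3} \\ x_{2,1} & x_{2,2} & x_{2,3} \\ x_{3,1} & x_{3,2} & x_{3,3} \end{bmatrix}=\begin{bmatrix} a & b & c \\ d & e & f \\ g & h & k \end{bmatrix}$ (the Haar state is boldface to distinguish it from the generator $h$). For $\lambda=(\lambda_1,\lambda_2,0)$ and a semistandard Young tableau $\mathbf T$ of shape $\lambda$ with entries in $\{1,2,3\}$ and column contents $J_1,\dots,J_{\lambda_1}$ (left to right), put $\xi_{\mathbf T}=\xi^{\{1,\dots,|J_1|\}}_{J_1}\cdots\xi^{\{1,\dots,|J_{\lambda_1}|\}}_{J_{\lambda_1}}$. The $\xi_{\mathbf T}$ form a basis of an irreducible right co-module $V^R(\lambda)$, and $V^R_\mu(\lambda)$ is the span of those $\xi_{\mathbf T}$ with $\mathbf T$ of content $\mu$. Columns correspond to $\xi_{\{1,2\}}^{\{1,2\}}=k^*D_q$, $\xi^{\{1,2\}}_{\{1,3\}}=-qh^*D_q$, $\xi^{\{1,2\}}_{\{2,3\}}=q^2g^*D_q$, $\xi^{\{1\}}_{\{1\}}=a$, $\xi^{\{1\}}_{\{2\}}=b$, $\xi^{\{1\}}_{\{3\}}=c$.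 Type (a): $\mathbf T$ has first row $1^{d_1+d_2+c_1}2^{c_2}3^{c_3}$ and second row $2^{d_1}3^{d_2}$, so $\xi_{\mathbf T}=(k^* )^{d_1}(-qh^* )^{d_2}a^{c_1}b^{c_2}c^{c_3}D_q^{d_1+d_2}$. The operation $O_2$ switches a box labelled $2$ in the first row with a box labelled $3$ in the second row. $\mathbf T_0$ is the tableau of content $\mu$ with the largest number of boxes labelled $2$ in the first row, and $v_i=\xi_{O_2^i(\mathbf T_0)}$. Notation: $(x;p)_N=\prod_{i=0}^{N-1}(1-xp^i)$, $(x;p)_0=1$; $\binom{N}{j}_{q^2}=\frac{(q^2;q^2)_N}{(q^2;q^2)_j(q^2;q^2)_{N-j}}$ for $0\le j\le N$ and $0$ for other integers $j$. *)

(* Defs.v *)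
From HB Require Import structures.
From mathcomp Require Import all_boot all_order all_algebra.
From mathcomp Require Import fingroup perm.
From mathcomp Require Import finmap generic_quotient ring_quotient.
From mathcomp Require Import monalg.
From mathcomp Require Import boolp reals.
From mathcomp Require Import complex.

Set Implicit Arguments.
Unset Strict Implicit.
Unset Printing Implicit Defensive.

Import Order.TTheory GRing.Theory Num.Theory.
Local Open Scope ring_scope.
Local Open Scope quotient_scope.

Lemma linearDZ (K : fieldType) (U V : lmodType K) (f : U -> V) : linear f ->
  [/\ {morph f : u v / u + v}, forall c, {morph f : u / c *: u} & f 0 = 0].
Proof.
move=> fl; pose F := GRing.isLinear.Build K U V *:%R f fl.
pose g : {linear U -> V} := HB.pack f F.
split; [exact: (linearD g) | exact: (linearZ_LR g) | exact: (linear0 g)].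
Qed.

Section LinearQuotient.
Variables (K : fieldType) (V : lmodType K) (S : V -> Prop).

Definition in_span (v : V) : Prop :=
  exists s : seq (K * V),
    (forall p, p \in s -> S p.2) /\ v = \sum_(p <- s) p.1 *: p.2.

Lemma in_span0 : in_span 0.
Proof. by exists [::]; split=> //; rewrite big_nil. Qed.

Lemma in_spanD u v : in_span u -> in_span v -> in_span (u + v).
Proof.
move=> [s [hs ->]] [t [ht ->]]; exists (s ++ t); split; last by rewrite big_cat.
by move=> p; rewrite mem_cat => /orP[/hs|/ht].
Qed.

Lemma in_spanZ c v : in_span v -> in_span (c *: v).
Proof.
move=> [s [hs ->]]; exists [seq (c * p.1, p.2) | p <- s]; split.
  by move=> p /mapP[p' /hs ? ->].
by rewrite big_map scaler_sumr; apply: eq_bigr => p _; rewrite scalerA.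
Qed.

Lemma in_span_gen v : S v -> in_span v.
Proof.
move=> hv; exists [:: (1, v)]; split; last by rewrite big_seq1 scale1r.
by move=> p; rewrite inE => /eqP ->.
Qed.

Definition spanp : V -> bool := fun v => `[< in_span v >].

Lemma spanp_zmod_closed : zmod_closed (spanp : {pred V}).
Proof.
split; first by apply/asboolP; apply: in_span0.
move=> u v /asboolP hu /asboolP hv; apply/asboolP.
by rewrite -scaleN1r; apply: in_spanD => //; apply: in_spanZ.
Qed.
HB.instance Definition _ := GRing.isZmodClosed.Build V spanp spanp_zmod_closed.

Definition span_closed : zmodClosed V := GRing.ZmodClosed.clone V spanp _.

Definition lquot : Type := Quotient.quot span_closed.
HB.instance Definition _ := Choice.on lquot.
End LinearQuotient.

(* The quotient maps and operations are sealed by [HB.lock] so that unification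
   never unfolds them down to the representation of free modules *)
HB.lock Definition lpi (K : fieldType) (V : lmodType K) (S : V -> Prop) (v : V) :
  lquot S := \pi_(Quotient.quot (span_closed S)) v.

HB.lock Definition lrepr (K : fieldType) (V : lmodType K) (S : V -> Prop)
  (x : lquot S) : V := repr (x : Quotient.quot (span_closed S)).

HB.lock Definition ladd (K : fieldType) (V : lmodType K) (S : V -> Prop)
  (x y : lquot S) : lquot S := lpi S (lrepr x + lrepr y).

HB.lock Definition lopp (K : fieldType) (V : lmodType K) (S : V -> Prop)
  (x : lquot S) : lquot S := lpi S (- lrepr x).

HB.lock Definition lscale (K : fieldType) (V : lmodType K) (S : V -> Prop)
  (c : K) (x : lquot S) : lquot S := lpi S (c *: lrepr x).

Section LinearQuotientTheory.
Variables (K : fieldType) (V : lmodType K) (S : V -> Prop).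
Local Notation lquot := (lquot S).
Local Notation lpi := (lpi S).

Lemma lreprK : cancel (@lrepr K V S) lpi.
Proof.
by move=> x; rewrite lpi.unlock lrepr.unlock; exact: (@reprK _ (Quotient.quot _)).
Qed.

Lemma lpiP u v : (lpi u = lpi v) <-> in_span S (u - v).
Proof.
rewrite lpi.unlock; split=> [/eqP|h].
  by rewrite -(Quotient.idealrBE (span_closed S)) => /asboolP.
by apply/eqP; rewrite -(Quotient.idealrBE (span_closed S)); apply/asboolP.
Qed.

Lemma lpi_repr v : in_span S (lrepr (lpi v) - v).
Proof. by apply/lpiP; rewrite lreprK. Qed.

Lemma lpi_surj (x : lquot) : exists u, x = lpi u.
Proof. by exists (lrepr x); rewrite lreprK. Qed.

Lemma lpi_add u v : ladd (lpi u) (lpi v) = lpi (u + v).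
Proof.
rewrite ladd.unlock; apply/lpiP; rewrite opprD addrACA.
by apply: in_spanD; exact: lpi_repr.
Qed.

Lemma lpi_opp u : lopp (lpi u) = lpi (- u).
Proof.
rewrite lopp.unlock; apply/lpiP; rewrite -opprD -[X in in_span _ X]scaleN1r.
exact/in_spanZ/lpi_repr.
Qed.

Lemma lpi_scale c v : lscale c (lpi v) = lpi (c *: v).
Proof.
rewrite lscale.unlock; apply/lpiP; rewrite -scalerBr.
exact/in_spanZ/lpi_repr.
Qed.

Lemma laddA : associative (@ladd K V S).
Proof.
move=> x y z; have [u ->] := lpi_surj x; have [v ->] := lpi_surj y.
by have [w ->] := lpi_surj z; rewrite !lpi_add addrA.
Qed.
Lemma laddC : commutative (@ladd K V S).
Proof.
move=> x y; have [u ->] := lpi_surj x; have [v ->] := lpi_surj y.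
by rewrite !lpi_add addrC.
Qed.
Lemma ladd0 : left_id (lpi 0) (@ladd K V S).
Proof. by move=> x; have [u ->] := lpi_surj x; rewrite lpi_add add0r. Qed.
Lemma laddN : left_inverse (lpi 0) (@lopp K V S) (@ladd K V S).
Proof. by move=> x; have [u ->] := lpi_surj x; rewrite lpi_opp lpi_add addNr. Qed.
HB.instance Definition _ := GRing.isZmodule.Build lquot laddA laddC ladd0 laddN.

Lemma lpiD u v : lpi (u + v) = lpi u + lpi v.
Proof. by rewrite -lpi_add. Qed.

Lemma lscaleA a b (x : lquot) : lscale a (lscale b x) = lscale (a * b) x.
Proof. by rewrite -[x]lreprK !lpi_scale scalerA. Qed.
Lemma lscale1 : left_id 1 (@lscale K V S).
Proof. by move=> x; rewrite -[x]lreprK lpi_scale scale1r. Qed.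
Lemma lscaleDr : right_distributive (@lscale K V S) +%R.
Proof.
move=> c x y; rewrite -[x]lreprK -[y]lreprK -lpiD !lpi_scale -lpiD.
by rewrite scalerDr.
Qed.
Lemma lscaleDl (x : lquot) : {morph (@lscale K V S)^~ x : a b / a + b}.
Proof. by move=> a b; rewrite -[x]lreprK !lpi_scale -lpiD scalerDl. Qed.

HB.instance Definition _ :=
  GRing.Zmodule_isLmodule.Build K lquot lscaleA lscale1 lscaleDr lscaleDl.

Lemma lpi_is_linear : linear lpi.
Proof. by move=> c u v; rewrite lpiD -lpi_scale. Qed.
HB.instance Definition _ := GRing.isLinear.Build K V lquot *:%R lpi lpi_is_linear.

Lemma lift_lpi (W : lmodType K) (f : {linear V -> W}) :
  (forall v, S v -> f v = 0) -> forall v, f (lrepr (lpi v)) = f v.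
Proof.
move=> fS v; apply/eqP; rewrite -subr_eq0 -linearB.
have [s [hs ->]] := lpi_repr v.
by rewrite linear_sum big_seq big1 // => p /hs /fS h; rewrite linearZ /= h scaler0.
Qed.
End LinearQuotientTheory.

Section FreeAlgebra.
Variables (K : fieldType) (G : choiceType).

Definition falg : Type := {malg K[{fmonom G}]}.
HB.instance Definition _ := GRing.Lalgebra.on falg.

Lemma falg_scaleAr (c : K) (u v : falg) : c *: (u * v) = u * (c *: v).
Proof.
have cC (w : {malg K[{fmonom G}]}) : w * c%:MP = c *: w.
  rewrite malgM_def fgmulgU malgZ_def /fgscale.
  by apply: eq_bigr => k _; rewrite mulm1 mulrC.
by rewrite -[RHS](congr1 (fun w => (u : falg) * w) (cC v)) mulrA -cC.
Qed.
HB.instance Definition _ := GRing.Lalgebra_isAlgebra.Build K falg falg_scaleAr.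
End FreeAlgebra.

HB.lock Definition fgen (K : fieldType) (G : choiceType) (i : G) : falg K G :=
  << fmu i >>.

Section FreeEvaluation.
Variables (K : fieldType) (G : choiceType).
Local Notation falg := (falg K G).
Variables (B : algType K) (g : G -> B).

Definition word_eval (m : {fmonom G}) : B := \prod_(i <- (m : seq G)) g i.

Lemma word_eval_mmorphism : mmorphism word_eval.
Proof.
split=> [m1 m2|]; rewrite /word_eval; last by rewrite fm1 big_nil.
by rewrite fmM big_cat.
Qed.
HB.instance Definition _ :=
  monalg.isMultiplicative.Build {fmonom G} B word_eval word_eval_mmorphism.

Definition free_eval : falg -> B := mmap (in_alg B) word_eval.

Lemma free_eval_gen i : free_eval (fgen K i) = g i.
Proof.
by rewrite fgen.unlock /free_eval mmapU /= scale1r mul1r /word_eval fmU big_seq1.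
Qed.

Lemma free_eval_monoid_morphism : monoid_morphism free_eval.
Proof.
have := @commr_mmap_is_multiplicative _ _ _ (in_alg B) word_eval.
case=> [u m m'|hM h1].
  by rewrite /GRing.comm /= mulr_algl mulr_algr.
by split.
Qed.
HB.instance Definition _ :=
  GRing.isZmodMorphism.Build falg B free_eval
    (@mmap_is_additive _ _ _ (in_alg B) word_eval).
HB.instance Definition _ :=
  GRing.isMonoidMorphism.Build falg B free_eval free_eval_monoid_morphism.
Lemma free_eval_scalable : scalable free_eval.
Proof. by move=> c u; rewrite /free_eval mmapZ /= mulr_algl. Qed.
HB.instance Definition _ :=
  GRing.isScalable.Build K falg B *:%R free_eval free_eval_scalable.
End FreeEvaluation.

Section QuotientAlgebra.
Variables (K : fieldType) (A : algType K) (Rel : A -> Prop).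

Definition ideal_gen (z : A) : Prop :=
  exists a r b : A, Rel r /\ z = a * r * b.

Definition qalg : Type := lquot ideal_gen.
HB.instance Definition _ := GRing.Lmodule.on qalg.

Definition qpi : A -> qalg := @lpi K A ideal_gen.
HB.instance Definition _ := GRing.Linear.on qpi.

Lemma in_idealMl a v : in_span ideal_gen v -> in_span ideal_gen (a * v).
Proof.
move=> [s [hs ->]]; exists [seq (p.1, a * p.2) | p <- s]; split.
  move=> _ /mapP[p /hs [a' [r [b [hr e]]]] ->].
  by exists (a * a'), r, b; rewrite /= e !mulrA.
by rewrite big_map mulr_sumr; apply: eq_bigr => p _; rewrite scalerAr.
Qed.

Lemma in_idealMr b v : in_span ideal_gen v -> in_span ideal_gen (v * b).
Proof.
move=> [s [hs ->]]; exists [seq (p.1, p.2 * b) | p <- s]; split.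
  move=> _ /mapP[p /hs [a [r [b' [hr e]]]] ->].
  by exists a, r, (b' * b); rewrite /= e !mulrA.
by rewrite big_map mulr_suml; apply: eq_bigr => p _; rewrite scalerAl.
Qed.

End QuotientAlgebra.

HB.lock Definition qmul (K : fieldType) (A : algType K) (Rel : A -> Prop)
  (x y : qalg Rel) : qalg Rel := qpi Rel (lrepr x * lrepr y).

Section QuotientAlgebraTheory.
Variables (K : fieldType) (A : algType K) (Rel : A -> Prop).
Local Notation qpi := (qpi Rel).
Local Notation qalg := (qalg Rel).
Local Notation qmul := (@qmul K A Rel).

Lemma qpi_mul u v : qmul (qpi u) (qpi v) = qpi (u * v).
Proof.
rewrite qmul.unlock; apply/lpiP; rewrite -(subrK (u * lrepr (qpi v)) (lrepr (qpi u) * _)).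
rewrite -mulrBl -addrA -mulrBr; apply: in_spanD.
  exact/in_idealMr/lpi_repr.
exact/in_idealMl/lpi_repr.
Qed.

Lemma qpi_surj (x : qalg) : exists u, x = qpi u.
Proof. exact: lpi_surj. Qed.

Lemma qmulA : associative qmul.
Proof.
move=> x y z; have [u ->] := qpi_surj x; have [v ->] := qpi_surj y.
by have [w ->] := qpi_surj z; rewrite !qpi_mul mulrA.
Qed.
Lemma qmul1 : left_id (qpi 1) qmul.
Proof. by move=> x; have [u ->] := qpi_surj x; rewrite qpi_mul mul1r. Qed.
Lemma qmulr1 : right_id (qpi 1) qmul.
Proof. by move=> x; have [u ->] := qpi_surj x; rewrite qpi_mul mulr1. Qed.
Lemma qmulDl : left_distributive qmul +%R.
Proof.
move=> x y z; have [u ->] := qpi_surj x; have [v ->] := qpi_surj y.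
by have [w ->] := qpi_surj z; rewrite -linearD !qpi_mul mulrDl linearD.
Qed.
Lemma qmulDr : right_distributive qmul +%R.
Proof.
move=> x y z; have [u ->] := qpi_surj x; have [v ->] := qpi_surj y.
by have [w ->] := qpi_surj z; rewrite -linearD !qpi_mul mulrDr linearD.
Qed.
HB.instance Definition _ :=
  GRing.Zmodule_isPzRing.Build qalg qmulA qmul1 qmulr1 qmulDl qmulDr.

Lemma qpi_monoid_morphism : monoid_morphism qpi.
Proof. by split=> // u v; rewrite -qpi_mul. Qed.
HB.instance Definition _ :=
  GRing.isMonoidMorphism.Build A qalg qpi qpi_monoid_morphism.

Lemma qscaleAl (c : K) (x y : qalg) : c *: (x * y) = (c *: x) * y.
Proof.
have [u ->] := qpi_surj x; have [v ->] := qpi_surj y.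
by rewrite -rmorphM -!linearZ -rmorphM /= -scalerAl.
Qed.
Lemma qscaleAr (c : K) (x y : qalg) : c *: (x * y) = x * (c *: y).
Proof.
have [u ->] := qpi_surj x; have [v ->] := qpi_surj y.
by rewrite -rmorphM -!linearZ -rmorphM /= -scalerAr.
Qed.

Lemma qpi_rel r : Rel r -> qpi r = 0.
Proof.
move=> hr; rewrite -(linear0 qpi); apply/lpiP; rewrite subr0.
by apply: in_span_gen; exists 1, r, 1; rewrite mul1r mulr1.
Qed.

Definition qalg_eval (B : algType K) (f : A -> B) (x : qalg) : B := f (lrepr x).

Lemma qalg_eval_qpi (B : algType K) (f : {lrmorphism A -> B}) :
  (forall r, Rel r -> f r = 0) -> forall u, qalg_eval f (qpi u) = f u.
Proof.
move=> fRel u; apply: (lift_lpi (f := f)) => v [a [r [b [hr ->]]]].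
by rewrite !rmorphM /= (fRel r hr) mulr0 mul0r.
Qed.
End QuotientAlgebraTheory.

Section FreeModule.
Variables (K : fieldType) (X : choiceType).

Definition fmod : Type := {malg K[X]}.
HB.instance Definition _ := GRing.Lmodule.on fmod.

End FreeModule.

HB.lock Definition fdelta (K : fieldType) (X : choiceType) (x : X) : fmod K X :=
  << x >>.

HB.lock Definition fext (K : fieldType) (X : choiceType) (U : lmodType K)
  (f : X -> U) (u : fmod K X) : U := \sum_(k <- msupp u) mcoeff k u *: f k.

Section FreeModuleTheory.
Variables (K : fieldType) (X : choiceType).
Local Notation fmod := (fmod K X).
Local Notation fdelta := (@fdelta K X).

Lemma fmodE (u : fmod) : exists s : seq (K * X), u = \sum_(p <- s) p.1 *: fdelta p.2.
Proof.
exists [seq (mcoeff k u, k) | k <- msupp u]; rewrite big_map [LHS]monalgE.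
apply: eq_bigr => k _; apply/malgP => k'.
by rewrite fdelta.unlock /= mcoeffZ !mcoeffU mulrnAr mulr1.
Qed.

Variables (U : lmodType K) (f : X -> U).
Local Notation fext := (fext f).

Lemma fextw (d : {fset X}) (u : {malg K[X]}) :
  (msupp u `<=` d)%fset -> fext u = \sum_(k <- d) mcoeff k u *: f k.
Proof.
move=> le; rewrite fext.unlock [LHS](big_fset_incl _ le) => //= x xd /mcoeff_outdom ->.
by rewrite scale0r.
Qed.

Lemma fext_linear : linear fext.
Proof.
move=> c u v; pose d := (msupp (c *: (u : {malg K[X]}) + v) `|` msupp u `|` msupp v)%fset.
rewrite (@fextw d (_ + _)) ?(@fextw d u) ?(@fextw d v).
- rewrite scaler_sumr -big_split; apply: eq_bigr => k _ /=.
  by rewrite mcoeffD mcoeffZ scalerDl scalerA.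
- exact: fsubsetUr.
- by apply: fsubset_trans (fsubsetUl _ _); exact: fsubsetUr.
- by apply: fsubset_trans (fsubsetUl _ _); exact: fsubsetUl.
Qed.
HB.instance Definition _ := GRing.isLinear.Build K fmod U *:%R fext fext_linear.

Lemma fext_delta x : fext (fdelta x) = f x.
Proof.
rewrite fdelta.unlock.
by rewrite (fextw (d := [fset x]%fset)) ?msuppU_le // big_seq_fset1 mcoeffUU scale1r.
Qed.
End FreeModuleTheory.

Section TensorProduct.
Variables (K : fieldType) (V W : lmodType K).
Local Notation d v w := (fdelta K (v, w) : fmod K (V * W)%type).

Inductive tens_rel : fmod K (V * W)%type -> Prop :=
| tens_Dl v v' w : tens_rel (d (v + v') w - (d v w + d v' w))
| tens_Dr v w w' : tens_rel (d v (w + w') - (d v w + d v w'))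
| tens_Zl c v w : tens_rel (d (c *: v) w - c *: d v w)
| tens_Zr c v w : tens_rel (d v (c *: w) - c *: d v w).

Definition tens : Type := lquot tens_rel.
HB.instance Definition _ := GRing.Lmodule.on tens.

Definition pure (v : V) (w : W) : tens := @lpi K _ tens_rel (d v w).

Local Notation tpi := (@lpi K _ tens_rel).

Lemma tpi_eq x y : tens_rel (x - y) -> tpi x = tpi y.
Proof. by move=> h; apply/lpiP/in_span_gen. Qed.

Lemma pureDl v v' w : pure (v + v') w = pure v w + pure v' w.
Proof. by rewrite -linearD; exact/tpi_eq/tens_Dl. Qed.
Lemma pureDr v w w' : pure v (w + w') = pure v w + pure v w'.
Proof. by rewrite -linearD; exact/tpi_eq/tens_Dr. Qed.
Lemma pureZl c v w : pure (c *: v) w = c *: pure v w.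
Proof. by rewrite -linearZ; exact/tpi_eq/tens_Zl. Qed.
Lemma pureZr c v w : pure v (c *: w) = c *: pure v w.
Proof. by rewrite -linearZ; exact/tpi_eq/tens_Zr. Qed.

Lemma tens_ind (P : tens -> Prop) :
  P 0 -> (forall x y, P x -> P y -> P (x + y)) -> (forall v w, P (pure v w)) ->
  forall x, P x.
Proof.
move=> P0 PD Pp x; rewrite -[x](@lreprK K _ tens_rel).
have [s ->] := fmodE (lrepr x); rewrite linear_sum.
elim/big_ind: _ => // -[c [v w]] _ /=.
by rewrite linearZ -[X in P X]pureZl; exact: Pp.
Qed.

Variables (U : lmodType K) (f : V -> W -> U).

Definition tlift (x : tens) : U :=
  fext (fun p => f p.1 p.2) (lrepr x).

Hypotheses (fl : forall w, linear (f^~ w)) (fr : forall v, linear (f v)).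

Let fDl v v' w : f (v + v') w = f v w + f v' w.
Proof. by have [h _ _] := linearDZ (fl w); exact: h. Qed.
Let fDr v w w' : f v (w + w') = f v w + f v w'.
Proof. by have [h _ _] := linearDZ (fr v); exact: h. Qed.
Let fZl c v w : f (c *: v) w = c *: f v w.
Proof. by have [_ h _] := linearDZ (fl w); exact: h. Qed.
Let fZr c v w : f v (c *: w) = c *: f v w.
Proof. by have [_ h _] := linearDZ (fr v); exact: h. Qed.

Let lift_rel (g : {linear fmod K (V * W)%type -> U}) r :
  (forall v w, g (d v w) = f v w) -> tens_rel r -> g r = 0.
Proof.
move=> gd [v v' w|v w w'|c v w|c v w].
- by rewrite linearB linearD !gd fDl subrr.
- by rewrite linearB linearD !gd fDr subrr.
- by rewrite linearB linearZ_LR !gd fZl subrr.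
- by rewrite linearB linearZ_LR !gd fZr subrr.
Qed.

Lemma tlift_tpi u : tlift (tpi u) = fext (fun p => f p.1 p.2) u.
Proof.
apply: (lift_lpi (f := fext (fun p : V * W => f p.1 p.2))) => r.
by apply: lift_rel => v w; exact: (fext_delta (fun p : V * W => f p.1 p.2)).
Qed.

Lemma tlift_pure v w : tlift (pure v w) = f v w.
Proof.
by rewrite [LHS]tlift_tpi; exact: (fext_delta (fun p : V * W => f p.1 p.2)).
Qed.

Lemma tlift_linear : linear tlift.
Proof.
move=> c x y; rewrite -[x](@lreprK K _ tens_rel) -[y](@lreprK K _ tens_rel).
by rewrite -linearP !tlift_tpi linearP.
Qed.
End TensorProduct.

Section TensorAlgebra.
Variables (K : fieldType) (A B : algType K).
Local Notation T := (tens A B).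

Definition tmul (x y : T) : T :=
  tlift (fun a b => tlift (fun a' b' => pure (a * a') (b * b')) y) x.

Let in_l a b b' : linear (fun a' : A => pure (a * a') (b * b' : B)).
Proof. by move=> c u v; rewrite mulrDr -scalerAr pureDl pureZl. Qed.
Let in_r a b a' : linear (fun b' : B => pure (a * a' : A) (b * b')).
Proof. by move=> c u v; rewrite mulrDr -scalerAr pureDr pureZr. Qed.
Let inner a b := tlift (fun (a' : A) (b' : B) => pure (a * a') (b * b')).
Let inner_lin a b : linear (inner a b).
Proof. by apply: tlift_linear. Qed.
Let inner_pure a b a' b' : inner a b (pure a' b') = pure (a * a') (b * b').
Proof. by apply: tlift_pure. Qed.
Let inner0 a b : inner a b 0 = 0.
Proof. by have [_ _ h] := linearDZ (inner_lin a b). Qed.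
Let innerD a b : {morph inner a b : x y / x + y}.
Proof. by have [h _ _] := linearDZ (inner_lin a b). Qed.
Let innerZ a b c : {morph inner a b : x / c *: x}.
Proof. by have [_ h _] := linearDZ (inner_lin a b). Qed.

Let out_l y b : linear (fun a : A => inner a b y).
Proof.
move=> c u v; elim/tens_ind: y => [|x y hx hy|a' b'].
- by rewrite !inner0 scaler0 addr0.
- by rewrite !innerD hx hy scalerDr addrACA.
- by rewrite !inner_pure mulrDl -scalerAl pureDl pureZl.
Qed.
Let out_r y a : linear (fun b : B => inner a b y).
Proof.
move=> c u v; elim/tens_ind: y => [|x y hx hy|a' b'].
- by rewrite !inner0 scaler0 addr0.
- by rewrite !innerD hx hy scalerDr addrACA.
- by rewrite !inner_pure mulrDl -scalerAl pureDr pureZr.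
Qed.

Lemma tmul_linl y : linear (tmul^~ y).
Proof. by apply: tlift_linear => [b|a]; [exact: out_l | exact: out_r]. Qed.

Let tmul_pl a b y : tmul (pure a b) y = inner a b y.
Proof. by apply: tlift_pure => [b'|a']; [exact: out_l | exact: out_r]. Qed.

Lemma tmul_pure a b a' b' :
  tmul (pure a b) (pure a' b') = pure (a * a') (b * b').
Proof. by rewrite tmul_pl inner_pure. Qed.

Lemma tmulDl : left_distributive tmul +%R.
Proof. by move=> x y z; have [h _ _] := linearDZ (tmul_linl z); exact: h. Qed.

Lemma tmul0 y : tmul 0 y = 0.
Proof. by have [_ _ h] := linearDZ (tmul_linl y); exact: h. Qed.

Lemma tmulZl c x y : tmul (c *: x) y = c *: tmul x y.
Proof. by have [_ h _] := linearDZ (tmul_linl y); exact: h. Qed.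

Lemma tmulDr : right_distributive tmul +%R.
Proof.
move=> x y z; elim/tens_ind: x => [|x x' hx hx'|a b].
- by rewrite !tmul0 addr0.
- by rewrite !tmulDl hx hx' addrACA.
- by rewrite !tmul_pl innerD.
Qed.

Lemma tmulZr c x y : tmul x (c *: y) = c *: tmul x y.
Proof.
elim/tens_ind: x => [|x x' hx hx'|a b].
- by rewrite !tmul0 scaler0.
- by rewrite !tmulDl hx hx' scalerDr.
- by rewrite !tmul_pl innerZ.
Qed.

Lemma tmulr0 x : tmul x 0 = 0.
Proof. by rewrite -[X in tmul x X](scale0r (0 : T)) tmulZr scale0r. Qed.

Lemma tmulA : associative tmul.
Proof.
move=> x y z; elim/tens_ind: x => [|x x' hx hx'|a b].
- by rewrite !tmul0.
- by rewrite !tmulDl hx hx'.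
elim/tens_ind: y => [|x x' hx hx'|a' b'].
- by rewrite tmul0 tmulr0 tmul0.
- by rewrite tmulDr !tmulDl tmulDr hx hx'.
elim/tens_ind: z => [|x x' hx hx'|a'' b''].
- by rewrite !tmulr0.
- by rewrite !tmulDr hx hx'.
by rewrite !tmul_pure !mulrA.
Qed.

Lemma tmul1 : left_id (pure 1 1) tmul.
Proof.
move=> x; elim/tens_ind: x => [|x x' hx hx'|a b]; first by rewrite tmulr0.
  by rewrite tmulDr hx hx'.
by rewrite tmul_pure !mul1r.
Qed.

Lemma tmulr1 : right_id (pure 1 1) tmul.
Proof.
move=> x; elim/tens_ind: x => [|x x' hx hx'|a b]; first by rewrite tmul0.
  by rewrite tmulDl hx hx'.
by rewrite tmul_pure !mulr1.
Qed.
HB.instance Definition _ :=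
  GRing.Zmodule_isPzRing.Build (tens A B) tmulA tmul1 tmulr1 tmulDl tmulDr.
End TensorAlgebra.

Section Relations.
Variables (K : fieldType) (q : K) (A : lalgType K).
Variables (x : 'I_3 -> 'I_3 -> A) (t : A).

Definition inversions n (s : 'S_n) : nat :=
  #|[set p : 'I_n * 'I_n | (p.1 < p.2)%N && (s p.2 < s p.1)%N]|.

(* [enum I] lists [I] in increasing order; only meant for #|I| = #|J| *)
Definition qminor (I J : {set 'I_3}) : A :=
  \sum_(s : 'S_#|I|) (- q) ^+ inversions s *:
    \prod_(p < #|I|) x (nth ord0 (enum I) p) (nth ord0 (enum J) (s p)).

Inductive GLq3_rel : A -> Prop :=
| GLq3_col (i l j : 'I_3) : (i < l)%N ->
    GLq3_rel (x i j * x l j - q *: (x l j * x i j))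
| GLq3_row (i j k : 'I_3) : (j < k)%N ->
    GLq3_rel (x i j * x i k - q *: (x i k * x i j))
| GLq3_comm (i l j k : 'I_3) : (i < l)%N -> (j < k)%N ->
    GLq3_rel (x i k * x l j - x l j * x i k)
| GLq3_cross (i l j k : 'I_3) : (i < l)%N -> (j < k)%N ->
    GLq3_rel (x i j * x l k - (x l k * x i j + (q - q^-1) *: (x i k * x l j)))
| GLq3_central (i j : 'I_3) : GLq3_rel (t * x i j - x i j * t)
| GLq3_inv : GLq3_rel (qminor setT setT * t - 1).

Section Counit.
Variable f : {lrmorphism A -> K^o}.
Hypotheses (fx : forall i j, f (x i j) = (i == j)%:R) (ft : f t = 1).

Lemma counit_qminor : f (qminor setT setT) = 1.
Proof.
rewrite /qminor linear_sum (bigD1 (1%g : 'S_#|[set: 'I_3]|)) //=.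
rewrite [X in _ + X]big1 ?addr0.
  rewrite linearZ rmorph_prod /= big1 => [|p _].
    rewrite (_ : inversions _ = 0%N) ?expr0 ?scale1r //.
    apply/eqP; rewrite cards_eq0; apply/eqP/setP=> -[i j]; rewrite !inE !perm1 /=.
    by case: ltngtP.
  by rewrite fx perm1 eqxx.
move=> s s1; rewrite linearZ rmorph_prod /=.
have [p hp] : exists p, s p != p.
  apply/existsP; apply: contraR s1 => /existsPn h.
  by apply/eqP/permP => p; rewrite perm1; apply/eqP; have := h p; rewrite negbK.
rewrite (bigD1 p) //= fx; case: eqP => [/eqP e|_]; last by rewrite mul0r scaler0.
move: e; rewrite nth_uniq ?enum_uniq -?cardE // => /eqP/val_inj e.
by rewrite -e eqxx in hp.
Qed.

Lemma counit_rel r : GLq3_rel r -> f r = 0.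
Proof.
have ne (i l : 'I_3) : (i < l)%N -> ((i == l) = false) * ((l == i) = false).
  by move=> il; split; rewrite -val_eqE /= ?(gtn_eqF il) ?(ltn_eqF il).
case=> [i l j il|i j k jk|i l j k il jk|i l j k il jk|i j|].
- rewrite linearB linearZ !rmorphM /= !fx.
  have [ij|_] := eqVneq i j; last by rewrite mul0r mulr0 scaler0 subrr.
  by rewrite -ij !(ne _ _ il) ?eqxx mul0r mulr0 scaler0 subrr.
- rewrite linearB linearZ !rmorphM /= !fx.
  have [ij|_] := eqVneq i j; last by rewrite mul0r mulr0 scaler0 subrr.
  by rewrite ij !(ne _ _ jk) ?eqxx mul0r mulr0 scaler0 subrr.
- by rewrite linearB !rmorphM /= !fx mulrC subrr.
- rewrite linearB linearD linearZ !rmorphM /= !fx.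
  rewrite [X in X - _]mulrC opprD addNKr.
  have [ik|_] := eqVneq i k; last by rewrite mul0r scaler0 oppr0.
  have jl : (j < l)%N by apply: ltn_trans il; rewrite ik.
  by rewrite !(ne _ _ jl) mulr0 scaler0 oppr0.
- by rewrite linearB !rmorphM /= ft mul1r mulr1 subrr.
- by rewrite linearB rmorphM rmorph1 /= ft counit_qminor mul1r subrr.
Qed.
End Counit.
End Relations.

Lemma GLq3_rel_morph (K : fieldType) (q : K) (A B : lalgType K)
    (f : {lrmorphism A -> B}) (x : 'I_3 -> 'I_3 -> A) (t : A) (r : B) :
  GLq3_rel q (fun i j => f (x i j)) (f t) r ->
  exists2 r', GLq3_rel q x t r' & r = f r'.
Proof.
case=> [i l j il|i j k jk|i l j k il jk|i l j k il jk|i j|].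
- by eexists; [exact: (@GLq3_col _ _ _ _ _ i l j il) | rewrite (linearB f) (linearZ_LR f) !(rmorphM f)].
- by eexists; [exact: (@GLq3_row _ _ _ _ _ i j k jk) | rewrite (linearB f) (linearZ_LR f) !(rmorphM f)].
- by eexists; [exact: GLq3_comm il jk | rewrite (linearB f) !(rmorphM f)].
- eexists; first exact: GLq3_cross il jk.
  by rewrite (linearB f) (linearD f) (linearZ_LR f) !(rmorphM f).
- by eexists; [exact: (@GLq3_central _ _ _ _ _ i j) | rewrite (linearB f) !(rmorphM f)].
- eexists; first exact: GLq3_inv.
  rewrite (linearB f) (rmorphM f) (rmorph1 f) /qminor (raddf_sum f).
  congr (_ * _ - _); apply: eq_bigr => s _.
  by rewrite [RHS](linearZ_LR f) -(rmorph_prod f).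
Qed.

Section GLq3.
Variables (K : fieldType) (q : K).

(* [Some (i, j)] indexes x_{i,j}, and [None] indexes det_q^{-1} *)
Definition GLq3_free : algType K := falg K (option ('I_3 * 'I_3)).
Definition free_x (i j : 'I_3) : GLq3_free := fgen K (Some (i, j)).
Definition free_dinv : GLq3_free := fgen K None.

Definition GLq3 : Type := qalg (GLq3_rel q free_x free_dinv).
HB.instance Definition _ := GRing.Lmodule.on GLq3.
HB.instance Definition _ := GRing.PzRing.on GLq3.

Definition GLq3_pi : GLq3_free -> GLq3 := @qpi K _ (GLq3_rel q free_x free_dinv).

Definition counit_gen (o : option ('I_3 * 'I_3)) : K^o :=
  if o is Some (i, j) then (i == j)%:R else 1.

Lemma counit_free r : GLq3_rel q free_x free_dinv r -> free_eval counit_gen r = 0.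
Proof.
apply: (counit_rel (f := free_eval counit_gen)) => [i j|].
  exact: (free_eval_gen counit_gen (Some (i, j))).
exact: (free_eval_gen counit_gen None).
Qed.

Definition counit : GLq3 -> K^o := qalg_eval (free_eval counit_gen).

Lemma counit_pi u : counit (GLq3_pi u) = free_eval counit_gen u.
Proof. exact: qalg_eval_qpi counit_free u. Qed.

Lemma counit1 : counit 1 = 1.
Proof. by rewrite [LHS](counit_pi 1) rmorph1. Qed.

Lemma counit_linear : linear counit.
Proof.
move=> c x y; have [u ->] := qpi_surj x; have [v ->] := qpi_surj y.
rewrite -[_ + _](linearP (qpi (GLq3_rel q free_x free_dinv))).
by rewrite !counit_pi linearP.
Qed.
HB.instance Definition _ :=
  GRing.isLinear.Build K GLq3 K^o *:%R counit counit_linear.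

Lemma GLq3_oner_neq0 : (1 : GLq3) != 0.
Proof.
apply/eqP => /(congr1 counit); rewrite counit1 linear0.
by apply/eqP/oner_neq0.
Qed.
HB.instance Definition _ := GRing.PzSemiRing_isNonZero.Build GLq3 GLq3_oner_neq0.
HB.instance Definition _ :=
  GRing.Lmodule_isLalgebra.Build K GLq3 (@qscaleAl K _ (GLq3_rel q free_x free_dinv)).
HB.instance Definition _ :=
  GRing.Lalgebra_isAlgebra.Build K GLq3 (@qscaleAr K _ (GLq3_rel q free_x free_dinv)).

HB.instance Definition _ := GRing.LRMorphism.on GLq3_pi.

Definition xg (i j : 'I_3) : GLq3 := GLq3_pi (free_x i j).
Definition dinv : GLq3 := GLq3_pi free_dinv.
Definition xi (I J : {set 'I_3}) : GLq3 := qminor q xg I J.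
Definition Dq : GLq3 := xi setT setT.

Lemma GLq3_relP r : GLq3_rel q xg dinv r -> r = 0.
Proof.
by move=> /(GLq3_rel_morph (f := GLq3_pi)) [r' hr' ->]; exact: qpi_rel.
Qed.

Lemma counitM x y : counit (x * y) = counit x * counit y.
Proof.
have [u ->] := qpi_surj x; have [v ->] := qpi_surj y.
by rewrite -rmorphM !counit_pi rmorphM.
Qed.
Lemma counit_monoid_morphism : monoid_morphism counit.
Proof. by split; [exact: counit1 | exact: counitM]. Qed.
HB.instance Definition _ :=
  GRing.isMonoidMorphism.Build GLq3 K^o counit counit_monoid_morphism.

Lemma counit_xg i j : counit (xg i j) = (i == j)%:R.
Proof. by rewrite counit_pi free_eval_gen. Qed.
End GLq3.

Section GLq3Tensor.
Variables (K : fieldType) (q : K).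

Definition GLq3_tens : Type := tens (GLq3 q) (GLq3 q).
HB.instance Definition _ := GRing.Lmodule.on GLq3_tens.
HB.instance Definition _ := GRing.PzRing.on GLq3_tens.

Lemma GLq3_tens_oner_neq0 : (1 : GLq3_tens) != 0.
Proof.
pose f (a b : GLq3 q) : K^o := counit a * counit b.
have fl b : linear (f^~ b).
  by move=> c u v; rewrite /f linearP mulrDl scalerAl.
have fr a : linear (f a).
  by move=> c u v; rewrite /f linearP mulrDr scalerAr.
have [_ _ f0] := linearDZ (tlift_linear fl fr).
apply/eqP => /(congr1 (tlift f)); rewrite [RHS]f0 [LHS](tlift_pure fl fr 1 1).
by rewrite /f rmorph1 mulr1; apply/eqP/oner_neq0.
Qed.
HB.instance Definition _ :=
  GRing.PzSemiRing_isNonZero.Build GLq3_tens GLq3_tens_oner_neq0.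
HB.instance Definition _ :=
  GRing.Lmodule_isLalgebra.Build K GLq3_tens (fun c x y => esym (@tmulZl K _ _ c x y)).
HB.instance Definition _ :=
  GRing.Lalgebra_isAlgebra.Build K GLq3_tens (fun c x y => esym (@tmulZr K _ _ c x y)).

(* [id_tens h] is id (x) h and [tens_id h] is h (x) id *)
Definition id_tens (h : {scalar GLq3 q}) : GLq3_tens -> GLq3 q :=
  tlift (fun a b => h b *: a).
Definition tens_id (h : {scalar GLq3 q}) : GLq3_tens -> GLq3 q :=
  tlift (fun a b => h a *: b).

Record is_comult (Delta : {lrmorphism GLq3 q -> GLq3_tens}) : Prop := {
  comult_xg : forall i j,
    Delta (xg q i j) = \sum_p pure (xg q i p) (xg q p j) :> GLq3_tens;
  comult_dinv : Delta (dinv q) = pure (dinv q) (dinv q) :> GLq3_tens }.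

Record is_haar (Delta : {lrmorphism GLq3 q -> GLq3_tens}) (h : {scalar GLq3 q}) :
  Prop := {
  haar1 : h 1 = 1;
  haar_left : forall x, id_tens h (Delta x) = (h x)%:A;
  haar_right : forall x, tens_id h (Delta x) = (h x)%:A }.
End GLq3Tensor.

Local Open Scope complex_scope.

Section UnitaryStructure.
Variables (R : realType) (q : R).
Local Notation O := (GLq3 q%:C).

Record is_star (star : O -> O) : Prop := {
  star_conj_linear : forall (c : R[i]) u v,
    star (c *: u + v) = conjc c *: star u + star v;
  star_antimul : forall u v, star (u * v) = star v * star u;
  star_involutive : involutive star;
  star_xg : forall i j : 'I_3,
    star (xg q%:C i j) =
      (- q%:C) ^ ((j : nat)%:Z - (i : nat)%:Z)
        *: (xi q%:C (~: [set i]) (~: [set j]) * dinv q%:C);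
  star_Dq : star (Dq q%:C) = dinv q%:C }.

Definition innerL (star : O -> O) (h : {scalar O}) (u v : O) : R[i] :=
  h (star u * v).
End UnitaryStructure.

Definition lab1 : 'I_3 := @Ordinal 3 0 isT.
Definition lab2 : 'I_3 := @Ordinal 3 1 isT.
Definition lab3 : 'I_3 := @Ordinal 3 2 isT.

(* Tableaux with at most two rows: (first row, second row) *)
Definition tableau : Type := (seq 'I_3 * seq 'I_3)%type.

Definition semistandard (T : tableau) : bool :=
  [&& (size T.2 <= size T.1)%N,
      sorted (fun a b : 'I_3 => (a <= b)%N) T.1,
      sorted (fun a b : 'I_3 => (a <= b)%N) T.2
    & all (fun p : 'I_3 * 'I_3 => (p.1 < p.2)%N) (zip T.1 T.2)].

Definition is_ssyt (l1 l2 : nat) (mu : 'I_3 -> nat) (T : tableau) : Prop :=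
  [/\ semistandard T, size T.1 = l1, size T.2 = l2
    & forall m, count_mem m (T.1 ++ T.2) = mu m].

Definition column (T : tableau) (j : nat) : {set 'I_3} :=
  [set m | (onth T.1 j == Some m) || (onth T.2 j == Some m)].

Definition xi_tab (K : fieldType) (q : K) (T : tableau) : GLq3 q :=
  \prod_(j < size T.1)
    xi q [set m : 'I_3 | (m < #|column T j|)%N] (column T j).

Definition is_T0 (l1 l2 : nat) (mu : 'I_3 -> nat) (T0 : tableau) : Prop :=
  is_ssyt l1 l2 mu T0 /\
  forall T, is_ssyt l1 l2 mu T -> (count_mem lab2 T.1 <= count_mem lab2 T0.1)%N.

(* Rows stay weakly increasing only if the box labelled 2 is the rightmost one of
   the first row and the box labelled 3 the leftmost one of the second row. *)
Definition O2 (T : tableau) : option tableau :=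
  let T' := (set_nth lab3 T.1 (size T.1 - (index lab2 (rev T.1)).+1) lab3,
             set_nth lab2 T.2 (index lab3 T.2) lab2) in
  if [&& lab2 \in T.1, lab3 \in T.2 & semistandard T'] then Some T' else None.

(* v_i; [None] when i exceeds the number of times O_2 can be applied to T_0 *)
Definition basis_vec (K : fieldType) (q : K) (T0 : tableau) (i : nat) :
  option (GLq3 q) := omap (xi_tab q) (iter i (obind O2) (Some T0)).

Definition tabA (d1 d2 c1 c2 c3 : nat) : tableau :=
  (nseq (d1 + d2 + c1) lab1 ++ nseq c2 lab2 ++ nseq c3 lab3,
   nseq d1 lab2 ++ nseq d2 lab3).

Definition typeA (T : tableau) : Prop :=
  exists d1 d2 c1 c2 c3, T = tabA d1 d2 c1 c2 c3.

Definition qpoch (F : fieldType) (x p : F) (n : nat) : F :=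
  \prod_(i < n) (1 - x * p ^+ i).

Definition qbinom (F : fieldType) (p : F) (n j : nat) : F :=
  if (j <= n)%N then qpoch p p n / (qpoch p p j * qpoch p p (n - j)) else 0.

(* Main.v *)
Require Import Defs.
From HB Require Import structures.
From mathcomp Require Import all_boot all_order all_algebra.
From mathcomp Require Import fingroup perm monalg.
From mathcomp Require Import reals complex.
From mathcomp Require Import ring zify.

Set Implicit Arguments.
Unset Strict Implicit.
Unset Printing Implicit Defensive.

Import Order.TTheory GRing.Theory Num.Theory.
Local Open Scope ring_scope.

(* The vectors A^d1 B^d2 a^c1 b^c2 c^c3 (A, B the leading minors, up to det) are moved
   around by the quantum group U_q(gl_3) acting on the columns: triangular
   two-dimensional representations of O(GL_q(3)) give, through the coproduct, skew
   derivations E_1, F_1, E_2 of the algebra, and invariance of the Haar state says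
   that h vanishes on their images.  Applied to products u^* v, this yields linear
   recursions between the inner products <u, v>:
   - they reduce every norm <u, u> with c2 = 0 to highest weight vectors A^d a^n;
   - the relations kk^* + hh^* + gg^* = 1 and a^*a + q^-2 b^*b + q^-4 c^*c = 1 link
     different highest weights and reduce their norms to h(1) = 1;
   - if c2 = k, E_1 gives a two-term recursion, hence a product formula, in which the
     sum over j of the theorem is summed by the q-Pfaff-Saalschutz identity;
   - F_1 gives a three-term recursion in c2 - k; the formula satisfies it summand by
     summand in j, by the two q-Pascal rules applied to the sum over p. *)

(** * q-series *)

(** The three skew derivations preserve d1 + d2 and c1 + c2 + c3, so invariance alone cannot compare
    two highest weights. The missing scalars, the norms of A^d a^n, come from inserting one of the
    two relations equal to 1 between the bra and the ket.

    The obstacle is that type (a) is not stable: [F1] on a vector creates the minor of columns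
    {2,3}, and [E1] on an adjoint creates the adjoint of that minor. A quantum Pluecker relation
    straightens its product with a, and the star of that relation does the same for adjoints.
    Straightening consumes one factor a, which is why these formulas carry [c1.+1]. Only the step
    from d to d + 1 meets a product outside type (a) that is not straightened; there [E1] is
    integrated by parts once more.

    The quantized enveloping algebra is never built. Each derivation is an entry of (id (x) rho)
    Delta, and rho is fixed by the images of the generators.

    Every denominator is a product of powers of q and factors 1 - q^(2n) with n > 0, nonzero because
    q is real and not 0, 1 or -1. *)

Ltac nz := repeat first [done | exact: oner_neq0 | apply/andP; split
  | apply: expf_neq0 | apply: invr_neq0 | apply: mulf_neq0].

Section QSeries.
Variables (F : fieldType) (p : F).
Hypotheses (p0 : p != 0) (p1 : forall n, p ^+ n.+1 != 1).
Local Notation phi := (qpoch p p).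
Local Notation binom := (qbinom p).

Lemma qpoch0 x : qpoch x p 0 = 1.
Proof. by rewrite /qpoch big_ord0. Qed.

Lemma qpochS x n : qpoch x p n.+1 = qpoch x p n * (1 - x * p ^+ n).
Proof. by rewrite /qpoch big_ord_recr. Qed.

Lemma phiS n : phi n.+1 = phi n * (1 - p ^+ n.+1).
Proof. by rewrite qpochS -exprS. Qed.

Lemma onemX_neq0 n : 1 - p ^+ n.+1 != 0.
Proof. by rewrite subr_eq0 eq_sym p1. Qed.

Lemma phi_neq0 n : phi n != 0.
Proof.
elim: n => [|n IH]; first by rewrite qpoch0 oner_neq0.
by rewrite phiS mulf_neq0 ?onemX_neq0.
Qed.

(** Lets every shifted factorial be written as a quotient of values of [phi], whose nonvanishing is
    known. *)
Lemma qpochD a n : qpoch (p ^+ a.+1) p n * phi a = phi (a + n).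
Proof.
elim: n => [|n IH]; first by rewrite qpoch0 mul1r addn0.
by rewrite qpochS mulrAC IH addnS phiS -exprD addSn.
Qed.

Lemma qpochE a n : qpoch (p ^+ a.+1) p n = phi (a + n) / phi a.
Proof. by rewrite -qpochD mulfK ?phi_neq0. Qed.

Lemma qbinom_small n j : (n < j)%N -> binom n j = 0.
Proof. by rewrite /qbinom; case: leqP. Qed.

Lemma qbinomE n j : binom (n + j) j = phi (n + j) / (phi j * phi n).
Proof. by rewrite /qbinom leq_addl addnK. Qed.

Lemma qbinomn0 n : binom n 0 = 1.
Proof. by rewrite -{1}[n]addn0 qbinomE qpoch0 mul1r addn0 divff ?phi_neq0. Qed.

Lemma qbinomnn n : binom n n = 1.
Proof. by rewrite -{1}[n]add0n qbinomE qpoch0 mulr1 add0n divff ?phi_neq0. Qed.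

(** One of the two q-Pascal rules; [qbinomSr] is its mirror image under j -> n - j. The proof of
    [psum_rec] plays one against the other. *)
Lemma qbinomS n j : binom n.+1 j.+1 = binom n j + p ^+ j.+1 * binom n j.+1.
Proof.
case: (ltngtP n j) => [nj|jn|->].
- by rewrite !qbinom_small ?mulr0 ?addr0 // ltnW.
- have [m ->] : exists m, n = (m + j.+1)%N by exists (n - j.+1)%N; rewrite subnK.
  have -> : (m + j.+1).+1 = (m.+1 + j.+1)%N by lia.
  rewrite !qbinomE [(m + j.+1)%N]addnS -addSn qbinomE !addSn addnS !phiS.
  have := phi_neq0 m; have := phi_neq0 j; have := onemX_neq0 m.
  have := onemX_neq0 j; rewrite !(exprS, exprD).
  move: (p ^+ m) (p ^+ j) (phi m) (phi j) (phi (m + j)) => x y u v w *.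
  by field; nz.
- by rewrite !qbinomnn qbinom_small ?mulr0 ?addr0.
Qed.

Lemma qbinomSr n j : (j <= n)%N ->
  binom n.+1 j.+1 = p ^+ (n - j) * binom n j + binom n j.+1.
Proof.
rewrite leq_eqVlt => /orP[/eqP->|jn].
  by rewrite subnn !qbinomnn qbinom_small // addr0 mulr1.
have [m ->] : exists m, n = (m + j.+1)%N by exists (n - j.+1)%N; rewrite subnK.
have -> : (m + j.+1).+1 = (m.+1 + j.+1)%N by lia.
have -> : (m + j.+1 - j = m.+1)%N by lia.
rewrite !qbinomE [(m + j.+1)%N]addnS -addSn qbinomE !addSn addnS !phiS.
have := phi_neq0 m; have := phi_neq0 j; have := onemX_neq0 m.
have := onemX_neq0 j; rewrite !(exprS, exprD).
move: (p ^+ m) (p ^+ j) (phi m) (phi j) (phi (m + j)) => x y u v w *.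
by field; nz.
Qed.

Lemma sum_qbinomS n (u : nat -> F) :
  \sum_(0 <= j < n.+2) binom n.+1 j * u j =
  \sum_(0 <= j < n.+1) binom n j * (u j.+1 + p ^+ j * u j).
Proof.
rewrite big_nat_recl // qbinomn0.
under eq_bigr do rewrite qbinomS mulrDl.
rewrite big_split /= addrCA.
under [RHS]eq_bigr do rewrite mulrDr.
rewrite [RHS]big_split /=; congr (_ + _).
rewrite [RHS]big_nat_recl // qbinomn0 expr0 big_nat_recr //=.
rewrite qbinom_small // mulr0 mul0r addr0 !mul1r; congr (_ + _).
by apply: eq_bigr => j _; rewrite mulrCA mulrA.
Qed.

Lemma sum_qbinomSr n (u : nat -> F) :
  \sum_(0 <= j < n.+2) binom n.+1 j * u j =
  \sum_(0 <= j < n.+1) binom n j * (p ^+ (n - j) * u j.+1 + u j).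
Proof.
rewrite big_nat_recl // qbinomn0.
under eq_big_nat => j jn do rewrite qbinomSr // mulrDl.
rewrite big_split /= addrCA.
under [RHS]eq_bigr do rewrite mulrDr.
rewrite [RHS]big_split /=; congr (_ + _).
  by apply: eq_bigr => j _; rewrite mulrCA mulrA.
rewrite [RHS]big_nat_recl // qbinomn0 big_nat_recr //=.
by rewrite qbinom_small // mul0r addr0.
Qed.

(** The inner sum of the theorem, with base p = q^2: there c = c1, n = c2 - k, M = d1 + c2 + c3 - j,
    and 2 [al] is the coefficient of the summation index in the exponent of q. *)
Definition psum (al c M n : nat) : F :=
  \sum_(0 <= j < n.+1) p ^+ (al * j) * phi (c + j) * phi (M - j) * binom n j.

Lemma psum_rec r s c n :
  (1 - p ^+ (r + c).+1) * psum (s + r).+1 c (n + s).+1 n.+1 =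
  (1 - p ^+ r) * psum (s + r).+1 c (n + s).+1 n
  + p ^+ r * (1 - p ^+ (s + r + c).+2) * psum (s + r).+1 c.+1 (n + s) n.
Proof.
set al := (s + r).+1.
pose u j := p ^+ (al * j) * phi (c + j) * phi ((n + s).+1 - j).
(* Contiguity of consecutive terms: this is what makes the final identity hold for each j
   separately. *)
have uS j : (j <= n)%N ->
  p ^+ al * (1 - p ^+ (c + j).+1) * u j = (1 - p ^+ (n + s - j).+1) * u j.+1.
  move=> jn; rewrite /u subSS subSn ?(leq_trans jn) ?leq_addr // addnS !phiS.
  by rewrite mulnS exprD; ring.
have e1 m : psum al c (n + s).+1 m = \sum_(0 <= j < m.+1) binom m j * u j.
  by apply: eq_bigr => j _; rewrite mulrC.
have e2 : p ^+ al * psum al c.+1 (n + s) n = \sum_(0 <= j < n.+1) binom n j * u j.+1.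
  rewrite /psum mulr_sumr; apply: eq_big_nat => j jn.
  by rewrite /u subSS addnS addSn mulnS exprD; ring.
(* After multiplication by p^(s+1), the factor 1 - p^(r+c+1) becomes p^(s+1) - p^(al+c+1). The sum
   is expanded by [sum_qbinomSr] for the first term and by [sum_qbinomS] for the second. *)
apply: (mulfI (expf_neq0 s.+1 p0)).
transitivity (p ^+ s.+1 * (\sum_(0 <= j < n.+1) binom n j * (p ^+ (n - j) * u j.+1 + u j))
  - p ^+ (al + c.+1) * (\sum_(0 <= j < n.+1) binom n j * (u j.+1 + p ^+ j * u j))).
  rewrite -sum_qbinomS -sum_qbinomSr -e1 mulrA -mulrBl mulrBr mulr1 -exprD.
  by congr ((_ - p ^+ _) * _); lia.
transitivity (p ^+ s.+1 * (1 - p ^+ r) * psum al c (n + s).+1 n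
  + (1 - p ^+ (s + r + c).+2) * (p ^+ al * psum al c.+1 (n + s) n)); last first.
  by rewrite [p ^+ al]exprS [p ^+ s.+1]exprS exprD; ring.
rewrite e2 e1 !mulr_sumr -sumrB -!big_split /=; apply: eq_big_nat => j jn.
have := uS j jn.
have -> : p ^+ (n + s - j).+1 = p ^+ s.+1 * p ^+ (n - j) 
  by rewrite -exprD; congr (p ^+ _); lia.
have -> : (s + r + c).+2 = (al + c.+1)%N by rewrite /al; lia.
have -> : (c + j).+1 = (c.+1 + j)%N by [].
have -> : p ^+ al = p ^+ s.+1 * p ^+ r by rewrite -exprD.
rewrite !(exprD _ al) !(exprD _ c.+1).
have -> : p ^+ al = p ^+ s.+1 * p ^+ r by rewrite -exprD.
move: (p ^+ s.+1) (p ^+ r) (p ^+ c.+1) (p ^+ j) (p ^+ (n - j)) (u j) (u j.+1) (binom n j).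
move=> x y z t v w w' b e.
(* Isolates the left side of the contiguity relation [e]; once it is replaced, only a polynomial
   identity remains. *)
transitivity (b * (x * y * (1 - z * t) * w)
  + b * (x * v * w' + x * w - x * y * w - x * y * z * w')).
  by ring.
by rewrite e; ring.
Qed.

(** * The q-Pfaff-Saalschutz sum *)

Lemma qbinom_absorb n j :
  binom n j.+1 = (1 - p ^+ (n - j)) / (1 - p ^+ j.+1) * binom n j.
Proof.
have [jn|nj|->] := ltngtP j n; last first.
- by rewrite subnn expr0 subrr !mul0r qbinom_small.
- by rewrite !qbinom_small ?mulr0 // ltnW.
have [m ->] : exists m, n = (m + j.+1)%N by exists (n - j.+1)%N; rewrite subnK.
have -> : (m + j.+1 - j = m.+1)%N by lia.
rewrite !qbinomE [(m + j.+1)%N]addnS -addSn qbinomE !addSn !phiS.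
have := phi_neq0 m; have := phi_neq0 j; have := onemX_neq0 m.
have := onemX_neq0 j.
move: (p ^+ m.+1) (p ^+ j.+1) (phi m) (phi j) (phi (m + j)) => x y u v w *.
by field; nz.
Qed.

Lemma qbinom_absorbS n j :
  binom n.+1 j.+1 = (1 - p ^+ n.+1) / (1 - p ^+ j.+1) * binom n j.
Proof.
have [nj|jn] := ltnP n j; first by rewrite !qbinom_small ?mulr0.
rewrite -(subnK jn) -addnS !qbinomE addnS !phiS.
have := phi_neq0 (n - j); have := phi_neq0 j; have := onemX_neq0 j.
move: (p ^+ j.+1) (p ^+ _.+1) (phi (n - j)) (phi j) (phi _) => x y u v w *.
by field; nz.
Qed.

(** Up to a factor free of j, the j-th term of the balanced series 3phi2(p^-n, p^-m, p^-(N+m+c+1);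
    p^-(n+m+c), p^-(N+m); p, p), written with [phi] to avoid negative powers. *)
Definition saal (n m c N j : nat) : F :=
  (-1) ^+ j * p ^+ 'C(j, 2) * binom n j * binom m j * phi j
  * phi (n + m + c - j) * phi (N + m - j) / phi (N + m + c + 1 - j).

(* WZ certificate in the variable m for the summand of the q-Pfaff-Saalschutz sum. *)
Lemma saal_telescope n m c l j : (j <= n)%N ->
  let N := (n + l)%N in
  let g i := if i is i'.+1 then (p ^+ i' - p ^+ n) * (1 - p ^+ (N + 2 * m + c + 2 - i'))
     * saal n m c N i' / (1 - p ^+ (N + m + c).+2) else 0 in
  saal n m.+1 c N j - p ^+ n * (1 - p ^+ (m + c).+1) * (1 - p ^+ (l + m).+1)
    / (1 - p ^+ (N + m + c).+2) * saal n m c N j = g j.+1 - g j.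
Proof.
move=> jn N g; rewrite /g {g} /N {N}.
case: j jn => [|i] jn.
  rewrite /saal !subn0 !qbinomn0 !addn1 !(addnS, addSn, addn0) !phiS qpoch0 expr0.
  have -> : (n + l + 2 * m + c = n + l + m + m + c)%N by lia.
  have := phi_neq0 (n + l + m + c); have := onemX_neq0 (n + l + m + c).
  have := onemX_neq0 (n + l + m + c).+1; rewrite !(exprS, exprD).
  move: (p ^+ n) (p ^+ m) (p ^+ c) (p ^+ l) => a b d e.
  move: (phi _) (phi _) (phi _) => x y z *.
  by field; nz.
have [minor2|im] := ltnP m i.
  rewrite /saal (qbinom_small (n := m.+1)) // !(qbinom_small (n := m)) //; last exact: ltnW.
  by rewrite !(mulr0, mul0r).
have [m' {im} ->] : exists m', m = (i + m')%N by exists (m - i)%N; rewrite subnKC.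
have [n' {jn} ->] : exists n', n = (i.+1 + n')%N by exists (n - i.+1)%N; rewrite subnKC.
rewrite /saal binS bin1 (qbinom_absorbS (i + m')) !(qbinom_absorb _ i).
have -> : (i.+1 + n' - i = n'.+1)%N by lia.
have -> : (i + m' - i = m')%N by lia.
have -> : (i.+1 + n' + (i + m') + c - i.+1 = n' + i + m' + c)%N by lia.
have -> : (i.+1 + n' + (i + m') + c - i = (n' + i + m' + c).+1)%N by lia.
have -> : (i.+1 + n' + (i + m').+1 + c - i.+1 = (n' + i + m' + c).+1)%N by lia.
have -> : (i.+1 + n' + l + (i + m') - i.+1 = n' + i + m' + l)%N by lia.
have -> : (i.+1 + n' + l + (i + m').+1 - i.+1 = (n' + i + m' + l).+1)%N by lia.
have -> : (i.+1 + n' + l + (i + m') - i = (n' + i + m' + l).+1)%N by lia.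
have -> : (i.+1 + n' + l + (i + m') + c + 1 - i.+1 = (n' + i + m' + l + c).+1)%N by lia.
have -> : (i.+1 + n' + l + (i + m').+1 + c + 1 - i.+1 = (n' + i + m' + l + c).+2)%N by lia.
have -> : (i.+1 + n' + l + (i + m') + c + 1 - i = (n' + i + m' + l + c).+2)%N by lia.
have -> : (i.+1 + n' + l + 2 * (i + m') + c + 2 - i.+1
  = i + m' + n' + l + m' + i + c + 2)%N by lia.
have -> : (i.+1 + n' + l + 2 * (i + m') + c + 2 - i
  = i + m' + n' + l + m' + i + c + 3)%N by lia.
have := phi_neq0 (n' + i + m' + l + c); have := onemX_neq0 (n' + i + m' + l + c).
have := onemX_neq0 (n' + i + m' + l + c).+1; have := onemX_neq0 i.
have := onemX_neq0 (i.+1 + n' + l + (i + m') + c).+1.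
rewrite !phiS !(exprS, exprD).
move: (p ^+ i) (p ^+ n') (p ^+ m') (p ^+ c) (p ^+ l) (p ^+ 'C(_, _)) ((-1) ^+ _).
move=> x n1 m1 d e w w'.
move: (phi _) (phi _) (phi _) (phi _) (binom _ _) (binom _ _) => *.
by field; nz.
Qed.

(** Induction on m. By [saal_telescope] the sum for m + 1 minus r times the sum for m telescopes to
    0: the certificate is 0 at j = 0 by definition, and at j = n + 1 through its factor p^n - p^n.
    At m = 0 only the term j = 0 survives. *)
Lemma sum_saal n m c l :
  \sum_(0 <= j < n.+1) saal n m c (n + l) j =
  p ^+ (n * m) * phi (n + c) * phi (m + c) * phi (l + m) * phi (n + l)
  / (phi c * phi l * phi (n + l + m + c + 1)).
Proof.
have nz := phi_neq0.
elim: m => [|m IH].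
  rewrite big_nat_recl // big1_seq ?addr0 => [|j _].
    rewrite /saal !subn0 !qbinomn0 bin0n qpoch0 !muln0 !addn0 !expr0.
    have := nz c; have := nz l; have := nz (n + l + c + 1)%N.
    move: (phi c) (phi l) (phi _) (phi _) (phi _) => *.
    by field; nz.
  by rewrite /saal [binom 0 _]qbinom_small // mulr0 !mul0r.
set r := p ^+ n * (1 - p ^+ (m + c).+1) * (1 - p ^+ (l + m).+1)
    / (1 - p ^+ (n + l + m + c).+2).
transitivity (r * \sum_(0 <= j < n.+1) saal n m c (n + l) j).
  apply/eqP; rewrite -subr_eq0 mulr_sumr -sumrB; apply/eqP.
  under eq_big_nat => j jn do rewrite saal_telescope //.
  by rewrite telescope_sumr //= subrr !mul0r subr0.
rewrite IH /r mulnS !(addnS, addSn, addn0) !phiS.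
have := nz c; have := nz l; have := nz (n + l + m + c)%N.
have := onemX_neq0 (n + l + m + c); have := onemX_neq0 (n + l + m + c).+1.
rewrite exprD.
move: (p ^+ (n + l + m + c).+1) (p ^+ (n + l + m + c).+2) (p ^+ _) (p ^+ _) (p ^+ _) (p ^+ _).
move: (phi c) (phi l) (phi _) (phi _) (phi _) (phi _) => *.
by field; nz.
Qed.
End QSeries.

(** * The value stated in the theorem: its product form at k = c2 and its recursion *)

Definition gram_val (F : fieldType) (q : F) d1 d2 c1 c2 c3 k : F :=
  q ^+ (2 * d1 * d2 + 4 * d1 + 4 * d2 + 2 * c1 * c2 + 2 * c1 * c3 + 2 * c2 * c3
         + 4 * c1 + 4 * c2 + 4 * c3 + k * (d2 + c2 - k))
   * ((1 - q ^+ 2) ^+ 2 * (1 - q ^+ 4)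
      * qpoch (q ^+ 2) (q ^+ 2) d2 * qpoch (q ^+ 2) (q ^+ 2) c2
      / (qpoch (q ^+ 2) (q ^+ 2) (d1 + d2 + 1)
         * qpoch (q ^+ 2) (q ^+ 2) (c1 + c2 + c3 + 1)))
   * \sum_(0 <= j < c3.+1)
       ((-1) ^+ j * q ^+ (j ^ 2 - j)
        * qbinom (q ^+ 2) d1 j * qbinom (q ^+ 2) c3 j * qpoch (q ^+ 2) (q ^+ 2) j
        / qpoch (q ^+ (2 * d1 + 2 * d2 + 2 * c1 + 2 * c3 + 4 - 2 * j)) (q ^+ 2)
                (c2 + 1)
        * \sum_(0 <= p < (c2 - k).+1)
            q ^+ ((2 * d1 + 2 * d2 + 2 * c3 + 2 - 2 * j) * p)
            * qpoch (q ^+ 2) (q ^+ 2) (c1 + p)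
            * qpoch (q ^+ 2) (q ^+ 2) (d1 + c2 + c3 - j - p)
            * qbinom (q ^+ 2) (c2 - k) p).

Section GramVal.
Variables (F : fieldType) (q : F).
Hypotheses (q0 : q != 0) (q1 : forall n, (q ^+ 2) ^+ n.+1 != 1).
Local Notation p := (q ^+ 2).
Local Notation phi := (qpoch p p).

(** What the stated value becomes when k = c2. At c2 = 0 it is the squared norm of the vector. *)
Definition gram_prod d1 d2 c1 c2 c3 : F :=
  q ^+ (4 * (d1 + d2 + c1 + c2 + c3)
        + 2 * (d1 * d2 + c1 * c2 + c1 * c3 + c2 * c3 + d1 * c3) + c2 * d2)
  * (1 - q ^+ 2) ^+ 2 * (1 - q ^+ 4)
  * (phi d2 * phi c1 * phi (d1 + c2) * phi (c2 + c3) * phi (d2 + c1 + c3 + 1)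
     * phi (d1 + d2 + c1 + 1))
  / (phi (d1 + d2 + 1) * phi (c1 + c2 + c3 + 1) * phi (d2 + c1 + 1)
     * phi (d1 + d2 + c1 + c2 + c3 + 2)).

Lemma double_bin2 j : (j ^ 2 - j = 2 * 'C(j, 2))%N.
Proof. by elim: j => // j IH; rewrite binS bin1 mulnDr -IH; nia. Qed.

(** Both sums really stop at min(a, b). The theorem sums up to c3, whereas [sum_saal] sums up to its
    first parameter, here d1. *)
Lemma sum_qbinom_comm a b (f : nat -> F) :
  \sum_(0 <= j < a.+1) qbinom p a j * qbinom p b j * f j =
  \sum_(0 <= j < b.+1) qbinom p a j * qbinom p b j * f j.
Proof.
have trunc c d : (d = a \/ d = b) -> (d <= c)%N ->
    \sum_(0 <= j < c.+1) qbinom p a j * qbinom p b j * f j =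
    \sum_(0 <= j < d.+1) qbinom p a j * qbinom p b j * f j.
  move=> hd dc; rewrite (big_cat_nat (n := d.+1)) //= [X in _ + X]big1_seq ?addr0 // => j.
  rewrite mem_index_iota => /andP[_ /andP[dj _]].
  by case: hd => <-; rewrite [qbinom p d j]qbinom_small ?(mulr0, mul0r).
case: (leqP a b) => ab; first by rewrite (trunc b a) //; left.
by rewrite (trunc a b) ?(ltnW ab) //; right.
Qed.

(** The inner sum reduces to its term 0, and the outer one is [sum_saal] with n = d1, m = c3, c = k
    and l = d2 + c1 + 1, where d2 = k + r. Its factor p^(nm) supplies the 2 d1 c3 in the exponent of
    [gram_prod]. *)
Lemma gram_val0 d1 r c1 k c3 :
  gram_val q d1 (k + r) c1 k c3 k = gram_prod d1 (k + r) c1 k c3.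
Proof.
have nz := phi_neq0 q1.
rewrite /gram_val subnn.
under eq_bigr => j _.
  rewrite big_nat1 muln0 expr0 mul1r !addn0 subn0 [qbinom p 0 0]qbinomnn // mulr1.
  over.
have -> : \sum_(0 <= j < c3.+1) ((-1) ^+ j * q ^+ (j ^ 2 - j)
        * qbinom p d1 j * qbinom p c3 j * phi j
        / qpoch (q ^+ (2 * d1 + 2 * (k + r) + 2 * c1 + 2 * c3 + 4 - 2 * j)) p (k + 1)
        * (phi c1 * phi (d1 + k + c3 - j))) =
   phi c1 * \sum_(0 <= j < d1.+1) saal p d1 c3 k (d1 + (k + r + c1 + 1)) j.
  rewrite mulr_sumr.
  transitivity (\sum_(0 <= j < c3.+1) qbinom p d1 j * qbinom p c3 j *
     (phi c1 * ((-1) ^+ j * p ^+ 'C(j, 2) * phi j * phi (d1 + c3 + k - j)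
      * phi (d1 + (k + r + c1 + 1) + c3 - j) / phi (d1 + (k + r + c1 + 1) + c3 + k + 1 - j)))).
    apply: eq_big_nat => j /andP[_ jc3].
    have -> : (2 * d1 + 2 * (k + r) + 2 * c1 + 2 * c3 + 4 - 2 * j =
      2 * (d1 + (k + r + c1 + 1) + c3 - j).+1)%N by lia.
    rewrite exprM qpochE //.
    have -> : (d1 + (k + r + c1 + 1) + c3 - j + (k + 1) =
       d1 + (k + r + c1 + 1) + c3 + k + 1 - j)%N by lia.
    have -> : (d1 + k + c3 - j = d1 + c3 + k - j)%N by lia.
    rewrite double_bin2 exprM.
    by field; nz.
  rewrite -sum_qbinom_comm; apply: eq_bigr => j _.
  by rewrite /saal; ring.
rewrite sum_saal ?expf_neq0 // /gram_prod.
set e1 := (X in q ^+ X * _ * _ = _); set e2 := (X in _ = q ^+ X * _ * _ * _ / _).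
have -> : e2 = (e1 + 2 * (d1 * c3))%N by rewrite /e1 /e2 addnK; ring.
rewrite exprD (exprM q 2); move: (q ^+ e1) (p ^+ (d1 * c3)) => x y {e1 e2}.
have -> : (k + r + c1 + 1 + c3 = k + r + c1 + c3 + 1)%N by lia.
have -> : (d1 + (k + r + c1 + 1) = d1 + (k + r) + c1 + 1)%N by lia.
have -> : (d1 + (k + r) + c1 + 1 + c3 + k + 1 = d1 + (k + r) + c1 + k + c3 + 2)%N by lia.
rewrite [(c3 + k)%N]addnC.
by field; nz.
Qed.

Definition gpre d1 d2 c1 c2 c3 k : F :=
  q ^+ (2 * d1 * d2 + 4 * d1 + 4 * d2 + 2 * c1 * c2 + 2 * c1 * c3 + 2 * c2 * c3
         + 4 * c1 + 4 * c2 + 4 * c3 + k * (d2 + c2 - k))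
   * ((1 - p) ^+ 2 * (1 - q ^+ 4) * phi d2 * phi c2
      / (phi (d1 + d2 + 1) * phi (c1 + c2 + c3 + 1))).

(** The range n of the inner sum is kept independent of c2, since the recursion compares the values
    for k and k + 1 at the same c2. *)
Definition gsum d1 d2 c1 c2 c3 n : F :=
  \sum_(0 <= j < c3.+1) (-1) ^+ j * q ^+ (j ^ 2 - j)
        * qbinom p d1 j * qbinom p c3 j * phi j
        / qpoch (p ^+ (d1 + d2 + c1 + c3 - j).+2) p c2.+1
        * psum p (d1 + d2 + c3 - j).+1 c1 (d1 + c2 + c3 - j) n.

Lemma gram_valE d1 d2 c1 c2 c3 k :
  gram_val q d1 d2 c1 c2 c3 k = gpre d1 d2 c1 c2 c3 k * gsum d1 d2 c1 c2 c3 (c2 - k).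
Proof.
congr (_ * _); apply: eq_big_nat => j /andP[_ jc3].
have -> : (2 * d1 + 2 * d2 + 2 * c1 + 2 * c3 + 4 - 2 * j = 2 * (d1 + d2 + c1 + c3 - j).+2)%N.
  by lia.
have -> : (2 * d1 + 2 * d2 + 2 * c3 + 2 - 2 * j = 2 * (d1 + d2 + c3 - j).+1)%N by lia.
rewrite exprM addn1; congr (_ * _); apply: eq_bigr => i _.
by rewrite -mulnA exprM.
Qed.

(** Term by term in j this is [psum_rec] with s = d1 + k + c3 - j. The extra coefficient it produces
    on the [c1.+1] term is exactly the first factor of the longer denominator. *)
Lemma gsum_rec d1 r c1 n c3 k :
  (1 - p ^+ (r + c1).+1) * gsum d1 (k + r) c1 (k + n.+1) c3 n.+1 =
  (1 - p ^+ r) * gsum d1 (k + r) c1 (k + n.+1) c3 n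
  + p ^+ r * gsum d1 (k + r) c1.+1 (k + n) c3 n.
Proof.
rewrite !mulr_sumr -big_split; apply: eq_big_nat => j /andP[_ jc3] /=.
have := psum_rec (expf_neq0 2 q0) q1 r (d1 + k + c3 - j) c1 n.
have -> : (d1 + (k + r) + c3 - j = d1 + k + c3 - j + r)%N by lia.
have -> : (d1 + (k + n.+1) + c3 - j = (n + (d1 + k + c3 - j)).+1)%N by lia.
have -> : (d1 + (k + n) + c3 - j = n + (d1 + k + c3 - j))%N by lia.
have -> : (d1 + (k + r) + c1 + c3 - j = d1 + k + c3 - j + r + c1)%N by lia.
have -> : (d1 + (k + r) + c1.+1 + c3 - j = (d1 + k + c3 - j + r + c1).+1)%N by lia.
move: (d1 + k + c3 - j)%N => s.
have -> : qpoch (p ^+ (s + r + c1).+2) p (k + n.+1).+1 =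
    (1 - p ^+ (s + r + c1).+2) * qpoch (p ^+ (s + r + c1).+3) p (k + n).+1.
  rewrite !qpochE //.
  have -> : ((s + r + c1).+1 + (k + n.+1).+1 = (s + r + c1).+2 + (k + n).+1)%N by lia.
  rewrite [phi (s + r + c1).+2]phiS.
  by have nz := phi_neq0 q1; have nz1 := onemX_neq0 q1 (s + r + c1).+1; field; nz.
have nz1 := onemX_neq0 q1 (s + r + c1).+1.
have : qpoch (p ^+ (s + r + c1).+3) p (k + n).+1 != 0.
  by rewrite qpochE //; have nz := phi_neq0 q1; nz.
rewrite mulrCA => nzB ->.
move: nz1 nzB; move: (psum _ _ _ _ _) (psum _ _ _ _ _) (qpoch _ _ (k + n).+1).
move: (p ^+ (s + r + c1).+2) (p ^+ r) => *.
by field; nz.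
Qed.

(** The shape of [gramF1] with its q-integers expanded. The factor 1 - p^r vanishes when k = d2,
    where the value at k + 1 has no meaning as an inner product. *)
Lemma gram_val_rec d1 r c1 n c3 k :
  (1 - p ^+ (r + c1).+1) * gram_val q d1 (k + r) c1 (k + n.+1) c3 k =
  q ^- (r + n) * (1 - p ^+ r) * gram_val q d1 (k + r) c1 (k + n.+1) c3 k.+1
  + p ^+ (c1 + r) / (p ^+ n * q ^+ k) * (1 - p ^+ (k + n).+1)
    * gram_val q d1 (k + r) c1.+1 (k + n) c3 k.
Proof.
rewrite !gram_valE.
have -> : (k + n.+1 - k = n.+1)%N by lia.
have -> : (k + n.+1 - k.+1 = n)%N by lia.
have -> : (k + n - k = n)%N by lia.
have eA : gpre d1 (k + r) c1 (k + n.+1) c3 k =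
    q ^- (r + n) * gpre d1 (k + r) c1 (k + n.+1) c3 k.+1.
  rewrite /gpre; set e1 := (X in q ^+ X * _ = _); set e2 := (X in _ = _ * (q ^+ X * _)).
  have -> : e2 = (e1 + (r + n))%N by rewrite /e1 /e2; nia.
  by rewrite [(e1 + _)%N]addnC (exprD q (r + n)) -(mulrA (q ^+ (r + n))) mulKf ?expf_neq0.
have eB : p ^+ r * gpre d1 (k + r) c1 (k + n.+1) c3 k =
    p ^+ (c1 + r) / (p ^+ n * q ^+ k) * (1 - p ^+ (k + n).+1)
    * gpre d1 (k + r) c1.+1 (k + n) c3 k.
  rewrite /gpre; set e1 := (X in _ * (q ^+ X * _) = _); set e2 := (X in _ = _ * (q ^+ X * _)).
  have e12 : (e2 + 2 * c1 = e1 + 2 * n + k)%N by rewrite /e1 /e2; nia.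
  have : q ^+ e2 * p ^+ c1 = q ^+ e1 * p ^+ n * q ^+ k by rewrite -!exprM -!exprD e12.
  have -> : (c1.+1 + (k + n) + c3 + 1 = c1 + (k + n.+1) + c3 + 1)%N by lia.
  rewrite addnS phiS -addnS exprD.
  have nz := phi_neq0 q1.
  have nzn := expf_neq0 n q0; have nzk := expf_neq0 k q0.
  have nzp := expf_neq0 n (expf_neq0 2 q0).
  move=> e.
  have -> : q ^+ e1 = q ^+ e2 * p ^+ c1 / (p ^+ n * q ^+ k) by rewrite e; field; nz.
  rewrite (exprD p c1); move: nzp nzn nzk {e12 e}.
  by move: (p ^+ n) (p ^+ c1) (p ^+ r) (p ^+ n.+1) (q ^+ e2) => *; field; nz.
rewrite mulrCA gsum_rec mulrDr; congr (_ + _); first by rewrite eA; ring.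
by rewrite [LHS]mulrCA (mulrA (p ^+ r)) eB; ring.
Qed.
End GramVal.

(** * Skew derivations and the Gram recursions *)

(** The symmetric q-integer [n], kept opaque until [qnumE] or [qnumQ] expands it. *)
HB.lock Definition qnum (K : fieldType) (q : K) (n : nat) : K :=
  (q ^+ n - q ^- n) / (q - q^-1).

Section SkewDerivation.
Variables (K : fieldType) (q : K) (A : algType K) (h : {scalar A}).

Local Notation qnum := (qnum q).
Definition qcomm (x y : A) : Prop := y * x = q^-1 *: (x * y).

(** Axiomatizes the action of a root vector E with coproduct 1 (x) E + E (x) K; [kap] is the action
    of K. The field [skew_haar] is invariance of h, as the counit of E is 0. *)
Record skew_derivation (D kap : A -> A) : Prop := {
  skewM : forall x y, D (x * y) = x * D y + D x * kap y;
  skew_haar : forall x, h (D x) = 0;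
  kap1 : kap 1 = 1;
  kapM : forall x y, kap (x * y) = kap x * kap y }.

Hypotheses (q0 : q != 0) (qq : q * q - 1 != 0).

Lemma qnumE n : qnum n = (q ^+ n - q ^- n) / (q - q^-1).
Proof. by rewrite qnum.unlock. Qed.

Lemma qnum0 : qnum 0 = 0.
Proof. by rewrite qnumE expr0 invr1 subrr mul0r. Qed.

Lemma qcommX x y m n : qcomm x y -> y ^+ n * x ^+ m = q ^- (n * m) *: (x ^+ m * y ^+ n).
Proof.
move=> xy; have xyn k : y ^+ k * x = q ^- k *: (x * y ^+ k).
  elim: k => [|k IH]; first by rewrite !expr0 mul1r mulr1 invr1 scale1r.
  rewrite {1}exprS -mulrA IH -scalerAr mulrA xy -scalerAl scalerA -mulrA -exprS.
  by congr (_ *: _); rewrite exprSr invfM mulrC.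
elim: m => [|m IH]; first by rewrite muln0 !expr0 mul1r mulr1 invr1 scale1r.
rewrite !exprSr mulrA IH -scalerAl. rewrite -[_ * _ * x]mulrA xyn -scalerAr scalerA mulrA.
by congr (_ *: _); rewrite mulnS exprD invfM mulrC.
Qed.

(** Integration by parts: the source of all linear relations between inner products. *)
Lemma skew_pair D kap (x y : A) : skew_derivation D kap ->
  h (x * D y) = - h (D x * kap y).
Proof.
move=> sk; have := skew_haar sk (x * y); rewrite (skewM sk) linearD /=.
by move/eqP; rewrite addr_eq0 => /eqP.
Qed.

Section Powers.
Variables (D kap : A -> A).
Hypothesis sk : skew_derivation D kap.

Lemma skew1 : D 1 = 0.
Proof.
have := skewM sk 1 1; rewrite (kap1 sk) !mulr1 mul1r.
by rewrite -[X in X = _]addr0 => /addrI.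
Qed.

Lemma kapX s x n : kap x = s *: x -> kap (x ^+ n) = s ^+ n *: x ^+ n.
Proof.
move=> kx; elim: n => [|n IH]; first by rewrite !expr0 (kap1 sk) scale1r.
by rewrite !exprS (kapM sk) kx IH -scalerAl -scalerAr scalerA.
Qed.

Lemma skewX0 x n : D x = 0 -> D (x ^+ n) = 0.
Proof.
move=> Dx; elim: n => [|n IH]; first exact: skew1.
by rewrite exprS (skewM sk) IH Dx mulr0 mul0r addr0.
Qed.

Lemma skewX t x y n : (kap x = q *: x) /\ (x * y = q^-1 *: (y * x)) \/
    (kap x = q^-1 *: x) /\ (x * y = q *: (y * x)) ->
  D x = t *: y -> D (x ^+ n) = (t * qnum n) *: (y * x ^+ n.-1).
Proof.
move=> hx Dx.
(* Both alternatives become one, with s = q or s = q^-1, because [m] is invariant under q ->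
   q^-1. *)
have {hx} [s [s0 ss kx xy sq]] : exists s : K,
    [/\ s != 0, s * s - 1 != 0, kap x = s *: x, x * y = s^-1 *: (y * x)
    & forall m, qnum m = (s ^+ m - s ^- m) / (s - s^-1)].
  case: hx => -[kx xy]; first by exists q; split=> // m; exact: qnumE.
  exists q^-1; split; rewrite ?invr_eq0 ?invrK //.
    rewrite -invfM subr_eq0 invr_eq1 -subr_eq0 //.
  move=> m; by rewrite qnumE exprVn !invrK -[q ^+ m - _]opprB -[q - _]opprB invrN mulrNN.
elim: n => [|[|n] IH].
- by rewrite expr0 skew1 qnum0 mulr0 scale0r.
- rewrite expr1 Dx expr0 mulr1 sq !expr1 divff ?mulr1 //.
  by rewrite subr_eq0 -(inj_eq (mulfI s0)) divff // -subr_eq0.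
rewrite exprS (skewM sk) IH (kapX _ kx) Dx /= -!scalerAr -scalerAl scalerA.
rewrite [x * (y * _)]mulrA xy -scalerAl scalerA.
rewrite -[y * x * _]mulrA -exprS -scalerDl; congr (_ *: _).
rewrite !sq !exprS.
have := expf_neq0 n s0; move: (s ^+ n) => z z0.
by field; nz.
Qed.
End Powers.
End SkewDerivation.

(** * Inner products computed from a list of commutation rules *)

Section Gram.
Variables (K : fieldType) (q : K) (A : algType K) (h : {scalar A}).
Variables (x1 x2 x3 m1 m2 m3 s1 s2 s3 t1 t2 t3 : A).
Variables (E1 kE1 F1 kF1 E2 kE2 : A -> A).
Local Notation qc := (qcomm q).
Local Notation "[ n ]" := (qnum q n) (at level 0, n at level 99) : ring_scope.
Hypotheses (q0 : q != 0) (q1 : forall n, (q ^+ 2) ^+ n.+1 != 1).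
Hypotheses (x12 : qc x1 x2) (x13 : qc x1 x3) (x23 : qc x2 x3).
Hypotheses (m12 : qc m1 m2) (m13 : qc m1 m3) (m23 : qc m2 m3).
Hypotheses (s32 : qc s3 s2) (s31 : qc s3 s1) (s21 : qc s2 s1).
Hypotheses (t32 : qc t3 t2) (t31 : qc t3 t1) (t21 : qc t2 t1).
(** Quantum Pluecker relation. The left side would be the tableau with columns {2,3}, {1}, which is
    not semistandard; the right side is a combination of semistandard ones. [s1t3] is the adjoint
    relation. *)
Hypothesis m3x1 : m3 * x1 = q^-1 *: (m2 * x2) - q ^- 2 *: (m1 * x3).
Hypothesis s1t3 : s1 * t3 = q^-1 *: (s2 * t2) - q ^- 2 *: (s3 * t1).
Hypothesis tm1 : t1 * m1 + q ^- 2 *: (t2 * m2) + q ^- 4 *: (t3 * m3) = 1.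
Hypothesis sx1 : s1 * x1 + q ^- 2 *: (s2 * x2) + q ^- 4 *: (s3 * x3) = 1.
(** The hypotheses from here on tabulate the three derivations and their K on all factors. A trivial
    coefficient is written [1 *:] to give every entry the shape expected by [skewX] and [kapX]. *)
Hypothesis skE1 : skew_derivation h E1 kE1.
Hypothesis E1x : [/\ E1 x1 = 0, E1 x2 = 1 *: x1 & E1 x3 = 0].
Hypothesis E1m : [/\ E1 m1 = 0, E1 m2 = 0 & E1 m3 = 1 *: m2].
Hypothesis E1s : [/\ E1 s1 = (- q^-1) *: s2, E1 s2 = 0 & E1 s3 = 0].
Hypothesis E1t : [/\ E1 t1 = 0, E1 t2 = (- q^-1) *: t3 & E1 t3 = 0].
Hypothesis kE1x : [/\ kE1 x1 = q^-1 *: x1, kE1 x2 = q *: x2 & kE1 x3 = 1 *: x3].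
Hypothesis kE1m : [/\ kE1 m1 = 1 *: m1, kE1 m2 = q^-1 *: m2 & kE1 m3 = q *: m3].
Hypothesis kE1s : [/\ kE1 s1 = q *: s1, kE1 s2 = q^-1 *: s2 & kE1 s3 = 1 *: s3].
Hypothesis kE1t : [/\ kE1 t1 = 1 *: t1, kE1 t2 = q *: t2 & kE1 t3 = q^-1 *: t3].
Hypothesis skF1 : skew_derivation h F1 kF1.
Hypothesis F1x : [/\ F1 x1 = 1 *: x2, F1 x2 = 0 & F1 x3 = 0].
Hypothesis F1m : [/\ F1 m1 = 0, F1 m2 = 1 *: m3 & F1 m3 = 0].
Hypothesis F1s : [/\ F1 s1 = 0, F1 s2 = (- q) *: s1 & F1 s3 = 0].
Hypothesis F1t : F1 t1 = 0 /\ F1 t2 = 0.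
Hypothesis kF1x : [/\ kF1 x1 = q^-1 *: x1, kF1 x2 = q *: x2 & kF1 x3 = 1 *: x3].
Hypothesis kF1m : [/\ kF1 m1 = 1 *: m1, kF1 m2 = q^-1 *: m2 & kF1 m3 = q *: m3].
Hypothesis kF1s : [/\ kF1 s1 = q *: s1, kF1 s2 = q^-1 *: s2 & kF1 s3 = 1 *: s3].
Hypothesis kF1t : kF1 t1 = 1 *: t1 /\ kF1 t2 = q *: t2.
Hypothesis skE2 : skew_derivation h E2 kE2.
Hypothesis E2x : [/\ E2 x1 = 0, E2 x2 = 0 & E2 x3 = 1 *: x2].
Hypothesis E2m : E2 m1 = 0 /\ E2 m2 = 1 *: m1.
Hypothesis E2s : [/\ E2 s1 = 0, E2 s2 = (- q^-1) *: s3 & E2 s3 = 0].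
Hypothesis E2t : E2 t1 = (- q^-1) *: t2 /\ E2 t2 = 0.
Hypothesis kE2x : [/\ kE2 x1 = 1 *: x1, kE2 x2 = q^-1 *: x2 & kE2 x3 = q *: x3].
Hypothesis kE2m : kE2 m1 = q^-1 *: m1 /\ kE2 m2 = q *: m2.
Hypothesis kE2s : [/\ kE2 s1 = 1 *: s1, kE2 s2 = q *: s2 & kE2 s3 = q^-1 *: s3].
Hypothesis kE2t : kE2 t1 = q *: t1 /\ kE2 t2 = q^-1 *: t2.

(* In the application x1, x2, x3 = a, b, c and m1, m2, m3 = k^*, -q h^*, q^2 g^*, while
   s_i = x_i^* and t_i = m_i^*, so that [bra] is the star of [ket]. *)
Definition ket d1 d2 c1 c2 c3 : A :=
  m1 ^+ d1 * m2 ^+ d2 * x1 ^+ c1 * x2 ^+ c2 * x3 ^+ c3.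
Definition bra d1 d2 c1 c2 c3 : A :=
  s3 ^+ c3 * s2 ^+ c2 * s1 ^+ c1 * t2 ^+ d2 * t1 ^+ d1.

Let qq : q * q - 1 != 0.
Proof. by rewrite subr_eq0 -expr2 -[X in X != _]expr1 q1. Qed.

Lemma qcR (x y : A) : qc x y -> y * x = q^-1 *: (x * y). Proof. by []. Qed.
Lemma qcL (x y : A) : qc x y -> x * y = q *: (y * x).
Proof. by move=> ->; rewrite scalerA divff // scale1r. Qed.

Lemma kE1_ket d1 d2 c1 c2 c3 :
  kE1 (ket d1 d2 c1 c2 c3) = (q ^+ c2 / (q ^+ d2 * q ^+ c1)) *: ket d1 d2 c1 c2 c3.
Proof.
have [k1 k2 k3] := kE1x; have [k4 k5 _] := kE1m.
rewrite /ket !(kapM skE1) (kapX skE1 _ k1) (kapX skE1 _ k2) (kapX skE1 _ k3).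
rewrite (kapX skE1 _ k4) (kapX skE1 _ k5) !expr1n !scale1r.
rewrite -?scalerAr -?scalerAl -?scalerAr -?scalerAl ?scalerA.
by congr (_ *: _); rewrite !exprVn invfM; ring.
Qed.

Lemma kF1_ket d1 d2 c1 c2 c3 :
  kF1 (ket d1 d2 c1 c2 c3) = (q ^+ c2 / (q ^+ d2 * q ^+ c1)) *: ket d1 d2 c1 c2 c3.
Proof.
have [k1 k2 k3] := kF1x; have [k4 k5 _] := kF1m.
rewrite /ket !(kapM skF1) (kapX skF1 _ k1) (kapX skF1 _ k2) (kapX skF1 _ k3).
rewrite (kapX skF1 _ k4) (kapX skF1 _ k5) !expr1n !scale1r.
rewrite -?scalerAr -?scalerAl -?scalerAr -?scalerAl ?scalerA.
by congr (_ *: _); rewrite !exprVn invfM; ring.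
Qed.

Lemma kE2_ket d1 d2 c1 c2 c3 :
  kE2 (ket d1 d2 c1 c2 c3) =
  (q ^+ d2 * q ^+ c3 / (q ^+ d1 * q ^+ c2)) *: ket d1 d2 c1 c2 c3.
Proof.
have [k1 k2 k3] := kE2x; have [k4 k5] := kE2m.
rewrite /ket !(kapM skE2) (kapX skE2 _ k1) (kapX skE2 _ k2) (kapX skE2 _ k3).
rewrite (kapX skE2 _ k4) (kapX skE2 _ k5) !expr1n !scale1r.
do 4 rewrite -?scalerAr -?scalerAl ?scalerA.
by congr (_ *: _); rewrite !exprVn invfM; ring.
Qed.

(** Only x2 is affected, so no straightening occurs. At c2 = 0 the factor [0] cancels the term with
    the truncated predecessor; the same convention serves below. *)
Lemma E1_ket d1 d2 c1 c2 c3 :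
  E1 (ket d1 d2 c1 c2 c3) = [c2] *: ket d1 d2 c1.+1 c2.-1 c3.
Proof.
have [e1 e2 e3] := E1x; have [e4 e5 _] := E1m; have [k1 k2 k3] := kE1x.
have e2' := skewX q0 qq skE1 c2 (or_introl (conj k2 (qcR x12))) e2.
rewrite /ket !(skewM skE1) (skewX0 skE1 _ e1) (skewX0 skE1 _ e3).
rewrite (skewX0 skE1 _ e4) (skewX0 skE1 _ e5) e2' (kapX skE1 _ k3) !expr1n !scale1r.
rewrite !(mulr0, mul0r, add0r, addr0) mul1r -scalerAr -scalerAl.
by rewrite exprSr !mulrA.
Qed.

Lemma E2_ket d1 d2 c1 c2 c3 :
  E2 (ket d1 d2 c1 c2 c3) = [c3] *: ket d1 d2 c1 c2.+1 c3.-1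
   + (q ^+ c3 / q ^+ c2 * [d2]) *: ket d1.+1 d2.-1 c1 c2 c3.
Proof.
have [e1 e2 e3] := E2x; have [e4 e5] := E2m; have [k1 k2 k3] := kE2x.
have e3' := skewX q0 qq skE2 c3 (or_introl (conj k3 (qcR x23))) e3.
have [_ k5] := kE2m.
have e5' := skewX q0 qq skE2 d2 (or_introl (conj k5 (qcR m12))) e5.
rewrite /ket !(skewM skE2) (skewX0 skE2 _ e1) (skewX0 skE2 _ e2).
rewrite (skewX0 skE2 _ e4) e5' e3' !(kapX skE2 _ k1, kapX skE2 _ k2, kapX skE2 _ k3).
rewrite !expr1n !scale1r.
rewrite !(mulr0, mul0r, add0r, addr0) !mul1r.
do 4 rewrite -?scalerAr -?scalerAl ?scalerA.
rewrite !exprSr !mulrA; congr (_ *: _ + _ *: _).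
by rewrite exprVn; ring.
Qed.

(** An m3 created by [F1] inside a power of m2 is carried to the right until it meets x1, where
    [m3x1] applies; the results are then put back in order. *)
Lemma m3_m2_x1_reorder n c : m3 * m2 ^+ n * x1 ^+ c.+1 =
  (q ^- (n + c.+1)) *: (m2 ^+ n.+1 * x1 ^+ c * x2)
  - (q ^- (n + n + c.+2)) *: (m1 * m2 ^+ n * x1 ^+ c * x3).
Proof.
have := qcommX n 1 m23; rewrite mul1n expr1 => ->; rewrite exprS.
rewrite -scalerAl mulrA -(mulrA _ m3) m3x1 mulrBr mulrBl -!scalerAr -!scalerAl.
rewrite !mulrA -exprSr -!(mulrA _ _ (x1 ^+ c)).
have := qcommX c 1 x12; rewrite mul1n expr1 => ->.
have := qcommX c 1 x13; rewrite mul1n expr1 => ->.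
have := qcommX 1 n m12; rewrite muln1 expr1 => ->.
rewrite -!scalerAr -!scalerAl scalerBr !scalerA !mulrA.
rewrite !(exprD, exprS, expr0, mulr1) !invfM.
by congr (_ *: _ - _ *: _); ring.
Qed.

(** Two contributions land on the first vector: F1 acting on x1, and half of the straightened m3 x1
    coming from F1 on m2. Their coefficients add up to the single q-integer [c1 + 1 + d2]. *)
Lemma F1_ket d1 d2 c1 c2 c3 :
  F1 (ket d1 d2 c1.+1 c2 c3) =
   (q ^+ c2 / (q ^+ c1 * q ^+ d2) * [c1.+1 + d2]) *: ket d1 d2 c1 c2.+1 c3
   - (q * [d2] / (q ^+ d2 ^+ 2 * (q ^+ c1.+1) ^+ 2)) *: ket d1.+1 d2.-1 c1 c2 c3.+1.
Proof.
have [e1 e2 e3] := F1x; have [e4 e5 _] := F1m; have [k1 k2 k3] := kF1x.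
have [k4 k5 _] := kF1m.
have e1' := skewX q0 qq skF1 c1.+1 (or_intror (conj k1 (qcL x12))) e1.
have e5' := skewX q0 qq skF1 d2 (or_intror (conj k5 (qcL m23))) e5.
rewrite /ket !(skewM skF1) (skewX0 skF1 _ e2) (skewX0 skF1 _ e3).
rewrite (skewX0 skF1 _ e4) e5' e1' !(kapX skF1 _ k1, kapX skF1 _ k2, kapX skF1 _ k3).
rewrite !expr1n !scale1r.
rewrite !(mulr0, mul0r, add0r, addr0) !mul1r.
do 4 rewrite -?scalerAr -?scalerAl ?scalerA.
have := qcommX c1 1 x12; rewrite mul1n expr1 => ->.
have x32 := qcommX c2 1 x23; rewrite mul1n expr1 in x32.
case: d2 {e5'} => [|d2] /=.
  rewrite qnum0 !(mulr0, mul0r, scale0r, subr0, addr0).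
  do 4 rewrite -?scalerAr -?scalerAl ?scalerA.
  rewrite addn0 [x2 ^+ c2.+1]exprS !mulrA; congr (_ *: _); rewrite expr0 ?mulr1; ring.
rewrite -[m1 ^+ d1 * (m3 * _) * _]mulrA m3_m2_x1_reorder.
rewrite mulrBr -!scalerAr !mulrDl -!scalerAl !mulrBl -!scalerAl.
rewrite !mulrA -(mulrA _ x3 (x2 ^+ c2)) x32.
rewrite -!scalerAr -!scalerAl !scalerBr scalerDr scalerBr !scalerA addrA -scalerDl !mulrA.
rewrite -exprSr -!(mulrA _ x2) -exprS -!(mulrA _ x3) -exprS.
congr (_ *: _ - _ *: _); rewrite !qnumE !(exprD, exprS, exprVn).
  have := expf_neq0 c1 q0; have := expf_neq0 d2 q0.
  by move: (q ^+ c2) (q ^+ c1) (q ^+ d2) => *; field; nz.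
have := expf_neq0 c1 q0; have := expf_neq0 d2 q0; have := expf_neq0 c2 q0.
by move: (q ^+ c2) (q ^+ c1) (q ^+ d2) => *; field; nz.
Qed.

(** Mirror image of [F1_ket]: on adjoints it is E1 that creates the foreign factor t3, and [s1t3]
    removes it. *)
Lemma E1_bra d1 d2 c1 c2 c3 :
  E1 (bra d1 d2 c1.+1 c2 c3) =
   (- q^-1 * [c1.+1 + d2]) *: bra d1 d2 c1 c2.+1 c3
   + ([d2] / (q ^+ 2 * (q ^+ c1 * q ^+ c2 * q ^+ d2))) *: bra d1.+1 d2.-1 c1 c2 c3.+1.
Proof.
have [e1 e2 e3] := E1s; have [e4 e5 _] := E1t; have [k1 k2 k3] := kE1s.
have [k4 k5 _] := kE1t.
have e1' := skewX q0 qq skE1 c1.+1 (or_introl (conj k1 (qcR s21))) e1.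
have e5' := skewX q0 qq skE1 d2 (or_introl (conj k5 (qcR t32))) e5.
rewrite /bra !(skewM skE1) (skewX0 skE1 _ e2) (skewX0 skE1 _ e3).
rewrite (skewX0 skE1 _ e4) e5' e1' !(kapX skE1 _ k5, kapX skE1 _ k4).
rewrite !expr1n !scale1r.
rewrite !(mulr0, mul0r, add0r, addr0).
case: d2 {e5'} => [|d2] /=.
  rewrite qnum0 !(mulr0, mul0r, scale0r, addr0, mul1r, scale1r, add0r, expr0, mulr1, addn0).
  by do 4 rewrite -?scalerAr -?scalerAl ?scalerA; rewrite [s2 ^+ c2.+1]exprSr !mulrA.
rewrite exprSr.
have e6 : s3 ^+ c3 * s2 ^+ c2 * (s1 ^+ c1 * s1) * (t3 * t2 ^+ d2) * t1 ^+ d1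
  = q^-1 / q ^+ c1 *: (s3 ^+ c3 * s2 ^+ c2.+1 * s1 ^+ c1 * t2 ^+ d2.+1 * t1 ^+ d1)
  - (q ^- 2 / (q ^+ c1 * q ^+ c2 * q ^+ d2)) *:
      (s3 ^+ c3.+1 * s2 ^+ c2 * s1 ^+ c1 * t2 ^+ d2 * t1 ^+ d1.+1).
  rewrite !mulrA -[_ * s1 * t3]mulrA s1t3 [s2 ^+ c2.+1]exprSr [s3 ^+ c3.+1]exprSr
    [t2 ^+ d2.+1]exprS [t1 ^+ d1.+1]exprS.
  rewrite mulrBr !mulrBl -!scalerAr -!scalerAl !mulrA.
  have := qcommX 1 c1 s21; rewrite muln1 expr1 => e.
  rewrite -[_ * s1 ^+ c1 * s2]mulrA {}e.
  have := qcommX 1 c1 s31; rewrite muln1 expr1 => e.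
  rewrite -[_ * s1 ^+ c1 * s3]mulrA {}e.
  rewrite -!scalerAr -!scalerAl !mulrA.
  have := qcommX 1 c2 s32; rewrite muln1 expr1 => e.
  rewrite -[_ * s2 ^+ c2 * s3]mulrA {}e.
  rewrite -!scalerAr -!scalerAl !mulrA.
  have := qcommX d2 1 t21; rewrite mul1n expr1 => e.
  rewrite -[_ * t1 * t2 ^+ d2]mulrA {}e.
  rewrite -!scalerAr -!scalerAl !mulrA !scalerA.
  by congr (_ *: _ - _ *: _); rewrite !invfM; ring.
do 4 rewrite -?scalerAr -?scalerAl ?scalerA.
rewrite mulrDl -!scalerAl {}e6 scalerBr !scalerA -addrA addrC -addrA.
rewrite -scaleNr -[_ * (s2 * _)]mulrA.
rewrite [s2 ^+ c2.+1]exprSr !mulrA -scalerDl addrC.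
congr (_ *: _ + _ *: _); rewrite !qnumE !(exprD, exprS).
  have := expf_neq0 c1 q0; have := expf_neq0 d2 q0.
  by move: (q ^+ c1) (q ^+ d2) => *; field; nz.
have := expf_neq0 c1 q0; have := expf_neq0 d2 q0; have := expf_neq0 c2 q0.
by move: (q ^+ c2) (q ^+ c1) (q ^+ d2) => *; field; nz.
Qed.

Lemma F1_bra d1 d2 c1 c2 c3 : F1 (bra d1 d2 c1 c2.+1 c3) =
  (- q * (q ^+ c1 * q ^+ d2 / q ^+ c2 * [c2.+1])) *: bra d1 d2 c1.+1 c2 c3.
Proof.
have [e1 e2 e3] := F1s; have [e4 e5] := F1t; have [k1 k2 k3] := kF1s.
have [k4 k5] := kF1t.
have e2' := skewX q0 qq skF1 c2.+1 (or_intror (conj k2 (qcL s21))) e2.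
rewrite /bra !(skewM skF1) (skewX0 skF1 _ e1) (skewX0 skF1 _ e3).
rewrite (skewX0 skF1 _ e4) (skewX0 skF1 _ e5) e2'.
rewrite !(kapX skF1 _ k1, kapX skF1 _ k5, kapX skF1 _ k4).
rewrite !expr1n !scale1r !(mulr0, mul0r, add0r, addr0) /=.
have := qcommX c2 1 s21; rewrite mul1n expr1 => ->.
do 4 rewrite -?scalerAr -?scalerAl ?scalerA.
rewrite [s1 ^+ c1.+1]exprS !mulrA; congr (_ *: _); ring.
Qed.

Lemma F1_bra0 d1 d2 c1 c3 : F1 (bra d1 d2 c1 0 c3) = 0.
Proof.
have [e1 e2 e3] := F1s; have [e4 e5] := F1t.
rewrite /bra expr0 mulr1 !(skewM skF1) (skewX0 skF1 _ e1) (skewX0 skF1 _ e3).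
rewrite (skewX0 skF1 _ e4) (skewX0 skF1 _ e5).
by rewrite !(mulr0, mul0r, add0r, addr0).
Qed.

Lemma E2_bra d1 d2 c1 c2 c3 : E2 (bra d1 d2 c1 c2 c3) =
  (- q^-1 * (q ^+ d1 / q ^+ d2 * [c2])) *: bra d1 d2 c1 c2.-1 c3.+1
  + (- q^-1 * [d1]) *: bra d1.-1 d2.+1 c1 c2 c3.
Proof.
have [e1 e2 e3] := E2s; have [e4 e5] := E2t; have [k1 k2 k3] := kE2s.
have [k4 k5] := kE2t.
have e2' := skewX q0 qq skE2 c2 (or_introl (conj k2 (qcR s32))) e2.
have e4' := skewX q0 qq skE2 d1 (or_introl (conj k4 (qcR t21))) e4.
rewrite /bra !(skewM skE2) (skewX0 skE2 _ e1) (skewX0 skE2 _ e3).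
rewrite (skewX0 skE2 _ e5) e2' e4'.
rewrite !(kapX skE2 _ k1, kapX skE2 _ k5, kapX skE2 _ k4).
rewrite !expr1n !scale1r !(mulr0, mul0r, add0r, addr0).
do 4 rewrite -?scalerAr -?scalerAl ?scalerA.
rewrite [s3 ^+ c3.+1]exprSr [t2 ^+ d2.+1]exprSr !mulrA addrC.
by congr (_ *: _ + _); rewrite exprVn; ring.
Qed.

(** * Linear relations between inner products *)

Definition gram d1 d2 c1 c2 c3 e1 e2 f1 f2 f3 : K :=
  h (bra d1 d2 c1 c2 c3 * ket e1 e2 f1 f2 f3).

Lemma gramE1 d1 d2 c1 c2 c3 e1 e2 f1 f2 f3 :
  [f2] * gram d1 d2 c1.+1 c2 c3 e1 e2 f1.+1 f2.-1 f3 =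
  q ^+ f2 / (q ^+ e2 * q ^+ f1) *
   (q^-1 * [c1.+1 + d2] * gram d1 d2 c1 c2.+1 c3 e1 e2 f1 f2 f3
    - [d2] / (q ^+ 2 * (q ^+ c1 * q ^+ c2 * q ^+ d2))
      * gram d1.+1 d2.-1 c1 c2 c3.+1 e1 e2 f1 f2 f3).
Proof.
have := skew_pair (bra d1 d2 c1.+1 c2 c3) (ket e1 e2 f1 f2 f3) skE1.
rewrite E1_ket E1_bra kE1_ket mulrDl -!scalerAl -!scalerAr !linearE /=.
rewrite -/(gram _ _ _ _ _ _ _ _ _ _).
by move=> ->; rewrite /gram; ring.
Qed.

Lemma gramF1 d1 d2 c1 c2 c3 e1 e2 f1 f2 f3 :
  q ^+ f2 / (q ^+ f1 * q ^+ e2) * [f1.+1 + e2] * gram d1 d2 c1 c2.+1 c3 e1 e2 f1 f2.+1 f3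
  - q * [e2] / (q ^+ e2 ^+ 2 * (q ^+ f1.+1) ^+ 2)
    * gram d1 d2 c1 c2.+1 c3 e1.+1 e2.-1 f1 f2 f3.+1 =
  q ^+ f2 / (q ^+ e2 * q ^+ f1) * (q ^+ c1 * q ^+ d2 / q ^+ c2 * [c2.+1])
  * gram d1 d2 c1.+1 c2 c3 e1 e2 f1.+1 f2 f3.
Proof.
have := skew_pair (bra d1 d2 c1 c2.+1 c3) (ket e1 e2 f1.+1 f2 f3) skF1.
rewrite F1_ket F1_bra kF1_ket mulrBr -!scalerAl -!scalerAr linearB !linearZ /= /gram => ->.
by rewrite exprS; field; nz.
Qed.

Lemma gramF1_0 d1 d2 c1 c3 e1 e2 f1 f2 f3 :
  q ^+ f2 / (q ^+ f1 * q ^+ e2) * [f1.+1 + e2] * gram d1 d2 c1 0 c3 e1 e2 f1 f2.+1 f3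
  = q * [e2] / (q ^+ e2 ^+ 2 * (q ^+ f1.+1) ^+ 2)
    * gram d1 d2 c1 0 c3 e1.+1 e2.-1 f1 f2 f3.+1.
Proof.
have := skew_pair (bra d1 d2 c1 0 c3) (ket e1 e2 f1.+1 f2 f3) skF1.
rewrite F1_ket F1_bra0 mul0r linear0 oppr0 mulrBr -!scalerAr linearB !linearZ /= /gram.
by move/eqP; rewrite subr_eq0 => /eqP.
Qed.

Lemma gramE2 d1 d2 c1 c2 c3 e1 e2 f1 f2 f3 :
  [f3] * gram d1 d2 c1 c2 c3 e1 e2 f1 f2.+1 f3.-1
  + q ^+ f3 / q ^+ f2 * [e2] * gram d1 d2 c1 c2 c3 e1.+1 e2.-1 f1 f2 f3 =
  q^-1 * (q ^+ e2 * q ^+ f3 / (q ^+ e1 * q ^+ f2))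
  * (q ^+ d1 / q ^+ d2 * [c2] * gram d1 d2 c1 c2.-1 c3.+1 e1 e2 f1 f2 f3
     + [d1] * gram d1.-1 d2.+1 c1 c2 c3 e1 e2 f1 f2 f3).
Proof.
have := skew_pair (bra d1 d2 c1 c2 c3) (ket e1 e2 f1 f2 f3) skE2.
rewrite E2_ket E2_bra kE2_ket mulrDl mulrDr -!scalerAl -!scalerAr !linearE /= /gram => ->.
by ring.
Qed.

Lemma onemq n : 1 - (q ^+ n.+1) ^+ 2 != 0.
Proof. by rewrite exprAC subr_eq0 eq_sym q1. Qed.

Let q2 : 1 - q * q != 0. Proof. exact: (onemq 0). Qed.

Lemma qnumQ n : [n] = q * (1 - (q ^+ n) ^+ 2) / (q ^+ n * (1 - q ^+ 2)).
Proof.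
by rewrite qnumE; field; nz.
Qed.

(** Without x2 in the ket, E1 kills the ket and [gramE1] loses its left side, leaving two terms. *)
Lemma gram_c2_step d1 d2 c1 c2 c3 e1 e2 f1 f3 :
  q ^+ c2 * q ^+ d2 * (1 - (q ^+ (c1 + d2).+1) ^+ 2)
    * gram d1 d2 c1 c2.+1 c3 e1 e2 f1 0 f3 =
  (1 - (q ^+ d2) ^+ 2) * gram d1.+1 d2.-1 c1 c2 c3.+1 e1 e2 f1 0 f3.
Proof.
have := gramE1 d1 d2 c1 c2 c3 e1 e2 f1 0 f3.
rewrite qnum0 mul0r !qnumQ => /esym/eqP; rewrite mulf_eq0 => /orP[|/eqP e].
  by rewrite mulf_eq0 invr_eq0 !mulf_eq0 !expf_eq0 (negbTE q0) ?andbF ?ltnn.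
apply/eqP; rewrite -subr_eq0; apply/eqP.
(* The difference of the two sides is this factor times the expression known to vanish by [e]. The
   same device closes the next proofs. *)
rewrite -[RHS](mulr0 (q * q ^+ c1 * q ^+ c2 * q ^+ d2 ^+ 2 * (1 - q ^+ 2))) -{}e.
move: (gram _ _ _ _ _ _ _ _ _ _) (gram _ _ _ _ _ _ _ _ _ _) => x y.
rewrite addSn !(exprS q, exprD, expr0).
by field; nz.
Qed.

(** E2 relates the two norms up to one cross term, whose ket has a single x2; [gramF1_0] turns that
    term into a multiple of the second norm. *)
Lemma gram_norm_d2_step d1 d2 c1 c3 :
  (q ^+ d2 ^+ 2 * q ^+ c3 ^+ 2 * (1 - (q ^+ d1.+1) ^+ 2) * (1 - (q ^+ (c1 + d2).+2) ^+ 2))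
    * gram d1 d2.+1 c1 0 c3 d1 d2.+1 c1 0 c3 =
  (q ^+ d1 ^+ 2 * (1 - (q ^+ d2.+1) ^+ 2) * (1 - (q ^+ (c1 + c3 + d2).+2) ^+ 2))
    * gram d1.+1 d2 c1 0 c3 d1.+1 d2 c1 0 c3.
Proof.
have := gramE2 d1.+1 d2 c1 0 c3 d1 d2.+1 c1 0 c3.
set x := gram _ _ _ _ _ _ _ _ 1 _; set N := gram d1.+1 d2 c1 0 c3 d1.+1 d2 c1 0 c3.
have nz1 := onemq (c1 + d2).+1.
(* The factor [c3] is kept because [x] is the wanted cross term only for c3 > 0. *)
have -> : [c3] * x = [c3] * ((1 - (q ^+ d2.+1) ^+ 2)
    / (q ^+ d2.+1 * (1 - (q ^+ (c1 + d2).+2) ^+ 2)) * N).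
  case: (posnP c3) => [->|c3_gt0]; first by rewrite qnum0 !mul0r.
  have := gramF1_0 d1.+1 d2 c1 c3 d1 d2.+1 c1 0 c3.-1; rewrite prednK //= -/N -/x => e.
  congr (_ * _); move: nz1 e; rewrite !qnumQ !(exprS q, addSn, addnS, exprD, expr0) => nz1.
  move/eqP; rewrite -subr_eq0 => /eqP e; apply/eqP; rewrite -subr_eq0; apply/eqP.
  rewrite -[RHS](mulr0 (q ^+ c1 ^+ 2 * q ^+ d2 ^+ 2 * q ^+ 2 * (1 - q * q)
    / (1 - (q * (q * (q ^+ c1 * q ^+ d2))) ^+ 2))) -e.
  by field; nz.
rewrite -/N; move: (gram _ _ _ _ _ _ _ _ _ _) N nz1 {x} => y N.
rewrite !qnumQ !(exprS q, addSn, addnS, exprD, expr0) => nz1.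
move/eqP; rewrite -subr_eq0 => /eqP e; apply/eqP; rewrite -subr_eq0; apply/eqP.
rewrite -[RHS](mulr0 (- q ^+ d1 ^+ 2 * q ^+ d2 * q ^+ c3 * (1 - q * q)
    * (1 - (q * (q * (q ^+ c1 * q ^+ d2))) ^+ 2))) -e.
by field; nz.
Qed.

Lemma gram_norm_c2_step d c1 c3 :
  (1 - (q ^+ c1.+1) ^+ 2) * gram d 0 c1 1 c3 d 0 c1 1 c3 =
  (q ^+ c1) ^+ 2 * (1 - q ^+ 2) * gram d 0 c1.+1 0 c3 d 0 c1.+1 0 c3.
Proof.
have := gramE1 d 0 c1 0 c3 d 0 c1 1 c3 => /=.
rewrite !qnumQ !(exprS q, addSn, addn0, exprD, expr0).
move/eqP; rewrite -subr_eq0 => /eqP e; apply/eqP; rewrite -subr_eq0; apply/eqP.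
rewrite -[RHS](mulr0 (- (q ^+ c1) ^+ 2 * (1 - q * q))) -e.
by field; nz.
Qed.

(** E2 exchanges x3 for x2, then [gram_norm_c2_step] exchanges x2 for x1. The cross term with factor
    [d] is reduced by [gram_c2_step]. *)
Lemma gram_norm_c3_step d c1 c3 :
  q ^+ c3 ^+ 2 * (1 - (q ^+ c1.+1) ^+ 2) * (1 - (q ^+ (d + c1).+2) ^+ 2)
    * gram d 0 c1 0 c3.+1 d 0 c1 0 c3.+1 =
  (q ^+ d * q ^+ c1) ^+ 2 * (1 - (q ^+ c3.+1) ^+ 2) * (1 - (q ^+ c1.+2) ^+ 2)
    * gram d 0 c1.+1 0 c3 d 0 c1.+1 0 c3.
Proof.
have := gramE2 d 0 c1 1 c3 d 0 c1 0 c3.+1; rewrite [c3.+1.-1]/=.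
have := gram_norm_c2_step d c1 c3.
set N := gram d 0 c1 0 c3.+1 d 0 c1 0 c3.+1.
set x := gram d.-1 _ _ _ _ _ _ _ _ _.
have nz1 := onemq c1.+1; have nz2 := onemq c1.
have -> : [d] * x = [d] * ((1 - q ^+ 2) / (q * (1 - (q ^+ c1.+2) ^+ 2)) * N).
  case: (posnP d) => [d0|d_gt0]; first by rewrite (_ : [d] = 0) ?mul0r // d0 qnum0.
  have := gram_c2_step d.-1 1 c1 0 c3 d 0 c1 c3.+1; rewrite prednK //= -/N -/x => e.
  congr (_ * _); move: nz1 e; rewrite !(exprS q, addSn, addnS, addn0, exprD, expr0) => nz1.
  move/eqP; rewrite -subr_eq0 => /eqP e; apply/eqP; rewrite -subr_eq0; apply/eqP.
  rewrite -[RHS](mulr0 (q * (1 - (q * (q * q ^+ c1)) ^+ 2))^-1) -e.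
  by field; nz.
move: (gram _ _ _ _ _ _ _ _ _ _) (gram _ _ _ _ _ _ _ _ _ _) N nz1 nz2 {x} => y z N.
rewrite !qnumQ !(exprS q, addSn, addnS, exprD, expr0) => nz1 nz2.
move/eqP; rewrite -subr_eq0 => /eqP e.
move/eqP; rewrite -subr_eq0 => /eqP e'; apply/eqP; rewrite -subr_eq0; apply/eqP.
transitivity (q ^+ d ^+ 2 * (1 - (q * (q * q ^+ c1)) ^+ 2) * (1 - (q * q ^+ c3) ^+ 2)
    / (1 - q * q) * 0 - q ^+ c3 * q ^+ d ^+ 2 * (1 - (q * q ^+ c1) ^+ 2)
    * (1 - (q * (q * q ^+ c1)) ^+ 2) * 0); last by rewrite !mulr0 subrr.
by rewrite -{1}e -e'; field; nz.
Qed.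

(** * Norms of highest weight vectors *)

Local Notation phi := (qpoch (q ^+ 2) (q ^+ 2)).
Hypothesis h1 : h 1 = 1.

(** Insert [sx1] between s1^n and x1^n, then move s2, s3 to the left and x2, x3 to the right. *)
Lemma gram_highest_sphere n : gram 0 0 n 0 0 0 0 n 0 0 =
  gram 0 0 n.+1 0 0 0 0 n.+1 0 0
  + (q * q ^+ n) ^- 2 * gram 0 0 n 1 0 0 0 n 1 0
  + (q * (q * q ^+ n)) ^- 2 * gram 0 0 n 0 1 0 0 n 0 1.
Proof.
rewrite /gram /bra /ket !expr0 !mul1r !mulr1 -{1}[x1 ^+ n]mul1r -{1}sx1 !expr1.
rewrite !mulrDl !mulrDr -!(scalerAl, scalerAr) !linearD !linearZ /= -/phi.
have := qcommX 1 n s21; rewrite muln1 expr1 => es2.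
have := qcommX 1 n s31; rewrite muln1 expr1 => es3.
have := qcommX n 1 x12; rewrite mul1n expr1 => ex2.
have := qcommX n 1 x13; rewrite mul1n expr1 => ex3.
rewrite !mulrA -exprSr -!(mulrA _ x1) -exprS es2 es3 -!(mulrA _ x2) -!(mulrA _ x3).
rewrite ex2 ex3 -!scalerAl -!scalerAr !scalerA !linearZ /= !mulrA.
by congr (_ + _ + _); congr (_ * _); field; nz.
Qed.

(** In [gram_highest_sphere] the three norms of degree n + 1 are multiples of one another, so the
    relation determines the next highest weight norm; h(1) = 1 starts the induction. *)
Lemma gram_highest_d0 n : gram 0 0 n 0 0 0 0 n 0 0 =
  q ^+ n ^+ 4 * (1 - q ^+ 2) * (1 - q ^+ 4)
  / ((1 - (q ^+ n.+1) ^+ 2) * (1 - (q ^+ n.+2) ^+ 2)).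
Proof.
elim: n => [|n IH].
  rewrite /gram /bra /ket !expr0 !mulr1 h1.
  have := onemq 1; have := q2; rewrite !(exprS q, expr0, mulr1) => *.
  by field; nz.
have := gram_highest_sphere n; rewrite IH.
have := gram_norm_c3_step 0 n 0; have := gram_norm_c2_step 0 n 0.
rewrite add0n; have := onemq n; have := onemq n.+1; have := onemq n.+2.
rewrite !(exprS q, expr0, mulr1).
set y := gram 0 0 n 1 0 _ _ _ _ _; set z := gram 0 0 n 0 1 _ _ _ _ _.
set x := gram _ _ _ _ _ _ _ _ _ _ => nz3 nz2 nz1.
move/(canRL (mulKf nz1)) => ->.
have nz4 : 1 ^+ 2 * (1 - (q * q ^+ n) ^+ 2) * (1 - (q * (q * q ^+ n)) ^+ 2) != 0 by nz.
move/(canRL (mulKf nz4)) => -> e.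
set l := (X in X = _) in e.
transitivity (q ^+ 4 * (1 - (q * q ^+ n) ^+ 2)
  / (1 - (q * (q * (q * q ^+ n))) ^+ 2) * l); last by rewrite /l; field; nz.
by rewrite e; field; nz.
Qed.

Lemma gram_norm_d2_1 d n : gram d 1 n 0 0 d 1 n 0 0 =
  q ^+ d ^+ 2 * (1 - q ^+ 2) / (1 - (q ^+ d.+1) ^+ 2) * gram d.+1 0 n 0 0 d.+1 0 n 0 0.
Proof.
have := gram_norm_d2_step d 0 n 0; have nz2 := onemq n.+1; have nz3 := onemq d.
move: nz2 nz3; rewrite !(addn0, expr0, exprS q, mulr1) => nz2 nz3.
have nz7 : 1 ^+ 2 * 1 ^+ 2 * (1 - (q * q ^+ d) ^+ 2)
    * (1 - (q * (q * q ^+ n)) ^+ 2) != 0 by nz.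
by move/(canRL (mulKf nz7)) => ->; field; nz.
Qed.

(** Straightening gives two kets. The inner product with the first follows from [gramF1], the one
    with the second from [gram_c2_step]. *)
Lemma gram_lowered_highest d n : h (bra d 1 n 1 0 * (m1 ^+ d * m3 * x1 ^+ n.+1)) =
  q ^+ 3 * q ^+ d ^+ 4 * q ^+ n * (1 - q ^+ 2) ^+ 2
    / ((1 - (q ^+ d.+1) ^+ 2) * (1 - (q ^+ (d + n).+3) ^+ 2))
    * gram d.+1 0 n.+1 0 0 d.+1 0 n.+1 0 0.
Proof.
have nz1 := onemq n; have nz2 := onemq n.+1; have nz3 := onemq d.
have nz4 := onemq (d + n).+2.
have em : m1 ^+ d * m3 * x1 ^+ n.+1 = q ^- n.+1 *: (m1 ^+ d * m2 * x1 ^+ n * x2)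
    - q ^- n.+2 *: (m1 ^+ d.+1 * x1 ^+ n * x3).
  rewrite -mulrA; have := m3_m2_x1_reorder 0 n; rewrite expr0 !mulr1 expr1 => ->.
  by rewrite !add0n mulrBr -!scalerAr [m1 ^+ d.+1]exprSr !mulrA.
rewrite {}em.
have := gramF1 d 1 n 0 0 d 1 n 0 0; have := gram_c2_step d 1 n 0 0 d.+1 0 n 1.
have := gram_norm_c3_step d.+1 n 0; rewrite gram_norm_d2_1 !qnumQ; move: nz1 nz2 nz3 nz4.
rewrite !(addn0, addnS, addSn) !(expr0, exprS q, mulr1, exprD) => nz1 nz2 nz3 nz4.
have nz8 : 1 ^+ 2 * (1 - (q * q ^+ n) ^+ 2)
    * (1 - (q * (q * (q * (q ^+ d * q ^+ n)))) ^+ 2) != 0 by nz.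
move/(canRL (mulKf nz8)) => ->.
have nz9 : 1 * q * (1 - (q * (q * q ^+ n)) ^+ 2) != 0 by nz.
move/(canRL (mulKf nz9)) => e2 e1.
rewrite mulrBr -!scalerAr linearB !linearZ /=.
have -> : m1 ^+ d * m2 * x1 ^+ n * x2 = ket d 1 n 1 0 by rewrite /ket !expr1 expr0 mulr1.
have -> : m1 ^+ d.+1 * x1 ^+ n * x3 = ket d.+1 0 n 0 1.
  by rewrite /ket !expr1 !expr0 !mulr1.
rewrite -/(gram _ _ _ _ _ _ _ _ _ _) -/(gram _ _ _ _ _ _ _ _ _ _) /= in e1 e2 *.
have nz10 : 1 / (q ^+ n * q) * (q * (1 - (q * (q * q ^+ n)) ^+ 2)
  / (q * (q * q ^+ n) * (1 - q * q))) != 0.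
  by rewrite ?mul1r; nz.
move/eqP: e1; rewrite subr_eq => /eqP/(canRL (mulKf nz10)) ->; rewrite {}e2.
by field; nz.
Qed.

(** Insert [tm1] between t1^d and m1^d. The m1 and m2 terms are norms for d + 1; the m3 term [T]
    stays outside type (a) and is eliminated through E1. *)
Lemma gram_highest_d_step d n :
  q ^+ 4 * (1 - (q ^+ d.+1) ^+ 2) * (1 - (q ^+ (d + n).+2) ^+ 2)
    * gram d 0 n 0 0 d 0 n 0 0 =
  (1 - (q ^+ d.+2) ^+ 2) * (1 - (q ^+ (d + n).+3) ^+ 2)
    * gram d.+1 0 n 0 0 d.+1 0 n 0 0.
Proof.
pose V := m1 ^+ d * m3 * x1 ^+ n.
pose T := h (s1 ^+ n * t3 * t1 ^+ d * V).
pose U := h (bra d 1 n.-1 1 0 * V).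
have eP : gram d 0 n 0 0 d 0 n 0 0 = gram d.+1 0 n 0 0 d.+1 0 n 0 0
   + (q * q ^+ d) ^- 2 * gram d 1 n 0 0 d 1 n 0 0 + (q * (q * q ^+ d)) ^- 2 * T.
  rewrite /T /V /gram /bra /ket !expr0 !mul1r !mulr1 -{1}[m1 ^+ d]mul1r -{1}tm1 !expr1.
  rewrite !mulrDl !mulrDr -!(scalerAl, scalerAr) !linearD !linearZ /=.
  have := qcommX 1 d t21; rewrite muln1 expr1 => et2.
  have := qcommX 1 d t31; rewrite muln1 expr1 => et3.
  have := qcommX d 1 m12; rewrite mul1n expr1 => em2.
  have := qcommX d 1 m13; rewrite mul1n expr1 => em3.
  rewrite !mulrA -!(mulrA _ _ (m1 ^+ d)) em2 em3 -!scalerAr -!scalerAl.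
  rewrite -!(mulrA _ (t1 ^+ d) t2) et2 -!(mulrA _ (t1 ^+ d) t3) et3 -!scalerAr -!scalerAl.
  rewrite !linearZ /= -!(mulrA _ (t1 ^+ d) t1) -exprSr -(exprS m1) !mulrA.
  by congr (_ + _ + _); congr (_ * _); field; nz.
(* E1 sends t2 to a multiple of t3 and m3 to m2. Integrating it by parts against [V] trades [T] for
   a known norm and, from E1 on s1^n, the correction [U]. *)
have eT : T = gram d 1 n 0 0 d 1 n 0 0 - q * [n] * U.
  have := skew_pair (s1 ^+ n * t2 * t1 ^+ d) V skE1.
  have [e1 _ _] := E1x; have [e4 _ e6] := E1m; have [k1 _ _] := kE1x.
  have [k4 _ k6] := kE1m.
  have [g1 _ _] := E1s; have [g4 g5 _] := E1t; have [l1 _ _] := kE1s.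
  have [l4 l5 _] := kE1t.
  have g1' := skewX q0 qq skE1 n (or_introl (conj l1 (qcR s21))) g1.
  rewrite /V !(skewM skE1) !(kapM skE1) (skewX0 skE1 _ e1) (skewX0 skE1 _ e4).
  rewrite (skewX0 skE1 _ g4) g1' g5 e6 l5 k6.
  rewrite !(kapX skE1 _ k1, kapX skE1 _ k4, kapX skE1 _ l4).
  rewrite !expr1n !scale1r !(mulr0, mul0r, add0r, addr0).
  rewrite /T /U /gram /bra /ket !expr0 !mul1r !mulr1 !expr1 /V.
  do 6 rewrite -?scalerAr -?scalerAl ?scalerA ?mulrDl ?scalerDr.
  rewrite !(linearD, linearZ) /= exprVn.
  move: (h _) (h _) (h _) => x y z e.
  rewrite -[z](mulVKf (expf_neq0 n q0)) e.
  by field; nz.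
have nz1 := onemq n; have nz2 := onemq n.+1; have nz3 := onemq d; have nz4 := onemq (d + n).+1.
have nz5 := onemq (d + n).+2; have nz6 := onemq d.+1.
move: eP; rewrite {}eT gram_norm_d2_1.
(* At n = 0 the factor [0] cancels [U], which [gram_lowered_highest] evaluates only for positive
   n. *)
case: n @V @U T nz1 nz2 nz4 nz5 => [|n] V U _ nz1 nz2 nz4 nz5.
  rewrite qnum0 mulr0 mul0r subr0.
  move: nz1 nz2 nz3 nz4 nz5 nz6.
  rewrite !(addn0, expr0, exprS q, mulr1) => nz1 nz2 nz3 nz4 nz5 nz6.
  by move=> ->; field; nz.
rewrite /U /V /= gram_lowered_highest qnumQ.
move: nz1 nz2 nz3 nz4 nz5 nz6.
rewrite !(addn0, addnS) !(expr0, exprS q, mulr1, exprD) => nz1 nz2 nz3 nz4 nz5 nz6.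
by move=> ->; field; nz.
Qed.

(** * Closed formulas and the general inner product *)

Local Notation gram_prod := (gram_prod q).

Lemma phiSq n : phi n.+1 = phi n * (1 - (q ^+ n.+1) ^+ 2).
Proof. by rewrite phiS exprAC. Qed.

Let phi_nz n : phi n != 0. Proof. exact: phi_neq0. Qed.

Lemma gram_highest d n : gram d 0 n 0 0 d 0 n 0 0 = gram_prod d 0 n 0 0.
Proof.
elim: d => [|d IH].
  rewrite gram_highest_d0 /gram_prod !(addn0, add0n, muln0, mul0n, addn1, addn2) !phiSq qpoch0.
  have := onemq n; have := onemq n.+1; have := onemq 0; have := onemq 1.
  have := phi_nz n; rewrite mulnC exprM !(expr0, exprS q, mulr1) => *.
  by field; nz.
have := gram_highest_d_step d n; rewrite IH {IH}.
have := onemq d.+1; have := onemq (d + n).+2 => nz1 nz2.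
move/esym; have := mulf_neq0 nz2 nz1 => nz3 /(canRL (mulKf nz3)) ->.
rewrite /gram_prod !(addn0, add0n, muln0, mul0n, addn1, addn2, addSn, mulnS, mulSn).
have := onemq (d + n).+1; have := onemq (d + n); have := onemq d; have := onemq n.
have := phi_nz n; have := phi_nz d; have := phi_nz (d + n); move: nz1 nz2 {nz3}.
rewrite !phiSq !(expr0, exprS q, mulr1, exprD) => *.
by field; nz.
Qed.

Lemma exprM2 n : q ^+ (2 * n) = (q ^+ n) ^+ 2. Proof. by rewrite mulnC exprM. Qed.
Lemma exprM4 n : q ^+ (4 * n) = (q ^+ n) ^+ 4. Proof. by rewrite mulnC exprM. Qed.

Lemma gram_norm_d2_0 d c1 c3 : gram d 0 c1 0 c3 d 0 c1 0 c3 = gram_prod d 0 c1 0 c3.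
Proof.
elim: c3 c1 => [|c3 IH] c1; first exact: gram_highest.
have nz1 := onemq c1; have nz2 := onemq (d + c1).+1.
have nz3 : q ^+ c3 ^+ 2 * (1 - (q ^+ c1.+1) ^+ 2) * (1 - (q ^+ (d + c1).+2) ^+ 2) != 0.
  by nz.
have := gram_norm_c3_step d c1 c3; rewrite IH => /(canRL (mulKf nz3)) -> {nz3}.
have nz4 := phi_nz d; have nz5 := phi_nz (c1 + c3); have nz6 := phi_nz (d + c1 + c3).
have nz7 := onemq (c1 + c3); have nz8 := onemq (c1 + c3).+1.
have nz9 := onemq (d + c1 + c3); have nz10 := onemq (d + c1 + c3).+1.
have nz11 := onemq (d + c1 + c3).+2; have nz12 := onemq d; have nz13 := onemq c1.+1.
have nz14 := phi_nz c1.
rewrite /gram_prod.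
rewrite !(addn0, add0n, muln0, mul0n, addn1, addn2, addSn, addnS, mulnS, mulSn, mulnDr).
move: nz1 nz2 nz4 nz5 nz6 nz7 nz8 nz9 nz10 nz11 nz12 nz13 nz14.
rewrite !phiSq !(expr0, exprS q, mulr1, exprD, exprM2, exprM4) => *.
by field; nz.
Qed.

Lemma gram_norm d1 d2 c1 c3 : gram d1 d2 c1 0 c3 d1 d2 c1 0 c3 = gram_prod d1 d2 c1 0 c3.
Proof.
elim: d2 d1 => [|d2 IH] d1; first exact: gram_norm_d2_0.
have nz1 := onemq d1; have nz2 := onemq (c1 + d2).+1.
have nz3 : q ^+ d2 ^+ 2 * q ^+ c3 ^+ 2 * (1 - (q ^+ d1.+1) ^+ 2)
  * (1 - (q ^+ (c1 + d2).+2) ^+ 2) != 0 by nz.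
have := gram_norm_d2_step d1 d2 c1 c3; rewrite IH => /(canRL (mulKf nz3)) -> {nz3}.
rewrite /gram_prod.
rewrite !(addn0, add0n, muln0, mul0n, addn1, addn2, addSn, addnS, mulnS, mulSn, mulnDr).
rewrite [(c1 + d2)%N]addnC [(c1 + c3 + d2)%N]addnC addnA in nz2 *.
have nz4 := phi_nz (d1 + d2 + c1 + c3); have nz5 := phi_nz (c1 + c3).
have nz6 := phi_nz (d2 + c1); have nz7 := phi_nz (d1 + d2).
have nz8 := onemq (d1 + d2 + c1 + c3); have nz9 := onemq (d1 + d2 + c1 + c3).+1.
have nz10 := onemq (d1 + d2 + c1 + c3).+2; have nz11 := onemq (c1 + c3).
have nz12 := onemq (d2 + c1); have nz13 := onemq (d1 + d2); have nz14 := onemq (d1 + d2).+1.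
move: nz1 nz2 nz4 nz5 nz6 nz7 nz8 nz9 nz10 nz11 nz12 nz13 nz14.
rewrite !phiSq !(expr0, exprS q, mulr1, exprD, exprM2, exprM4) => *.
by field; nz.
Qed.

(** Each use of [gram_c2_step] trades a pair s2, t2 of the bra for s3, t1, until the bra is the
    adjoint of the ket. *)
Lemma gram_c2_all d1 d2 c1 c2 c3 : (c2 <= d2)%N ->
  gram d1 d2 c1 c2 c3 (d1 + c2) (d2 - c2) c1 0 (c3 + c2) = gram_prod d1 d2 c1 c2 c3.
Proof.
elim: c2 d1 d2 c3 => [|c2 IH] d1 d2 c3; first by rewrite !addn0 subn0 gram_norm.
case: d2 => // d2 c2d2.
have nz1 := onemq (c1 + d2).+1.
have nz2 : q ^+ c2 * q ^+ d2.+1 * (1 - (q ^+ (c1 + d2.+1).+1) ^+ 2) != 0.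
  by rewrite addnS; nz.
have := gram_c2_step d1 d2.+1 c1 c2 c3 (d1 + c2.+1) (d2.+1 - c2.+1) c1 (c3 + c2.+1).
rewrite subSS -(addSnnS d1) -(addSnnS c3) [d2.+1.-1]/= IH // => /(canRL (mulKf nz2)) -> {nz2}.
rewrite /gram_prod.
rewrite !(addn0, add0n, muln0, mul0n, addn1, addn2, addSn, addnS, mulnS, mulSn, mulnDr).
rewrite [(c1 + d2)%N]addnC in nz1 *.
have nz4 := phi_nz (d1 + d2 + c1 + c2 + c3); have nz5 := phi_nz (c1 + c2 + c3).
have nz6 := phi_nz (d2 + c1); have nz7 := phi_nz (d1 + d2).
have nz8 := onemq (d1 + d2 + c1 + c2 + c3); have nz9 := onemq (d1 + d2 + c1 + c2 + c3).+1.
have nz10 := onemq (d1 + d2 + c1 + c2 + c3).+2.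
have nz15 := onemq (d1 + d2 + c1 + c2 + c3).+3; have nz11 := onemq (c1 + c2 + c3).
have nz16 := onemq (c1 + c2 + c3).+1.
have nz12 := onemq (d2 + c1); have nz13 := onemq (d1 + d2); have nz14 := onemq (d1 + d2).+1.
move: nz1 nz4 nz5 nz6 nz7 nz8 nz9 nz10 nz11 nz12 nz13 nz14 nz15 nz16.
rewrite !phiSq !(expr0, exprS q, mulr1, exprD, exprM2, exprM4) => *.
by field; nz.
Qed.

(** Here n = c2 - k and r = d2 - k. [gramF1] expresses the case n + 1 by two cases n: one with k + 1
    and r - 1, the other with c1 + 1. Hence all other parameters vary in the induction. *)
Theorem gram_eq_val d1 r c1 n c3 k :
  gram d1 (k + r) c1 (k + n) c3 (d1 + k) r c1 n (c3 + k) =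
  gram_val q d1 (k + r) c1 (k + n) c3 k.
Proof.
elim: n r c1 c3 k d1 => [|n IH] r c1 c3 k d1.
  rewrite addn0 gram_val0 // -[in RHS](gram_c2_all d1 c1 c3 (leq_addr r k)).
  by rewrite [(k + r - k)%N]addKn.
have := gramF1 d1 (k + r) c1 (k + n) c3 (d1 + k) r c1 n (c3 + k).
rewrite IH -(addnS k n).
set cY := q * [r] / _.
have -> : cY * gram d1 (k + r) c1 (k + n.+1) c3 (d1 + k).+1 r.-1 c1 n (c3 + k).+1
   = cY * gram_val q d1 (k + r) c1 (k + n.+1) c3 k.+1.
  (* For r = 0 the truncated r - 1 would break the induction hypothesis, but the coefficient [0]
     vanishes. *)
  rewrite /cY; case: (r) => [|r']; first by rewrite qnum0 !(mulr0, mul0r).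
  by have := IH r' c1 c3 k.+1 d1; rewrite !(addnS, addSn) => ->.
rewrite {}/cY; have := gram_val_rec q0 q1 d1 r c1 n c3 k.
have nz1 := onemq (r + c1).
have nz2 : 1 - (q ^+ 2) ^+ (r + c1).+1 != 0 by rewrite exprAC.
move/(canRL (mulKf nz2)) => ->.
move: (gram_val _ _ _ _ _ _ _) (gram_val _ _ _ _ _ _ _) (gram _ _ _ _ _ _ _ _ _ _) => Y Z X.
rewrite !qnumQ !(exprAC q 2) [(c1.+1 + r)%N]addSn [(c1 + r)%N]addnC.
move: nz1 {nz2}; rewrite !(exprS q, exprD, expr0, mulr1) => nz1.
set cX := (X in X * _ - _ = _ -> _).
have nzX : cX != 0 by rewrite /cX; nz.
move/eqP; rewrite subr_eq => /eqP/(canRL (mulKf nzX)) ->; rewrite {nzX}/cX.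
by field; nz.
Qed.
End Gram.

(** * Generators, minors and representations of GLq3 *)

Section Induction.
Variables (K : fieldType) (q : K).

Lemma falg_ind (G : choiceType) (P : falg K G -> Prop) :
  P 1 -> (forall u v, P u -> P v -> P (u + v)) -> (forall c u, P u -> P (c *: u)) ->
  (forall i u, P u -> P (fgen K i * u)) -> forall u, P u.
Proof.
move=> P1 PD PZ PM u.
have P0 : P 0 by rewrite -(scale0r (1 : falg K G)); exact: PZ.
rewrite [u](monalgE (u : malg _ _)).
elim/big_ind: _ => // m _.
have -> : mkmalgU m (mcoeff m u) =
    mcoeff m u *: (mkmalgU m 1 : falg K G).
  apply/malgP => m'.
  by rewrite [RHS](mcoeffZ) !mcoeffU mulrnAr mulr1.
apply: PZ; rewrite -[m]fmK.
elim: (fmonom_val m) => [|i s IH].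
  rewrite -fmoneE; exact: P1.
have -> : mkmalgU (FMonom (i :: s)) 1 =
    fgen K i * (mkmalgU (FMonom s) 1 : falg K G) :> falg K G.
  rewrite fgen.unlock [RHS]malgM_def fgmulUU mulr1; congr (mkmalgU _ _).
  apply/eqP; rewrite fmP fmM fmU //.
exact: PM.
Qed.

Lemma GLq3_ind (P : GLq3 q -> Prop) :
  P 1 -> (forall u v, P u -> P v -> P (u + v)) -> (forall c u, P u -> P (c *: u)) ->
  (forall i j u, P u -> P (xg q i j * u)) -> (forall u, P u -> P (dinv q * u)) ->
  forall u, P u.
Proof.
move=> P1 PD PZ Px Pd x; have [u ->] := qpi_surj x.
elim/falg_ind: u => [|u v hu hv|c u hu|[[i j]|] u hu].
- by rewrite [qpi _ _](rmorph1 (@GLq3_pi K q)).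
- by rewrite [qpi _ _](rmorphD (@GLq3_pi K q)); apply: PD.
- by rewrite [qpi _ _](linearZ_LR (@GLq3_pi K q)); apply: PZ.
- by rewrite [qpi _ _](rmorphM (@GLq3_pi K q)); apply: Px.
- by rewrite [qpi _ _](rmorphM (@GLq3_pi K q)); apply: Pd.
Qed.
End Induction.

(** * Explicit quantum minors of size 2 and 3 *)

Section Minors.
Variables (K : fieldType) (q : K) (A : lalgType K) (x : 'I_3 -> 'I_3 -> A).

(** Frees the size of the permutations from the cardinal in the type used by [qminor], so that it
    can be the numeral 2 or 3. *)
Definition perm_sum n (f : nat -> nat -> A) : A :=
  \sum_(s : 'S_n) (- q) ^+ inversions s *: \prod_(p < n) f p (s p).

Lemma qminorE n (I J : {set 'I_3}) : #|I| = n ->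
  qminor q x I J = perm_sum n (fun p r => x (nth ord0 (enum I) p) (nth ord0 (enum J) r)).
Proof. by move=> <-. Qed.

Lemma inversionsE n (s : 'S_n) :
  inversions s = (\sum_(i < n) \sum_(j < n) ((i < j)%N && (s j < s i)%N))%N.
Proof.
rewrite /inversions cardsE -sum1_card pair_big big_mkcond /=.
by apply: eq_bigr => -[i j] _ /=; rewrite unfold_in /=; case: (_ && _).
Qed.

(** A duplicate-free list of n! permutations is complete by counting, so exhaustiveness of an
    explicit list needs no case analysis. *)
Lemma perm_enumeration n (L : seq 'S_n) : uniq L -> size L = n`! ->
  forall (V : nmodType) (F : 'S_n -> V), \sum_s F s = \sum_(s <- L) F s.
Proof.
move=> uL sL V F; rewrite -big_enum /=; apply: perm_big; rewrite perm_sym.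
have sub : {subset L <= enum {: 'S_n}} by move=> s _; rewrite mem_enum.
have [|_ e] := uniq_min_size uL sub; first by rewrite -cardE card_Sn sL.
by apply: uniq_perm; rewrite ?enum_uniq.
Qed.

Local Notation o0 := (@Ordinal 2 0 isT).
Local Notation o1 := (@Ordinal 2 1 isT).

Lemma perm_sum2 f : perm_sum 2 f = f 0%N 0%N * f 1%N 1%N - q *: (f 0%N 1%N * f 1%N 0%N).
Proof.
have e s : inversions (s : 'S_2) = (s (inord 1) < s (inord 0))%N.
  rewrite inversionsE !big_ord_recl !big_ord0 /= !addn0 add0n.
  by congr (nat_of_bool ((s _ < s _)%N)); apply: val_inj; rewrite /= inordK.
pose t := tperm (inord 0 : 'I_2) (inord 1).
rewrite /perm_sum (perm_enumeration (L := [:: 1%g; t])) /=; last 2 first.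
- rewrite inE andbT; apply/eqP => /permP /(_ (inord 0)); rewrite perm1 tpermL.
  by move/(congr1 val); rewrite /= !inordK.
- by [].
rewrite !big_cons big_nil addr0 !e !perm1 !big_ord_recl !big_ord0 /= !mulr1.
have -> : ord0 = inord 0 :> 'I_2 by apply: val_inj; rewrite /= inordK.
have -> : lift (inord 0) ord0 = inord 1 :> 'I_2 by apply: val_inj; rewrite /= /bump !inordK.
rewrite !perm1 tpermL tpermR !inordK //= expr0 scale1r expr1 scaleNr.
done.
Qed.

Lemma perm_sum3 (f : nat -> nat -> A) : perm_sum 3 f =
   f 0%N 0%N * (f 1%N 1%N * f 2%N 2%N) - q *: (f 0%N 1%N * (f 1%N 0%N * f 2%N 2%N))
   - q *: (f 0%N 0%N * (f 1%N 2%N * f 2%N 1%N))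
   + q ^+ 2 *: (f 0%N 1%N * (f 1%N 2%N * f 2%N 0%N))
   + q ^+ 2 *: (f 0%N 2%N * (f 1%N 0%N * f 2%N 1%N))
   - q ^+ 3 *: (f 0%N 2%N * (f 1%N 1%N * f 2%N 0%N)).
Proof.
pose i0 : 'I_3 := inord 0; pose i1 : 'I_3 := inord 1; pose i2 : 'I_3 := inord 2.
have e s : inversions (s : 'S_3) = ((s i1 < s i0) + (s i2 < s i0) + (s i2 < s i1))%N.
  rewrite inversionsE !big_ord_recl !big_ord0 /= !addn0 !add0n.
  by congr ((s _ < s _)%N + (s _ < s _)%N + (s _ < s _)%N)%N; apply: val_inj;
    rewrite /= inordK.
pose L : seq 'S_3 := [:: 1%g; tperm i0 i1; tperm i1 i2; (tperm i1 i2 * tperm i0 i1)%g;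
  (tperm i0 i1 * tperm i1 i2)%g; tperm i0 i2].
have v0 : i0 = 0%N :> nat by rewrite inordK.
have v1 : i1 = 1%N :> nat by rewrite inordK.
have v2 : i2 = 2%N :> nat by rewrite inordK.
have [n01 n02 n12] : [/\ i0 != i1, i0 != i2 & i1 != i2] by rewrite -!val_eqE /= v0 v1 v2.
have [n10 n20 n21] : [/\ i1 != i0, i2 != i0 & i2 != i1] by rewrite -!val_eqE /= v0 v1 v2.
pose tp := (permM, perm1, @tpermL _, @tpermR _, tpermD n02 n12, tpermD n10 n20,
  tpermD n01 n21).
have uL : uniq L.
  apply: (@map_uniq _ _ (fun s : 'S_3 => (s i0 : nat, s i1 : nat))).
  by rewrite /= !tp v0 v1 v2.
rewrite /perm_sum (perm_enumeration uL) // !big_cons big_nil addr0 !e.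
rewrite !big_ord_recl !big_ord0 /= !mulr1.
have -> : ord0 = i0 :> 'I_3 by apply: val_inj; rewrite /= v0.
have -> : lift i0 ord0 = i1 :> 'I_3 by apply: val_inj; rewrite /= /bump v0 v1.
have -> : lift i0 (lift ord0 ord0) = i2 :> 'I_3 by apply: val_inj; rewrite /= /bump v0 v2.
rewrite !tp v0 v1 v2 /=.
rewrite !add0n !addn0 expr0 scale1r expr1 sqrrN !scaleNr exprNn -signr_odd expr1.
by rewrite mulN1r !scaleNr !addrA.
Qed.

Lemma enum3 (I : {set 'I_3}) : enum I = [seq i <- [:: lab1; lab2; lab3] | i \in I].
Proof.
rewrite {1}/enum_mem -enumT; congr filter.
by apply: (inj_map val_inj); rewrite val_enum_ord.
Qed.

Lemma qminor2 (I J : {set 'I_3}) i i' j j' : enum I = [:: i; i'] -> enum J = [:: j; j'] ->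
  qminor q x I J = x i j * x i' j' - q *: (x i j' * x i' j).
Proof.
move=> eI eJ; rewrite (@qminorE 2) ?perm_sum2 ?eI ?eJ //.
by rewrite cardE eI.
Qed.

Lemma qminor3 : qminor q x setT setT =
   x lab1 lab1 * (x lab2 lab2 * x lab3 lab3) - q *: (x lab1 lab2 * (x lab2 lab1 * x lab3 lab3))
   - q *: (x lab1 lab1 * (x lab2 lab3 * x lab3 lab2))
   + q ^+ 2 *: (x lab1 lab2 * (x lab2 lab3 * x lab3 lab1))
   + q ^+ 2 *: (x lab1 lab3 * (x lab2 lab1 * x lab3 lab2))
   - q ^+ 3 *: (x lab1 lab3 * (x lab2 lab2 * x lab3 lab1)).
Proof. by rewrite (@qminorE 3) ?cardsT ?card_ord // perm_sum3 enum3 /= !inE. Qed.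

Lemma enumC1 : [/\ enum (~: [set lab1]) = [:: lab2; lab3],
    enum (~: [set lab2]) = [:: lab1; lab3]
  & enum (~: [set lab3]) = [:: lab1; lab2]].
Proof. by split; rewrite enum3 /= !inE. Qed.
End Minors.

(** * Triangular 2 x 2 representations and the universal property *)

Section TriangularRep.
Variables (K : fieldType) (q : K).

Definition tri (a b c : K) : 'M[K]_2 :=
  \matrix_(i, j) (if i == 0 then if j == 0 then a else b else if j == 0 then 0 else c).

Lemma triM a b c a' b' c' : tri a b c * tri a' b' c' = tri (a * a') (a * b' + b * c') (c * c').
Proof.
apply/matrixP => i j; rewrite !mxE !big_ord_recl big_ord0 !mxE /= addr0.
by case: i => [[|[|]]] //= ?; case: j => [[|[|]]] //= ?; rewrite ?(mulr0, mul0r, add0r, addr0).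
Qed.

Lemma triD a b c a' b' c' : tri a b c + tri a' b' c' = tri (a + a') (b + b') (c + c').
Proof.
apply/matrixP => i j; rewrite !mxE.
by case: i => [[|[|]]] //= ?; case: j => [[|[|]]] //= ?; rewrite addr0.
Qed.

Lemma triZ k a b c : k *: tri a b c = tri (k * a) (k * b) (k * c).
Proof.
apply/matrixP => i j; rewrite !mxE.
by case: i => [[|[|]]] //= ?; case: j => [[|[|]]] //= ?; rewrite mulr0.
Qed.

Lemma triN a b c : - tri a b c = tri (- a) (- b) (- c).
Proof. by rewrite -scaleN1r triZ !mulN1r. Qed.

Lemma tri1 : tri 1 0 1 = 1.
Proof.
apply/matrixP => i j; rewrite !mxE.
by case: i => [[|[|]]] //= ?; case: j => [[|[|]]] //= ?.
Qed.

Lemma tri0 : tri 0 0 0 = 0.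
Proof.
apply/matrixP => i j; rewrite !mxE.
by case: i => [[|[|]]] //= ?; case: j => [[|[|]]] //= ?.
Qed.

Lemma GLq3_rel_eval (A B : lalgType K) (f : {lrmorphism A -> B})
    (x : 'I_3 -> 'I_3 -> A) (t r : A) :
  GLq3_rel q x t r -> GLq3_rel q (fun i j => f (x i j)) (f t) (f r).
Proof.
case=> [i l j il|i j k jk|i l j k il jk|i l j k il jk|i j|].
- rewrite (linearB f) (linearZ_LR f) !(rmorphM f).
  exact: (@GLq3_col _ _ _ (fun i j => f (x i j))).
- rewrite (linearB f) (linearZ_LR f) !(rmorphM f).
  exact: (@GLq3_row _ _ _ (fun i j => f (x i j))).
- rewrite (linearB f) !(rmorphM f); exact: (@GLq3_comm _ _ _ (fun i j => f (x i j))).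
- rewrite (linearB f) (linearD f) (linearZ_LR f) !(rmorphM f).
  exact: (@GLq3_cross _ _ _ (fun i j => f (x i j))).
- rewrite (linearB f) !(rmorphM f); exact: (@GLq3_central _ _ _ (fun i j => f (x i j))).
rewrite (linearB f) (rmorphM f) (rmorph1 f) /qminor (raddf_sum f).
have -> : (\sum_(s : 'S_#|[set: 'I_3]|) f ((- q) ^+ inversions s *:
    \prod_(p < #|[set: 'I_3]|)
      x (nth ord0 (enum [set: 'I_3]) p) (nth ord0 (enum [set: 'I_3]) (s p))))
  = qminor q (fun i j => f (x i j)) setT setT.
  by apply: eq_bigr => s _; rewrite (linearZ_LR f) -(rmorph_prod f).
exact: GLq3_inv.
Qed.
End TriangularRep.

Section Eval.
Variables (K : fieldType) (q : K) (B : algType K) (g : option ('I_3 * 'I_3) -> B).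
Hypothesis gP : forall r, GLq3_rel q (fun i j => g (Some (i, j))) (g None) r -> r = 0.

Definition GLq3_eval : GLq3 q -> B := qalg_eval (free_eval g).

Lemma GLq3_eval_pi u : GLq3_eval (GLq3_pi q u) = free_eval g u.
Proof.
apply: (qalg_eval_qpi (f := free_eval g)) => r /(GLq3_rel_eval (free_eval g)) h.
apply: gP; rewrite -[g None](free_eval_gen g).
have -> // : (fun i j => g (Some (i, j))) =
  (fun i j => free_eval g (@free_x K i j)).
by apply: boolp.funext => i; apply: boolp.funext => j; rewrite free_eval_gen.
Qed.

Lemma GLq3_eval_xg i j : GLq3_eval (xg q i j) = g (Some (i, j)).
Proof. by rewrite GLq3_eval_pi free_eval_gen. Qed.

Lemma GLq3_eval_dinv : GLq3_eval (dinv q) = g None.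
Proof. by rewrite GLq3_eval_pi free_eval_gen. Qed.

Lemma GLq3_evalM x y : GLq3_eval (x * y) = GLq3_eval x * GLq3_eval y.
Proof.
have [u ->] := qpi_surj x; have [v ->] := qpi_surj y.
by rewrite -rmorphM !GLq3_eval_pi rmorphM.
Qed.

Lemma GLq3_eval1 : GLq3_eval 1 = 1.
Proof. by rewrite [LHS](GLq3_eval_pi 1) rmorph1. Qed.

Lemma GLq3_eval_linear : linear GLq3_eval.
Proof.
move=> c x y; have [u ->] := qpi_surj x; have [v ->] := qpi_surj y.
rewrite -[_ + _](linearP (GLq3_pi q)).
by rewrite !GLq3_eval_pi linearP.
Qed.
End Eval.

(** * Slices of the coproduct *)

Section Slice.
Variables (K : fieldType) (q : K).
Local Notation O := (GLq3 q).
Variable Delta : {lrmorphism O -> GLq3_tens q}.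
Variable h : {scalar O}.
Hypothesis hh : is_haar Delta h.

Section Functional.
Variable f : O -> K.
Hypothesis fl : linear (f : O -> K^o).

Definition slice (t : GLq3_tens q) : O := tlift (fun a b => f b *: a) t.

Let fl1 b : linear (fun a : O => f b *: a).
Proof. by move=> c u v; rewrite scalerDr !scalerA mulrC. Qed.
Let fl2 (a : O) : linear (fun b : O => f b *: a).
Proof. by move=> c u v; rewrite fl scalerDl scalerA. Qed.

Lemma slice_pure a b : slice (pure a b) = f b *: a.
Proof. exact: tlift_pure. Qed.

Lemma slice_linear : linear slice.
Proof. exact: tlift_linear. Qed.

Lemma sliceD : {morph slice : u v / u + v}.
Proof. by have [] := linearDZ slice_linear. Qed.

Lemma slice0 : slice 0 = 0.
Proof. by have [] := linearDZ slice_linear. Qed.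

(** Evaluate h (x) f on Delta(x) in the other order: h first gives h(x) 1 by right invariance, then
    f gives h(x) f(1). *)
Lemma haar_slice x : h (slice (Delta x)) = h x * f 1.
Proof.
have [fD fZ f0] := linearDZ fl.
have hl (b : O) : linear (fun a : O => h a *: b).
  by move=> c u v; rewrite linearP scalerDl scalerA.
have hr a : linear (fun b : O => h a *: b).
  by move=> c u v; rewrite scalerDr !scalerA mulrC.
have [tD tZ t0] := linearDZ (tlift_linear hl hr).
have e t : h (slice t) = f (tens_id h t).
  elim/tens_ind: t => [|u v hu hv|a b].
  - by rewrite slice0 linear0 [tens_id h 0]t0 f0.
  - by rewrite sliceD linearD hu hv [tens_id h (u + v)]tD fD.
  - by rewrite slice_pure linearZ [tens_id h _](tlift_pure hl hr) fZ /= mulrC.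
by rewrite e (haar_right hh) fZ.
Qed.
End Functional.

Variable rho : O -> 'M[K]_2.
Hypothesis rho_lin : linear rho.
Hypothesis rhoM : forall x y, rho (x * y) = rho x * rho y.

Definition rho_entry i j (x : O) : K := rho x i j.

Lemma rho_entry_linear i j : linear (rho_entry i j : O -> K^o).
Proof. by move=> c u v; rewrite /rho_entry rho_lin !mxE. Qed.

(** The matrix product of rho passes to the slices; for triangular rho this becomes the skew Leibniz
    rule. *)
Lemma sliceM i j s t : slice (rho_entry i j) (s * t) =
  slice (rho_entry i 0) s * slice (rho_entry 0 j) t
  + slice (rho_entry i 1) s * slice (rho_entry 1 j) t.
Proof.
have sl k l := slice_linear (rho_entry_linear k l).
elim/tens_ind: s => [|u v hu hv|a b].
- by rewrite mul0r !slice0 ?mul0r ?addr0 //; exact: rho_entry_linear.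
- by rewrite mulrDl !(sliceD (rho_entry_linear _ _)) hu hv !mulrDl addrACA.
elim/tens_ind: t => [|u v hu hv|a' b'].
- by rewrite mulr0 !slice0 ?mulr0 ?addr0 //; exact: rho_entry_linear.
- by rewrite mulrDr !(sliceD (rho_entry_linear _ _)) hu hv !mulrDr addrACA.
rewrite [_ * _]tmul_pure !(slice_pure (rho_entry_linear _ _)) /rho_entry rhoM mxE.
rewrite !big_ord_recl big_ord0 addr0 scalerDl -!scalerAl -!scalerAr !scalerA.
by have -> : lift ord0 ord0 = 1 :> 'I_2 by apply: val_inj.
Qed.
End Slice.

Section Skew.
Variables (K : fieldType) (q : K).
Local Notation O := (GLq3 q).
Hypothesis q0 : q != 0.
Variable Delta : {lrmorphism O -> GLq3_tens q}.
Hypothesis hDelta : is_comult Delta.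
Variable h : {scalar O}.
Hypothesis hh : is_haar Delta h.

(* The off-diagonal entry represents E_i or F_i, and [kap] is the group-like K_i. *)
Definition tri_gen (s t : 'I_3) (kap : 'I_3 -> K) (o : option ('I_3 * 'I_3)) : 'M[K]_2 :=
  if o is Some (i, j) then tri (i == j)%:R ((i == s) && (j == t))%:R ((i == j)%:R * kap i)
  else 1.

(** Eigenvalues of K_1 on the three columns; [kap23] gives those of K_2. *)
Definition kap12 (i : 'I_3) : K := nth 1 [:: q^-1; q; 1] i.
Definition kap23 (i : 'I_3) : K := nth 1 [:: 1; q^-1; q] i.

(** The three cases are E_1, F_1 and E_2, in this order; the derivation replaces column t by column
    s. *)
Definition adjacent s t kap := [\/ [/\ s = lab1, t = lab2 & kap = kap12],
  [/\ s = lab2, t = lab1 & kap = kap12] | [/\ s = lab2, t = lab3 & kap = kap23]].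

(** A finite check over all index values. The determinant goes to the identity because the three
    weights multiply to 1, which is consistent with sending its inverse to 1. *)
Lemma tri_gen_rel s t kap : adjacent s t kap ->
  forall r, GLq3_rel q (fun i j => tri_gen s t kap (Some (i, j)))
    (tri_gen s t kap None) r -> r = 0.
Proof.
have e3 (i : 'I_3) : [\/ i = lab1, i = lab2 | i = lab3].
  by case: i => [[|[|[|//]]] p]; [apply: Or31 | apply: Or32 | apply: Or33]; apply: val_inj.
have fin (a b c : K) : a = 0 -> b = 0 -> c = 0 -> tri a b c = 0.
  by move=> -> -> ->; exact: tri0.
move=> adj r; case=> [i l j|i j k|i l j k|i l j k|i j|].
- case: adj => -[-> -> ->] /=; case: (e3 i) => ->; case: (e3 l) => -> //= _;
  case: (e3 j) => -> /=;
  rewrite !triM ?triZ ?triN ?triD; apply: fin; rewrite /kap12 /kap23 /=; by field.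
- case: adj => -[-> -> ->] /=; case: (e3 i) => ->; case: (e3 j) => -> //=;
  case: (e3 k) => -> //= _;
  rewrite !triM ?triZ ?triN ?triD; apply: fin; rewrite /kap12 /kap23 /=; by field.
- case: adj => -[-> -> ->] /=; case: (e3 i) => ->; case: (e3 l) => -> //= _;
  case: (e3 j) => ->; case: (e3 k) => -> //= _;
  rewrite !triM ?triZ ?triN ?triD; apply: fin; rewrite /kap12 /kap23 /=; by field.
- case: adj => -[-> -> ->] /=; case: (e3 i) => ->; case: (e3 l) => -> //= _;
  case: (e3 j) => ->; case: (e3 k) => -> //= _;
  rewrite !triM !triZ !triD triN !triD; apply: fin; rewrite /kap12 /kap23 /=; by field.
- by rewrite mul1r mulr1 subrr.
rewrite qminor3 mulr1 -tri1.
by case: adj => -[-> -> ->] /=; rewrite !triM !triZ !triN !triD; apply: fin;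
  rewrite /kap12 /kap23 /=; field.
Qed.

Section Adjacent.
Variables (s t : 'I_3) (kap : 'I_3 -> K).
Hypothesis adj : adjacent s t kap.
Let rho := GLq3_eval (q := q) (tri_gen s t kap).
Let L i j (x : O) : O := slice (rho_entry rho i j) (Delta x).
Let rho_lin : linear rho. Proof. exact: (GLq3_eval_linear (tri_gen_rel adj)). Qed.
Let rhoM x y : rho (x * y) = rho x * rho y.
Proof. exact: (GLq3_evalM (tri_gen_rel adj)). Qed.
Let el := rho_entry_linear rho_lin.

Let L_linear i j : linear (L i j).
Proof. by move=> c u v; rewrite /L linearP (slice_linear (el i j)). Qed.

Let LM i j x y : L i j (x * y) = L i 0 x * L 0 j y + L i 1 x * L 1 j y.
Proof. by rewrite /L rmorphM (sliceM rho_lin rhoM). Qed.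

Let L_xg k l i j : L k l (xg q i j) =
  \sum_p tri_gen s t kap (Some (p, j)) k l *: xg q i p.
Proof.
rewrite /L (comult_xg hDelta).
elim/big_ind2: _ => [|x1 x2 y1 y2 h1 h2|p _].
- exact: (slice0 (el k l)).
- by rewrite (sliceD (el k l)) h1 h2.
by rewrite (slice_pure (el k l)) /rho_entry /rho (GLq3_eval_xg (tri_gen_rel adj)).
Qed.

Let L_dinv k l : L k l (dinv q) = (1 : 'M_2) k l *: dinv q.
Proof.
by rewrite /L (comult_dinv hDelta) (slice_pure (el k l)) /rho_entry /rho
  (GLq3_eval_dinv (tri_gen_rel adj)).
Qed.

Let L1 k l : L k l 1 = (1 : 'M_2) k l *: 1.
Proof.
by rewrite /L rmorph1 [LHS](slice_pure (el k l) 1 1) /rho_entry /rho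
  (GLq3_eval1 (tri_gen_rel adj)).
Qed.

(** The lower left entry vanishes on generators, and the product rule propagates this along words.
    [L00] then shows in the same way that the upper left slice is the identity. *)
Let L10 x : L 1 0 x = 0.
Proof.
have [LD LZ L0] := linearDZ (L_linear 1 0).
elim/(GLq3_ind (q := q)): x => [|u v hu hv|c u hu|i j u hu|u hu].
- by rewrite L1 mxE scale0r.
- by rewrite LD hu hv addr0.
- by rewrite LZ hu scaler0.
- rewrite LM hu mulr0 addr0 L_xg big1 ?mul0r // => p _.
  by rewrite /= mxE /= scale0r.
- by rewrite LM hu mulr0 addr0 L_dinv mxE /= scale0r mul0r.
Qed.

Let L00 x : L 0 0 x = x.
Proof.
have [LD LZ L0] := linearDZ (L_linear 0 0).
elim/(GLq3_ind (q := q)): x => [|u v hu hv|c u hu|i j u hu|u hu].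
- by rewrite L1 mxE scale1r.
- by rewrite LD hu hv.
- by rewrite LZ hu.
- rewrite LM hu L10 mulr0 addr0 L_xg (bigD1 j) //= big1 => [|p pj].
    by rewrite mxE /= eqxx scale1r addr0.
  by rewrite mxE /= (negbTE pj) scale0r.
- by rewrite LM hu L10 mulr0 addr0 L_dinv mxE /= scale1r.
Qed.

(** Take D = [L 0 1] and kp = [L 1 1]. With [L00] and [L10], the rule [LM] becomes the Leibniz rule
    and the multiplicativity of kp; h kills D because rho(1) has off-diagonal entry 0. *)
Lemma skew_exists : exists D kp : O -> O,
  [/\ skew_derivation h D kp, linear D, linear kp,
      (forall i j, D (xg q i j) = if j == t then xg q i s else 0)
      /\ (forall i j, kp (xg q i j) = kap j *: xg q i j)
    & D (dinv q) = 0 /\ kp (dinv q) = dinv q].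
Proof.
exists (L 0 1), (L 1 1); split.
- split=> [x y|x||x y].
  + by rewrite LM L00.
  + rewrite /L (haar_slice hh (el 0 1)) /rho_entry /rho.
    by rewrite (GLq3_eval1 (tri_gen_rel adj)) mxE mulr0.
  + by rewrite L1 mxE scale1r.
  + by rewrite LM L10 mul0r add0r.
- exact: L_linear.
- exact: L_linear.
- split=> i j; rewrite L_xg.
    case: eqP => [->|jt].
      rewrite (bigD1 s) //= big1 => [|p ps]; first by rewrite mxE /= !eqxx scale1r addr0.
      by rewrite mxE /= (negbTE ps) scale0r.
    by rewrite big1 // => p _; rewrite mxE /= (introF eqP jt) andbF scale0r.
  rewrite (bigD1 j) //= big1 => [|p pj]; first by rewrite mxE /= eqxx mul1r addr0.
  by rewrite mxE /= (negbTE pj) mul0r scale0r.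
- by rewrite !L_dinv !mxE scale0r scale1r.
Qed.
End Adjacent.
End Skew.

(** * Relations between the minors *)

Section Relations.
Variables (K : fieldType) (q : K).
Hypothesis q0 : q != 0.
Local Notation O := (GLq3 q).
Local Notation x := (@xg K q).
Local Notation lam := (q - q^-1).

Lemma xg_row (i j k : 'I_3) : (j < k)%N -> x i k * x i j = q^-1 *: (x i j * x i k).
Proof.
move=> jk; have /eqP := GLq3_relP (@GLq3_row _ _ _ (xg q) _ i j k jk).
by rewrite subr_eq0 => /eqP->; rewrite scalerA mulVf ?scale1r.
Qed.

Lemma xg_comm (i l j k : 'I_3) : (i < l)%N -> (j < k)%N -> x l j * x i k = x i k * x l j.
Proof.
move=> il jk; have /eqP := GLq3_relP (@GLq3_comm _ _ _ (xg q) _ i l j k il jk).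
by rewrite subr_eq0 => /eqP->.
Qed.

Lemma xg_cross (i l j k : 'I_3) : (i < l)%N -> (j < k)%N ->
  x l k * x i j = x i j * x l k - lam *: (x i k * x l j).
Proof.
move=> il jk; have /eqP := GLq3_relP (@GLq3_cross _ _ _ (xg q) _ i l j k il jk).
by rewrite subr_eq0 => /eqP->; rewrite addrK.
Qed.

Lemma dinvC i j : dinv q * x i j = x i j * dinv q.
Proof.
by have /eqP := GLq3_relP (@GLq3_central _ _ _ (xg q) _ i j); rewrite subr_eq0 => /eqP.
Qed.

Lemma Dq_dinv : Dq q * dinv q = 1.
Proof.
by have /eqP := GLq3_relP (@GLq3_inv _ _ _ (xg q) (dinv q)); rewrite subr_eq0 => /eqP.
Qed.

Lemma dinv_central u : dinv q * u = u * dinv q.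
Proof.
elim/(GLq3_ind (q := q)): u => [|u v hu hv|c u hu|i j u hu|u hu].
- by rewrite mulr1 mul1r.
- by rewrite mulrDl mulrDr hu hv.
- by rewrite -scalerAl -scalerAr hu.
- by rewrite mulrA dinvC -!mulrA hu.
- by rewrite -!mulrA hu.
Qed.

Lemma dinv_Dq : dinv q * Dq q = 1.
Proof. by rewrite dinv_central Dq_dinv. Qed.

(** [Dq] is the inverse of the central element [dinv], so no computation with the determinant is
    required. *)
Lemma Dq_central u : Dq q * u = u * Dq q.
Proof.
rewrite -[RHS]mul1r -Dq_dinv -mulrA [dinv q * (u * _)]mulrA dinv_central.
by rewrite -[u * _ * _]mulrA dinv_Dq mulr1.
Qed.

Definition minor2 (i l j k : 'I_3) : O := x i j * x l k - q *: (x i k * x l j).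

Local Notation a := (x lab1 lab1).
Local Notation b := (x lab1 lab2).
Local Notation c := (x lab1 lab3).
Local Notation d := (x lab2 lab1).
Local Notation e := (x lab2 lab2).
Local Notation f := (x lab2 lab3).
Local Notation g := (x lab3 lab1).
Local Notation h := (x lab3 lab2).
Local Notation k := (x lab3 lab3).
Local Notation A := (minor2 lab1 lab2 lab1 lab2).
Local Notation B := (minor2 lab1 lab2 lab1 lab3).
Local Notation C := (minor2 lab1 lab2 lab2 lab3).

Lemma row12_relation : C * a = q^-1 *: (B * b) - q ^- 2 *: (A * c).
Proof.
have fa : f * a = a * f - lam *: (c * d) by exact: xg_cross.
have ea : e * a = a * e - lam *: (b * d) by exact: xg_cross.
have fb : f * b = b * f - lam *: (c * e) by exact: xg_cross.
have ba : b * a = q^-1 *: (a * b) by exact: xg_row.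
have ca : c * a = q^-1 *: (a * c) by exact: xg_row.
have cb : c * b = q^-1 *: (b * c) by exact: xg_row.
have db : d * b = b * d by exact: xg_comm.
have dc : d * c = c * d by exact: xg_comm.
have ec : e * c = c * e by exact: xg_comm.
(* Coordinates on the three ordered words abf, ace, bcd, to which every product below reduces. *)
pose L u v w := u *: (a * (b * f)) + v *: (a * (c * e)) + w *: (b * (c * d)).
have LD u v w u' v' w' : L u v w + L u' v' w' = L (u + u') (v + v') (w + w').
  by rewrite /L !scalerDl addrACA [X in X + _ = _]addrACA.
have LZ s u v w : s *: L u v w = L (s * u) (s * v) (s * w) by rewrite /L !scalerDr !scalerA.
have LN u v w : - L u v w = L (- u) (- v) (- w) by rewrite /L !scaleNr !opprD.
have e1 : b * f * a = L q^-1 0 (- lam).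
  rewrite -mulrA fa mulrBr -scalerAr mulrA ba -scalerAl -mulrA /L scale0r addr0 scaleNr //.
have e2 : c * e * a = L 0 q^-1 (- lam * q^-1).
  rewrite -mulrA ea mulrBr -scalerAr !mulrA ca cb -!scalerAl -!mulrA /L scale0r add0r.
  by rewrite scalerA mulNr scaleNr.
have e3 : a * f * b = L 1 (- lam) 0.
  by rewrite -mulrA fb mulrBr -scalerAr /L scale0r addr0 scale1r scaleNr.
have e4 : c * d * b = L 0 0 q^-1.
  by rewrite -mulrA db mulrA cb -scalerAl -mulrA /L !scale0r !add0r.
have e5 : a * e * c = L 0 1 0.
  by rewrite -mulrA ec /L !scale0r add0r addr0 scale1r.
have e6 : b * d * c = L 0 0 1.
  by rewrite -mulrA dc /L !scale0r !add0r scale1r.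
rewrite /minor2 !mulrBl -!scalerAl e1 e2 e3 e4 e5 e6 !(LZ, LN, LD).
by congr L; field.
Qed.

Lemma Dq_expand : Dq q = a * (e * k) - q *: (b * (d * k)) - q *: (a * (f * h))
   + q ^+ 2 *: (b * (f * g)) + q ^+ 2 *: (c * (d * h)) - q ^+ 3 *: (c * (e * g)).
Proof. exact: qminor3. Qed.

(* Coordinates on the six ordered words of the quantum determinant. *)
Let L u1 u2 u3 u4 u5 u6 : O := u1 *: (a * (e * k)) + u2 *: (a * (f * h))
  + u3 *: (b * (d * k)) + u4 *: (b * (f * g)) + u5 *: (c * (d * h)) + u6 *: (c * (e * g)).

Let LD u1 u2 u3 u4 u5 u6 v1 v2 v3 v4 v5 v6 :
  L u1 u2 u3 u4 u5 u6 + L v1 v2 v3 v4 v5 v6 =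
  L (u1 + v1) (u2 + v2) (u3 + v3) (u4 + v4) (u5 + v5) (u6 + v6).
Proof. by rewrite /L !scalerDl; do 4 (rewrite addrACA; congr (_ + _)); rewrite addrACA. Qed.

Let LZ s u1 u2 u3 u4 u5 u6 :
  s *: L u1 u2 u3 u4 u5 u6 = L (s * u1) (s * u2) (s * u3) (s * u4) (s * u5) (s * u6).
Proof. by rewrite /L !scalerDr !scalerA. Qed.

Let LN u1 u2 u3 u4 u5 u6 :
  - L u1 u2 u3 u4 u5 u6 = L (- u1) (- u2) (- u3) (- u4) (- u5) (- u6).
Proof. by rewrite /L !scaleNr !opprD. Qed.

Let LDq : Dq q = L 1 (- q) (- q) (q ^+ 2) (q ^+ 2) (- q ^+ 3).
Proof. by rewrite Dq_expand /L !scaleNr scale1r [X in X + _ + _ - _]addrAC. Qed.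

Let Lsimp := (@scale0r K O, @add0r O, @addr0 O, @scale1r K O, @scaleNr K O).

Let ka : k * a = a * k - lam *: (c * g). Proof. exact: xg_cross. Qed.
Let ke : k * e = e * k - lam *: (f * h). Proof. exact: xg_cross. Qed.
Let kb : k * b = b * k - lam *: (c * h). Proof. exact: xg_cross. Qed.
Let kd : k * d = d * k - lam *: (f * g). Proof. exact: xg_cross. Qed.
Let hd : h * d = d * h - lam *: (e * g). Proof. exact: xg_cross. Qed.
Let ha : h * a = a * h - lam *: (b * g). Proof. exact: xg_cross. Qed.
Let ea : e * a = a * e - lam *: (b * d). Proof. exact: xg_cross. Qed.
Let fa : f * a = a * f - lam *: (c * d). Proof. exact: xg_cross. Qed.
Let fb : f * b = b * f - lam *: (c * e). Proof. exact: xg_cross. Qed.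
Let ge : g * e = e * g. Proof. exact: xg_comm. Qed.
Let gf : g * f = f * g. Proof. exact: xg_comm. Qed.
Let gb : g * b = b * g. Proof. exact: xg_comm. Qed.
Let gc : g * c = c * g. Proof. exact: xg_comm. Qed.
Let hf : h * f = f * h. Proof. exact: xg_comm. Qed.
Let hc : h * c = c * h. Proof. exact: xg_comm. Qed.
Let ec : e * c = c * e. Proof. exact: xg_comm. Qed.
Let db : d * b = b * d. Proof. exact: xg_comm. Qed.
Let dc : d * c = c * d. Proof. exact: xg_comm. Qed.

(** Laplace expansion of the determinant along row 3, entries on the left. Multiplied by [dinv] it
    becomes the relation [tm1]; [row1_sphere], with row 1 on the right, becomes [sx1]. *)
Lemma row3_sphere :
  k * A - q^-1 *: (h * B) + q ^- 2 *: (g * C) = Dq q.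
Proof.
have e1 : k * (a * e) = L 1 (- lam) 0 0 0 (- lam).
  by rewrite mulrA ka mulrBl -scalerAl -!mulrA ke ge mulrBr -scalerAr /L !Lsimp.
have e2 : k * (b * d) = L 0 0 1 (- lam) (- lam) (lam ^+ 2).
  rewrite mulrA kb mulrBl -scalerAl -!mulrA kd hd !mulrBr -!scalerAr /L !Lsimp.
  by rewrite scalerBr opprB scalerA addrA expr2 [RHS]addrAC.
have e3 : h * (a * f) = L 0 1 0 (- lam) 0 0.
  by rewrite mulrA ha mulrBl -scalerAl -!mulrA hf gf /L !Lsimp.
have e4 : h * (c * d) = L 0 0 0 0 1 (- lam).
  by rewrite mulrA hc -mulrA hd mulrBr -scalerAr /L !Lsimp.
have e5 : g * (b * f) = L 0 0 0 1 0 0 by rewrite mulrA gb -mulrA gf /L !Lsimp.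
have e6 : g * (c * e) = L 0 0 0 0 0 1 by rewrite mulrA gc -mulrA ge /L !Lsimp.
rewrite /minor2 !mulrBr -!scalerAr e1 e2 e3 e4 e5 e6 LDq !(LZ, LN, LD).
by congr L; field.
Qed.

Lemma row1_sphere :
  minor2 lab2 lab3 lab2 lab3 * a - q^-1 *: (minor2 lab2 lab3 lab1 lab3 * b)
  + q ^- 2 *: (minor2 lab2 lab3 lab1 lab2 * c) = Dq q.
Proof.
have e1 : e * k * a = L 1 0 (- lam) 0 0 (- lam).
  rewrite -mulrA ka mulrBr -scalerAr !mulrA ea ec mulrBl -scalerAl -!mulrA /L !Lsimp.
  by [].
have e2 : f * h * a = L 0 1 0 (- lam) (- lam) (lam ^+ 2).
  rewrite -mulrA ha mulrBr -scalerAr !mulrA fa fb !mulrBl -!scalerAl -!mulrA /L !Lsimp.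
  by rewrite scalerBr opprB scalerA [X in _ + X = _]addrC addrA [X in X + _ = _]addrAC expr2.
have e3 : d * k * b = L 0 0 1 0 (- lam) 0.
  by rewrite -mulrA kb mulrBr -scalerAr !mulrA db dc -!mulrA /L !Lsimp.
have e4 : f * g * b = L 0 0 0 1 0 (- lam).
  by rewrite -mulrA gb mulrA fb mulrBl -scalerAl -!mulrA /L !Lsimp.
have e5 : d * h * c = L 0 0 0 0 1 0 by rewrite -mulrA hc mulrA dc -mulrA /L !Lsimp.
have e6 : e * g * c = L 0 0 0 0 0 1 by rewrite -mulrA gc mulrA ec -mulrA /L !Lsimp.
rewrite /minor2 !mulrBl -!scalerAl e1 e2 e3 e4 e5 e6 LDq !(LZ, LN, LD).
by congr L; field.
Qed.
End Relations.

(** * The unitary structure *)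

Local Open Scope complex_scope.

Section Morphism.
Variables (F F' : fieldType) (m : {rmorphism F -> F'}).

Lemma rmorph_qpoch x p n : m (qpoch x p n) = qpoch (m x) (m p) n.
Proof.
rewrite /qpoch rmorph_prod; apply: eq_bigr => i _.
by rewrite rmorphB rmorph1 rmorphM rmorphXn.
Qed.

Lemma rmorph_qbinom p n j : m (qbinom p n j) = qbinom (m p) n j.
Proof.
by rewrite /qbinom; case: ifP; rewrite ?rmorph0 // fmorph_div rmorphM !rmorph_qpoch.
Qed.

(** The recursions live over the complex numbers, while the theorem states a real value; this
    carries one to the other. *)
Lemma rmorph_gram_val q d1 d2 c1 c2 c3 k :
  m (gram_val q d1 d2 c1 c2 c3 k) = gram_val (m q) d1 d2 c1 c2 c3 k.
Proof.
rewrite /gram_val !rmorphM fmorphV !rmorphM rmorph_sum !rmorph_qpoch.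
rewrite !(rmorphXn, rmorphB, rmorph1).
congr (_ * _); apply: eq_bigr => j _.
rewrite !rmorphM fmorphV rmorph_sum !rmorph_qpoch !rmorph_qbinom.
rewrite !(rmorphXn, rmorphN, rmorph1); congr (_ * _); apply: eq_bigr => p _.
by rewrite !rmorphM !rmorph_qpoch !rmorph_qbinom !rmorphXn.
Qed.
End Morphism.

(** * The derivations on 2 x 2 minors *)

Section SkewMinors.
Variables (K : fieldType) (q : K) (h : {scalar GLq3 q}) (s t : 'I_3) (kap : 'I_3 -> K).
Variables (D kp : GLq3 q -> GLq3 q).
Hypothesis q0 : q != 0.
Hypothesis sk : skew_derivation h D kp.
Hypotheses (Dl : linear D) (kl : linear kp).
Hypothesis Dx : forall i j, D (xg q i j) = if j == t then xg q i s else 0.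
Hypothesis kx : forall i j, kp (xg q i j) = kap j *: xg q i j.
Hypotheses (Dd : D (dinv q) = 0) (kd : kp (dinv q) = dinv q).

Lemma skewZ c u : D (c *: u) = c *: D u.
Proof. by have [_ Z _] := linearDZ Dl; exact: Z. Qed.

Lemma kapZ c u : kp (c *: u) = c *: kp u.
Proof. by have [_ Z _] := linearDZ kl; exact: Z. Qed.

Lemma linearB_of (f : GLq3 q -> GLq3 q) : linear f -> forall u v, f (u - v) = f u - f v.
Proof.
by move=> fl u v; have [AD Z _] := linearDZ fl; rewrite AD -scaleN1r Z scaleN1r.
Qed.

Lemma skew_mi i l j k : D (minor2 q i l j k) =
  (if k == t then xg q i j * xg q l s else 0)
  + (if j == t then kap k *: (xg q i s * xg q l k) else 0)
  - q *: ((if j == t then xg q i k * xg q l s else 0)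
          + (if k == t then kap j *: (xg q i s * xg q l j) else 0)).
Proof.
rewrite /minor2 (linearB_of Dl) skewZ !(skewM sk) !Dx !kx -!scalerAr.
by congr (_ + _ - _ *: (_ + _)); case: ifP; rewrite ?mulr0 ?mul0r ?scaler0.
Qed.

Lemma kap_mi i l j k : kp (minor2 q i l j k) = (kap j * kap k) *: minor2 q i l j k.
Proof.
rewrite /minor2 (linearB_of kl) kapZ !(kapM sk) !kx -!scalerAr -!scalerAl !scalerA.
rewrite scalerBr !scalerA; congr (_ *: _ - _ *: _); ring.
Qed.

Lemma skew_dinv u : D (u * dinv q) = D u * dinv q.
Proof. by rewrite (skewM sk) Dd mulr0 add0r kd. Qed.

Lemma kap_dinv u : kp (u * dinv q) = kp u * dinv q.
Proof. by rewrite (kapM sk) kd. Qed.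
End SkewMinors.

Section Star.
Variables (R : realType) (q : R).
Hypotheses (q0 : q != 0) (q1 : q != 1) (qN1 : q != -1).
Local Notation Q := (q%:C).
Local Notation O := (GLq3 Q).
Variable star : O -> O.
Hypothesis hstar : is_star star.

Lemma complex_q_neq0 : Q != 0.
Proof. by rewrite (fmorph_eq0 (real_complex R)). Qed.

(** Realness of q enters here: q^2 is a nonnegative real different from 1, hence no root of
    unity. *)
Lemma complex_q2_pow_neq1 n : (Q ^+ 2) ^+ n.+1 != 1.
Proof.
rewrite -!(rmorphXn (real_complex R)) -(rmorph1 (real_complex R)) (inj_eq (@fmorph_inj _ _ _)).
by rewrite pexpr_eq1 ?sqr_ge0 // sqrf_eq1 negb_or q1 qN1.
Qed.

Lemma star0 : star 0 = 0.
Proof.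
have := star_conj_linear hstar 1 0 0; rewrite scaler0 addr0 conjc1 scale1r.
by rewrite -[X in X = _]addr0 => /addrI.
Qed.

Lemma starD u v : star (u + v) = star u + star v.
Proof. by rewrite -{1}[u]scale1r (star_conj_linear hstar) conjc1 scale1r. Qed.

Lemma starZ (c : R) u : star (c%:C *: u) = c%:C *: star u.
Proof. by rewrite -[c%:C *: u]addr0 (star_conj_linear hstar) star0 addr0 conjc_real. Qed.

Lemma starN u : star (- u) = - star u.
Proof. by apply/eqP; rewrite -addr_eq0 addrC -starD subrr star0. Qed.

Lemma starZV n u : star (Q ^- n *: u) = Q ^- n *: star u.
Proof. by rewrite -(rmorphXn (real_complex R)) -(fmorphV (real_complex R)) starZ. Qed.

Lemma star1 : star 1 = 1.
Proof.
by have := star_antimul hstar (star 1) 1; rewrite mulr1 (star_involutive hstar) mulr1 => <-.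
Qed.

Lemma starX u n : star (u ^+ n) = star u ^+ n.
Proof.
elim: n => [|n IH]; first by rewrite !expr0 star1.
by rewrite exprS (star_antimul hstar) IH exprSr.
Qed.

(** The star reverses products, so the order of the pair is reversed too; this explains the
    descending indices of the rules for s and t. *)
Lemma star_qcomm u v : qcomm Q u v -> qcomm Q (star v) (star u).
Proof.
rewrite /qcomm => e; rewrite -!(star_antimul hstar) e.
by rewrite -[Q^-1](fmorphV (real_complex R)) starZ.
Qed.

Lemma qcommZ (a b : R[i]) (u v : O) : qcomm Q u v -> qcomm Q (a *: u) (b *: v).
Proof.
rewrite /qcomm => e; rewrite -!(scalerAl, scalerAr) e !scalerA.
by congr (_ *: _); rewrite mulrC -mulrA mulrC [b * a]mulrC; ring.
Qed.

Local Notation x1 := (xg Q lab1 lab1).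
Local Notation x2 := (xg Q lab1 lab2).
Local Notation x3 := (xg Q lab1 lab3).
Local Notation m1 := (star (xg Q lab3 lab3)).
Local Notation m2 := (- Q *: star (xg Q lab3 lab2)).
Local Notation m3 := (Q ^+ 2 *: star (xg Q lab3 lab1)).
Local Notation t1 := (xg Q lab3 lab3).
Local Notation t2 := (- Q *: xg Q lab3 lab2).
Local Notation t3 := (Q ^+ 2 *: xg Q lab3 lab1).

Lemma xi_mi i l j k (I J : {set 'I_3}) :
  enum I = [:: i; l] -> enum J = [:: j; k] -> xi Q I J = minor2 Q i l j k.
Proof. exact: qminor2. Qed.

Lemma m1E : m1 = minor2 Q lab1 lab2 lab1 lab2 * dinv Q.
Proof.
have [e1 e2 e3] := enumC1.
by rewrite (star_xg hstar) (xi_mi e3 e3) subrr expr0z scale1r.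
Qed.

(** The factors -q here and q^2 in [m3E] cancel the power of -q in the star of a generator, leaving
    a bare minor times [dinv]. *)
Lemma m2E : m2 = minor2 Q lab1 lab2 lab1 lab3 * dinv Q.
Proof.
have [e1 e2 e3] := enumC1.
rewrite (star_xg hstar) (xi_mi e3 e2) (_ : _ - _ = -1) // exprN1 scalerA.
by rewrite divff ?scale1r // oppr_eq0 complex_q_neq0.
Qed.

Lemma m3E : m3 = minor2 Q lab1 lab2 lab2 lab3 * dinv Q.
Proof.
have [e1 e2 e3] := enumC1.
rewrite (star_xg hstar) (xi_mi e3 e1) (_ : _ - _ = - 2%:Z) // -exprnN scalerA.
by rewrite sqrrN divff ?scale1r // expf_neq0 ?complex_q_neq0.
Qed.

Lemma s1E : star x1 = minor2 Q lab2 lab3 lab2 lab3 * dinv Q.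
Proof.
have [e1 e2 e3] := enumC1.
by rewrite (star_xg hstar) (xi_mi e1 e1) subrr expr0z scale1r.
Qed.

Lemma s2E : star x2 = - Q *: (minor2 Q lab2 lab3 lab1 lab3 * dinv Q).
Proof.
have [e1 e2 e3] := enumC1.
by rewrite (star_xg hstar) (xi_mi e1 e2) (_ : _ - _ = 1) // expr1z.
Qed.

Lemma s3E : star x3 = Q ^+ 2 *: (minor2 Q lab2 lab3 lab1 lab2 * dinv Q).
Proof.
have [e1 e2 e3] := enumC1.
by rewrite (star_xg hstar) (xi_mi e1 e3) (_ : _ - _ = 2%:Z) // -exprnP sqrrN.
Qed.

Lemma star_m1 : star m1 = t1. Proof. exact: star_involutive hstar _. Qed.
Lemma star_m2 : star m2 = t2.
Proof. by rewrite -(rmorphN (real_complex R)) starZ (star_involutive hstar). Qed.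
Lemma star_m3 : star m3 = t3.
Proof. by rewrite -(rmorphXn (real_complex R)) starZ (star_involutive hstar). Qed.

Variables (Delta : {lrmorphism O -> GLq3_tens Q}) (hDelta : is_comult Delta).
Variables (h : {scalar O}) (hh : is_haar Delta h).

Lemma gram_star d1 r c1 n c3 k :
  gram h x1 x2 x3 m1 m2 (star x1) (star x2) (star x3) t1 t2
    d1 (k + r) c1 (k + n) c3 (d1 + k) r c1 n (c3 + k) =
  gram_val Q d1 (k + r) c1 (k + n) c3 k.
Proof.
have nz := complex_q_neq0.
have adjE1 : adjacent Q lab1 lab2 (kap12 Q) by apply: Or31.
have adjF1 : adjacent Q lab2 lab1 (kap12 Q) by apply: Or32.
have adjE2 : adjacent Q lab2 lab3 (kap23 Q) by apply: Or33.
have [E1 [kE1 [skE1 E1l kE1l [E1x kE1x] [E1d kE1d]]]] :=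
  skew_exists complex_q_neq0 hDelta hh adjE1.
have [F1 [kF1 [skF1 F1l kF1l [F1x kF1x] [F1d kF1d]]]] :=
  skew_exists complex_q_neq0 hDelta hh adjF1.
have [E2 [kE2 [skE2 E2l kE2l [E2x kE2x] [E2d kE2d]]]] :=
  skew_exists complex_q_neq0 hDelta hh adjE2.
have rowQ i (j l : 'I_3) : (j < l)%N -> qcomm Q (xg Q i j) (xg Q i l) by exact: xg_row.
have t32 : qcomm Q t3 t2 by apply: qcommZ; exact: rowQ.
have t31 : qcomm Q t3 t1 by rewrite -[t1]scale1r; apply: qcommZ; exact: rowQ.
have t21 : qcomm Q t2 t1 by rewrite -[t1]scale1r; apply: qcommZ; exact: rowQ.
have m3x1 : m3 * x1 = Q^-1 *: (m2 * x2) - Q ^- 2 *: (m1 * x3).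
  rewrite m1E m2E m3E -!mulrA !dinv_central !mulrA row12_relation //.
  by rewrite mulrBl -!scalerAl.
(* The adjoint of [m3x1], whose coefficients are real. *)
have s1t3 : star x1 * t3 = Q^-1 *: (star x2 * t2) - Q ^- 2 *: (star x3 * t1).
  have := congr1 star m3x1; rewrite (star_antimul hstar) star_m3 => ->.
  rewrite starD starN -[Q^-1]/(Q ^- 1) !starZV.
  by rewrite !(star_antimul hstar) star_m2 star_m1.
have tm1 : t1 * m1 + Q ^- 2 *: (t2 * m2) + Q ^- 4 *: (t3 * m3) = 1.
  rewrite m1E m2E m3E -(Dq_dinv Q) -(row3_sphere complex_q_neq0).
  move: (minor2 _ _ _ _ _) (minor2 _ _ _ _ _) (minor2 _ _ _ _ _) (dinv _) => u v w z.
  rewrite !mulrDl mulNr !mulrA -!scalerAl !scalerA -scaleNr.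
  by congr (_ + _ *: _ + _ *: _); field.
have sx1 : star x1 * x1 + Q ^- 2 *: (star x2 * x2) + Q ^- 4 *: (star x3 * x3) = 1.
  rewrite s1E s2E s3E -(Dq_dinv Q) -(row1_sphere complex_q_neq0) -!scalerAl.
  move: (minor2 _ _ _ _ _) (minor2 _ _ _ _ _) (minor2 _ _ _ _ _) => u v w.
  rewrite -!mulrA !dinv_central !mulrDl mulNr -!scalerAl !mulrA !scalerA -scaleNr.
  by congr (_ + _ *: _ + _ *: _); field.
have mE1 := skew_mi skE1 E1l E1x kE1x; have kmE1 := kap_mi skE1 kE1l kE1x.
have mF1 := skew_mi skF1 F1l F1x kF1x; have kmF1 := kap_mi skF1 kF1l kF1x.
have mE2 := skew_mi skE2 E2l E2x kE2x; have kmE2 := kap_mi skE2 kE2l kE2x.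
have dE1 := skew_dinv skE1 E1d kE1d; have kdE1 := kap_dinv skE1 kE1d.
have dF1 := skew_dinv skF1 F1d kF1d; have kdF1 := kap_dinv skF1 kF1d.
have dE2 := skew_dinv skE2 E2d kE2d; have kdE2 := kap_dinv skE2 kE2d.
(* These scalar rules normalize the coefficients met when the derivations act on minors and on
   adjoints. *)
have VQ (u : O) : u - Q *: (Q^-1 *: u) = 0 by rewrite scalerA divff // scale1r subrr.
have NQ (u : O) : u = - Q^-1 *: (- Q *: u) by rewrite scalerA mulrNN mulVf // scale1r.
have SC (a b : R[i]) (u : O) : a *: (b *: u) = b *: (a *: u) by rewrite !scalerA mulrC.
have NQ2 (u : O) : - Q *: u = - Q^-1 *: (Q ^+ 2 *: u).
  by rewrite scalerA; congr (_ *: _); field.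
pose simp := (addr0, add0r, scaler0, subr0, oppr0, scale1r, subrr, mul0r, VQ).
have E1mi i l : [/\ E1 (minor2 Q i l lab1 lab2) = 0,
      E1 (minor2 Q i l lab1 lab3) = 0
    & E1 (minor2 Q i l lab2 lab3) = minor2 Q i l lab1 lab3].
  by rewrite !mE1 /kap12 /= !simp.
have F1mi i l : [/\ F1 (minor2 Q i l lab1 lab2) = 0,
      F1 (minor2 Q i l lab1 lab3) = minor2 Q i l lab2 lab3
    & F1 (minor2 Q i l lab2 lab3) = 0].
  by rewrite !mF1 /kap12 /= !simp.
have E2mi i l : [/\ E2 (minor2 Q i l lab1 lab2) = 0,
      E2 (minor2 Q i l lab1 lab3) = minor2 Q i l lab1 lab2
    & E2 (minor2 Q i l lab2 lab3) = 0].
  by rewrite !mE2 /kap23 /= !simp.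
have E1Z := skewZ E1l; have F1Z := skewZ F1l; have E2Z := skewZ E2l.
have kE1Z := kapZ kE1l; have kF1Z := kapZ kF1l; have kE2Z := kapZ kE2l.
have [E1a1 E1a2 E1a3] := E1mi lab1 lab2; have [E1b1 E1b2 E1b3] := E1mi lab2 lab3.
have [F1a1 F1a2 F1a3] := F1mi lab1 lab2; have [F1b1 F1b2 F1b3] := F1mi lab2 lab3.
have [E2a1 E2a2 E2a3] := E2mi lab1 lab2; have [E2b1 E2b2 E2b3] := E2mi lab2 lab3.
(* The m_i inherit their q-commutation from row 3 through the star. *)
have st2 : star t2 = m2 by rewrite -star_m2 (star_involutive hstar).
have st3 : star t3 = m3 by rewrite -star_m3 (star_involutive hstar).
apply: (gram_eq_val (m3 := m3) (t3 := t3) (E1 := E1) (kE1 := kE1) (F1 := F1) (kF1 := kF1)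
  (E2 := E2) (kE2 := kE2) nz complex_q2_pow_neq1) => //; do ?exact: rowQ.
- by rewrite -st2; apply: star_qcomm.
- by rewrite -st3; apply: star_qcomm.
- by rewrite -st2 -st3; apply: star_qcomm.
- by apply: star_qcomm; apply: rowQ.
- by apply: star_qcomm; apply: rowQ.
- by apply: star_qcomm; apply: rowQ.
- by rewrite !E1x /= scale1r.
- by rewrite m1E m2E m3E !dE1 E1a1 E1a2 E1a3 mul0r scale1r.
- rewrite s1E s2E s3E !E1Z !dE1 E1b1 E1b2 E1b3 mul0r !scaler0; split=> //; exact: NQ.
- by rewrite !E1Z !E1x /= !scaler0; split=> //; exact: NQ2.
- by rewrite m1E m2E m3E !kdE1 !kmE1 -!scalerAl /kap12 /= mulVf // !mulr1.
- rewrite s1E s2E s3E !kE1Z !kdE1 !kmE1 -!scalerAl /kap12 /= mulVf // !mulr1.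
  by split=> //; exact: SC.
- by rewrite !kE1Z !kE1x /kap12 /=; split=> //; exact: SC.
- by rewrite !F1x /= scale1r.
- by rewrite m1E m2E m3E !dF1 F1a1 F1a2 F1a3 mul0r scale1r.
- by rewrite s1E s2E s3E !F1Z !dF1 F1b1 F1b2 F1b3 mul0r !scaler0; split.
- by rewrite !F1Z !F1x /= !scaler0.
- by rewrite m1E m2E m3E !kdF1 !kmF1 -!scalerAl /kap12 /= mulVf // !mulr1.
- rewrite s1E s2E s3E !kF1Z !kdF1 !kmF1 -!scalerAl /kap12 /= mulVf // !mulr1.
  by split=> //; exact: SC.
- by rewrite !kF1Z !kF1x /kap12 /=; split=> //; exact: SC.
- by rewrite !E2x /= scale1r.
- by rewrite m1E m2E !dE2 E2a1 E2a2 mul0r scale1r.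
- rewrite s1E s2E s3E !E2Z !dE2 E2b1 E2b2 E2b3 mul0r !scaler0; split=> //; exact: NQ2.
- by rewrite !E2Z !E2x /= !scaler0; split=> //; exact: NQ.
- by rewrite m1E m2E !kdE2 !kmE2 -!scalerAl /kap23 /= !mul1r.
- rewrite s1E s2E s3E !kE2Z !kdE2 !kmE2 -!scalerAl /kap23 /= mulVf // !mul1r.
  by split=> //; exact: SC.
- by rewrite !kE2Z !kE2x /kap23 /=; split=> //; exact: SC.
- exact: haar1 hh.
Qed.
End Star.

Theorem theorem5p8 (R : realType) (q : R)
  (hq0 : q != 0) (hq1 : q != 1) (hqN1 : q != -1)
  (Delta : {lrmorphism GLq3 q%:C -> GLq3_tens q%:C}) (hDelta : is_comult Delta)
  (star : GLq3 q%:C -> GLq3 q%:C) (hstar : is_star star)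
  (h : {scalar GLq3 q%:C}) (hh : is_haar Delta h)
  (l1 l2 : nat) (hl2 : (0 < l2)%N) (hl12 : (l2 < l1)%N)
  (mu : 'I_3 -> nat) (T0 : tableau) (hT0 : is_T0 l1 l2 mu T0)
  (hA : forall T, is_ssyt l1 l2 mu T -> typeA T)
  (i k d1 d2 c1 c2 c3 : nat) (hk : (k <= minn d2 c2)%N)
  (vi vik : GLq3 q%:C)
  (hi : basis_vec q%:C T0 i = Some vi)
  (hik : basis_vec q%:C T0 (i + k) = Some vik)
  (hvi : vi = star (xg q%:C lab3 lab3) ^+ d1
              * (- q%:C *: star (xg q%:C lab3 lab2)) ^+ d2
              * xg q%:C lab1 lab1 ^+ c1 * xg q%:C lab1 lab2 ^+ c2
              * xg q%:C lab1 lab3 ^+ c3 * Dq q%:C ^+ (d1 + d2))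
  (hvik : vik = star (xg q%:C lab3 lab3) ^+ (d1 + k)
              * (- q%:C *: star (xg q%:C lab3 lab2)) ^+ (d2 - k)
              * xg q%:C lab1 lab1 ^+ c1 * xg q%:C lab1 lab2 ^+ (c2 - k)
              * xg q%:C lab1 lab3 ^+ (c3 + k) * Dq q%:C ^+ (d1 + d2)) :
  innerL star h vi vik =
  (q ^+ (2 * d1 * d2 + 4 * d1 + 4 * d2 + 2 * c1 * c2 + 2 * c1 * c3 + 2 * c2 * c3
         + 4 * c1 + 4 * c2 + 4 * c3 + k * (d2 + c2 - k))
   * ((1 - q ^+ 2) ^+ 2 * (1 - q ^+ 4)
      * qpoch (q ^+ 2) (q ^+ 2) d2 * qpoch (q ^+ 2) (q ^+ 2) c2
      / (qpoch (q ^+ 2) (q ^+ 2) (d1 + d2 + 1)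
         * qpoch (q ^+ 2) (q ^+ 2) (c1 + c2 + c3 + 1)))
   * \sum_(0 <= j < c3.+1)
       ((-1) ^+ j * q ^+ (j ^ 2 - j)
        * qbinom (q ^+ 2) d1 j * qbinom (q ^+ 2) c3 j * qpoch (q ^+ 2) (q ^+ 2) j
        / qpoch (q ^+ (2 * d1 + 2 * d2 + 2 * c1 + 2 * c3 + 4 - 2 * j)) (q ^+ 2)
                (c2 + 1)
        * \sum_(0 <= p < (c2 - k).+1)
            q ^+ ((2 * d1 + 2 * d2 + 2 * c3 + 2 - 2 * j) * p)
            * qpoch (q ^+ 2) (q ^+ 2) (c1 + p)
            * qpoch (q ^+ 2) (q ^+ 2) (d1 + c2 + c3 - j - p)
            * qbinom (q ^+ 2) (c2 - k) p))%:C.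
Proof.
move: hk; rewrite leq_min => /andP[kd2 kc2].
have SM := star_antimul hstar.
have starXn := starX hstar.
have DC n (u : GLq3 q%:C) : Dq q%:C ^+ n * u = u * Dq q%:C ^+ n.
  by apply/esym/commrX => //; exact/esym/Dq_central.
have dD n : dinv q%:C ^+ n * Dq q%:C ^+ n = 1.
  elim: n => [|n IH]; first by rewrite !expr0 mulr1.
  by rewrite exprS exprSr -mulrA [_ * (_ * Dq _)]mulrA IH mul1r dinv_Dq.
rewrite /innerL hvi hvik !SM !starXn (star_Dq hstar) (star_m1 hstar) (star_m2 hstar).
(* The adjoint of the first vector begins with a power of [dinv]; bringing the equal power of the
   central [Dq] to the front of the second vector makes the two cancel. *)
rewrite -[_ * _ * Dq _ ^+ _]DC.
have dC n (u v : GLq3 q%:C) : dinv q%:C ^+ n * u * (Dq q%:C ^+ n * v) = u * v.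
  have -> : dinv q%:C ^+ n * u = u * dinv q%:C ^+ n.
    by apply/esym/commrX; exact/esym/dinv_central.
  by rewrite -mulrA [dinv _ ^+ n * _]mulrA dD mul1r.
rewrite dC.
have := gram_star hq0 hq1 hqN1 hstar hDelta hh d1 (d2 - k) c1 (c2 - k) c3 k.
(* The bounds on k allow d2 = k + (d2 - k) and c2 = k + (c2 - k), the shape required by
   [gram_star]. *)
rewrite !subnKC // -(rmorph_gram_val (real_complex R)) /gram /bra /ket => <-.
by rewrite !mulrA.
Qed.
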